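(* Let $q$ be a complex number with $|q|<1$ and let $\omega=e^{2\pi i/3}$. Then $$\oint \frac{(q^6 z, q^3 z, 1/z;q^3)_\infty}{(q^4 z, \omega q^4 z, \omega^2 q^4z; q^3)_\infty}\frac{dz}{2\pi i z} = H\left(\frac{(q^4,q^2,q^{-1};q^3)_\infty}{(q^9;q^9)_\infty}\sum_{n\ge 0} \frac{(-1)^n q^{3\binom{n}{2}+4n}(q;q^3)_n}{(q^9;q^9)_n}\right),$$ where the integral is over a positively oriented contour separating $0$ from all poles of the integrand.
   Context: For $n\in\mathbb{N}\cup\{\infty\}$, $(A;q)_n:=\prod_{k=0}^{n-1}(1-Aq^k)$ and $(A_1,\ldots,A_m;q)_n:=(A_1;q)_n\cdots(A_m;q)_n$. The huffing operator $H$ acts on a (Laurent) series in $q$ by $H\left(\sum_n a(n)q^n\right):=\sum_n a(3n)q^{3n}$, i.e. it keeps exactly the terms whose exponent of $q$ is divisible by $3$ (the expression inside $H$ is expanded as a Laurent series in $q$). *)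

(* Defs.v *)
From Stdlib Require Import Reals ZArith.
From Coquelicot Require Import Coquelicot.

Open Scope C_scope.

Fixpoint qpoch (A q : C) (n : nat) : C :=
  match n with
  | O => 1
  | S k => qpoch A q k * (1 - A * q ^ k)
  end.

Definition qpoch_inf (A q : C) : C :=
  iota (T := C_CompleteNormedModule)
    (fun l : C => filterlim (qpoch A q) eventually (locally l)).

Definition qpoch_inf3 (A1 A2 A3 q : C) : C :=
  qpoch_inf A1 q * qpoch_inf A2 q * qpoch_inf A3 q.

Definition CSeries (u : nat -> C) : C :=
  iota (T := C_CompleteNormedModule)
    (fun l : C => is_series (V := C_NormedModule) u l).

(* Both one-sided series are required to converge. For q = 0 the negative part
   makes sense only when the coefficients of negative index vanish; it is then
   identically zero, and the sum is a 0. *)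
Definition is_laurent_sum (a : Z -> C) (q l : C) : Prop :=
  exists lp lm : C,
    is_series (V := C_NormedModule)
      (fun n : nat => a (Z.of_nat n) * q ^ n) lp /\
    is_series (V := C_NormedModule)
      (fun n : nat => a (- Z.of_nat (S n))%Z * (/ q) ^ S n) lm /\
    l = lp + lm.

(* Expansion in the punctured unit disc, with finite principal part. *)
Definition is_laurent_expansion (F : C -> C) (a : Z -> C) : Prop :=
  (exists N : Z, forall n : Z, (n < N)%Z -> a n = 0) /\
  (forall q : C, (0 < Cmod q < 1)%R -> is_laurent_sum a q (F q)).

Definition huff (a : Z -> C) (n : Z) : C :=
  if (n mod 3 =? 0)%Z then a n else 0.

(* l is the value at q of H(F); the coefficients a are determined by F. *)
Definition is_huffing (F : C -> C) (q l : C) : Prop :=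
  exists a : Z -> C, is_laurent_expansion F a /\ is_laurent_sum (huff a) q l.

(* All contours are parametrised by [0, 1]. The derivative on each piece extends continuously to the end points of the
   piece. *)
Definition piecewise_C1 (g : R -> C) : Prop :=
  continuous_on (T := R_UniformSpace) (U := C_UniformSpace)
    (fun t : R => (0 <= t <= 1)%R) g /\
  exists (n : nat) (t : nat -> R),
    t O = 0%R /\ t n = 1%R /\
    forall i : nat, (i < n)%nat ->
      (t i < t (S i))%R /\
      exists d : R -> C,
        (forall s : R,
           continuous (T := R_UniformSpace) (U := C_UniformSpace) d s) /\
        (forall s : R, (t i < s < t (S i))%R ->
           is_derive (V := C_R_NormedModule) g s (d s)).

Definition simple_closed_contour (g : R -> C) : Prop :=
  piecewise_C1 g /\
  g 0%R = g 1%R /\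
  (forall s t : R, (0 <= s < 1)%R -> (0 <= t < 1)%R -> g s = g t -> s = t).

Definition path_derive (g : R -> C) (t : R) : C :=
  (Derive (fun s : R => Re (g s)) t, Derive (fun s : R => Im (g s)) t).

(* path_derive g is arbitrary at the finitely many break points of g, which do
   not affect the Riemann integral. *)
Definition is_contour_integral (g : R -> C) (f : C -> C) (l : C) : Prop :=
  is_RInt (V := C_R_NormedModule)
    (fun t : R => f (g t) * path_derive g t) 0%R 1%R l.

Definition is_winding_number (g : R -> C) (p w : C) : Prop :=
  (forall t : R, (0 <= t <= 1)%R -> g t <> p) /\
  is_contour_integral g (fun z : C => / (2 * PI * Ci * (z - p))) w.

(* For a simple closed contour, winding number 1 means that p is inside and the
   contour is positively oriented; winding number 0 means that p is outside. *)
Definition positively_encloses (g : R -> C) (p : C) : Prop :=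
  is_winding_number g p 1.

Definition leaves_outside (g : R -> C) (p : C) : Prop :=
  is_winding_number g p 0.

Definition is_pole (f : C -> C) (p : C) : Prop :=
  filterlim (fun z : C => Cmod (f z))
    (locally' (T := C_UniformSpace) p) (Rbar_locally p_infty).

(* 0 itself is an essential singularity of the integrand below when q <> 0, and
   a pole when q = 0; hence the restriction to p <> 0. *)
Definition separates_0_from_poles (g : R -> C) (f : C -> C) : Prop :=
  positively_encloses g 0 /\
  (forall p : C, p <> 0 -> is_pole f p -> leaves_outside g p).

Definition omega : C := (cos (2 * PI / 3), sin (2 * PI / 3)).

Definition integrand (q z : C) : C :=
  qpoch_inf3 (q ^ 6 * z) (q ^ 3 * z) (/ z) (q ^ 3) /
  qpoch_inf3 (q ^ 4 * z) (omega * q ^ 4 * z) (omega ^ 2 * q ^ 4 * z) (q ^ 3) /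
  (2 * PI * Ci * z).

Definition huffed_function (q : C) : C :=
  qpoch_inf3 (q ^ 4) (q ^ 2) (/ q) (q ^ 3) / qpoch_inf (q ^ 9) (q ^ 9) *
  CSeries (fun n : nat =>
    (- (1)) ^ n * q ^ (3 * (n * (n - 1) / 2) + 4 * n)%nat *
    qpoch q (q ^ 3) n / qpoch (q ^ 9) (q ^ 9) n).

(* Main.v *)
(* Truncate every q-Pochhammer symbol of the integrand at level K. The truncated
   integrand is a rational function whose denominator has 3K simple zeros
   1 / ((omega^j q)^(4+3k)), j < 3, k < K, and whose numerator has degree 2K in z;
   its partial fraction decomposition shows that its integral over a contour
   enclosing 0 but none of these zeros is minus the sum of the residues at the
   zeros. Minus the residue at 1 / s^(4+3k), with s = omega^j q, is a third of the
   k-th term of a truncation of the function to be huffed, evaluated at s. Letting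
   K tend to infinity (uniform convergence on the contour, dominated convergence
   of the sum) gives one third of the sum of that function over q, omega q and
   omega^2 q, which is the value of the huffing operator. That the function has a Laurent expansion at all follows
   because its truncations have power series with uniformly bounded majorants. *)
Require Import Defs.
From Stdlib Require Import Reals ZArith Lra Lia IndefiniteDescription.
From Coquelicot Require Import Coquelicot.

Open Scope C_scope.

(** * Complex sequences and sums *)

(** Along an arbitrary simple closed contour, winding numbers give only the integrals of 1/z and
    1/(z - p). No residue theorem is invoked: every truncated integrand is reduced to these two and
    to the powers z^-(m+2), which have primitives and integrate to 0 over a closed path. To this end
    only the factors in positive powers of z are decomposed, while (1/z; q^3)_K is kept aside and
    peeled off one linear factor at a time; the effect is to evaluate it with 1/z replaced by the
    node. The hypothesis on the contour speaks of poles of the full integrand, so every zero of the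
    denominator must be shown to be a genuine pole, not cancelled by the numerator. Since (1/q;
    q^3)_oo = (1 - 1/q) (q^2; q^3)_oo, the factor 1 - 1/q carries the whole principal part, and what
    remains is an ordinary power series. For q = 0 the nodes and the average over cube roots lose
    their meaning; both sides equal 1 there, and this is why the constant and linear coefficients of
    that power series, 1 and 0, are tracked throughout. *)

Definition Ccv (u : nat -> C) (l : C) : Prop :=
  forall eps : R, (0 < eps)%R ->
    exists N : nat, forall n : nat, (N <= n)%nat -> (Cmod (u n - l) < eps)%R.

Lemma Ccv_filterlim (u : nat -> C) (l : C) :
  Ccv u l <-> filterlim u eventually (locally (T := C_UniformSpace) l).
Proof.
  split.
  - intros H.
    apply (filterlim_locally_ball_norm (U := C_NormedModule)).
    intros eps. destruct (H eps (cond_pos eps)) as [N HN].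
    exists N. intros n Hn. exact (HN n Hn).
  - intros H eps Heps.
    destruct (proj1 (filterlim_locally_ball_norm (U := C_NormedModule) u l) H
                (mkposreal eps Heps)) as [N HN].
    exists N. intros n Hn. exact (HN n Hn).
Qed.

Lemma Ccv_unique (u : nat -> C) (l l' : C) : Ccv u l -> Ccv u l' -> l = l'.
Proof.
  intros H H'.
  apply Ccv_filterlim in H. apply Ccv_filterlim in H'.
  exact (filterlim_locally_unique (V := C_NormedModule) u l l' H H').
Qed.

Lemma Ccv_ext_ev (N : nat) (u v : nat -> C) (l : C) :
  (forall n, (N <= n)%nat -> u n = v n) -> Ccv u l -> Ccv v l.
Proof.
  intros E H eps Heps. destruct (H eps Heps) as [M HM].
  exists (max N M). intros n Hn. rewrite <- E by lia. apply HM. lia.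
Qed.

Lemma Ccv_ext (u v : nat -> C) (l : C) :
  (forall n, u n = v n) -> Ccv u l -> Ccv v l.
Proof. intros E. apply (Ccv_ext_ev 0). intros n _. apply E. Qed.

Lemma Ccv_eq (u : nat -> C) (l l' : C) : l = l' -> Ccv u l -> Ccv u l'.
Proof. intros ->. exact (fun H => H). Qed.

Lemma Ccv_const (c : C) : Ccv (fun _ => c) c.
Proof.
  intros eps Heps. exists 0%nat. intros n _.
  replace (c - c) with (RtoC 0) by ring. rewrite Cmod_0. exact Heps.
Qed.

Lemma Ccv_subseq (phi : nat -> nat) (u : nat -> C) (l : C) :
  (forall N, exists M, forall n, (M <= n)%nat -> (N <= phi n)%nat) ->
  Ccv u l -> Ccv (fun n => u (phi n)) l.
Proof.
  intros Hphi H eps Heps. destruct (H eps Heps) as [N HN].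
  destruct (Hphi N) as [M HM]. exists M. intros n Hn. apply HN, HM, Hn.
Qed.

Lemma Ccv_plus (u v : nat -> C) (l m : C) :
  Ccv u l -> Ccv v m -> Ccv (fun n => u n + v n) (l + m).
Proof.
  intros Hu Hv eps Heps.
  destruct (Hu (eps / 2)%R) as [N HN]; [lra|].
  destruct (Hv (eps / 2)%R) as [M HM]; [lra|].
  exists (max N M). intros n Hn.
  replace (u n + v n - (l + m)) with ((u n - l) + (v n - m)) by ring.
  eapply Rle_lt_trans; [apply Cmod_triangle|].
  assert (H1 := HN n ltac:(lia)). assert (H2 := HM n ltac:(lia)). lra.
Qed.

Lemma Ccv_bounded (u : nat -> C) (l : C) :
  Ccv u l -> exists N, forall n, (N <= n)%nat -> (Cmod (u n) <= Cmod l + 1)%R.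
Proof.
  intros H. destruct (H 1%R Rlt_0_1) as [N HN]. exists N. intros n Hn.
  replace (u n) with (l + (u n - l)) by ring.
  eapply Rle_trans; [apply Cmod_triangle|].
  assert (H1 := HN n Hn). lra.
Qed.

Lemma Ccv_mult (u v : nat -> C) (l m : C) :
  Ccv u l -> Ccv v m -> Ccv (fun n => u n * v n) (l * m).
Proof.
  intros Hu Hv eps Heps.
  destruct (Ccv_bounded u l Hu) as [N0 HN0].
  assert (Hl := Cmod_ge_0 l). assert (Hm := Cmod_ge_0 m).
  set (B := (Cmod l + Cmod m + 1)%R).
  assert (HB : (0 < B)%R) by (unfold B; lra).
  assert (He : (0 < eps / (2 * B))%R) by (apply Rdiv_lt_0_compat; lra).
  destruct (Hu _ He) as [N HN]. destruct (Hv _ He) as [M HM].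
  exists (max N0 (max N M)). intros n Hn.
  replace (u n * v n - l * m) with (u n * (v n - m) + m * (u n - l)) by ring.
  eapply Rle_lt_trans; [apply Cmod_triangle|]. rewrite !Cmod_mult.
  assert (H0 := HN0 n ltac:(lia)). assert (H1 := HN n ltac:(lia)).
  assert (H2 := HM n ltac:(lia)).
  assert (G1 := Cmod_ge_0 (u n - l)). assert (G2 := Cmod_ge_0 (v n - m)).
  assert (G3 := Cmod_ge_0 (u n)).
  apply Rle_lt_trans with ((Cmod l + 1) * Cmod (v n - m) + Cmod m * Cmod (u n - l))%R.
  { apply Rplus_le_compat; [apply Rmult_le_compat_r; lra | lra]. }
  apply Rlt_le_trans with (B * (eps / (2 * B)) + B * (eps / (2 * B)))%R.
  - assert ((Cmod l + 1) * Cmod (v n - m) <= B * Cmod (v n - m))%R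
      by (apply Rmult_le_compat_r; unfold B; lra).
    assert (Cmod m * Cmod (u n - l) <= B * Cmod (u n - l))%R
      by (apply Rmult_le_compat_r; unfold B; lra).
    assert (B * Cmod (v n - m) < B * (eps / (2 * B)))%R
      by (apply Rmult_lt_compat_l; lra).
    assert (B * Cmod (u n - l) < B * (eps / (2 * B)))%R
      by (apply Rmult_lt_compat_l; lra).
    lra.
  - right. field. lra.
Qed.

Lemma Ccv_scal (c : C) (u : nat -> C) (l : C) :
  Ccv u l -> Ccv (fun n => c * u n) (c * l).
Proof. apply Ccv_mult, Ccv_const. Qed.

Lemma Cmod_minus_le (x y : C) : (Cmod x - Cmod y <= Cmod (x - y))%R.
Proof.
  assert (H := Cmod_triangle (x - y) y).
  replace (x - y + y) with x in H by ring. lra.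
Qed.

Lemma Ccv_inv (u : nat -> C) (l : C) :
  l <> 0 -> Ccv u l -> Ccv (fun n => / u n) (/ l).
Proof.
  intros Hl H eps Heps.
  assert (Pl : (0 < Cmod l)%R) by (apply Cmod_gt_0, Hl).
  destruct (H (Cmod l / 2)%R) as [N HN]; [lra|].
  destruct (H (eps * (Cmod l * Cmod l / 2))%R) as [M HM].
  { apply Rmult_lt_0_compat; [lra|]. assert (0 < Cmod l * Cmod l)%R by nra. lra. }
  exists (max N M). intros n Hn.
  assert (H1 := HN n ltac:(lia)). assert (H2 := HM n ltac:(lia)).
  assert (H3 : (Cmod l / 2 < Cmod (u n))%R).
  { assert (G := Cmod_minus_le l (u n)).
    replace (l - u n) with (- (u n - l)) in G by ring.
    rewrite Cmod_opp in G. lra. }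
  assert (Hu : u n <> 0) by (apply Cmod_gt_0; lra).
  replace (/ u n - / l) with (- ((u n - l) / (u n * l))) by (field; split; assumption).
  rewrite Cmod_opp, Cmod_div, Cmod_mult by (apply Cmult_neq_0; assumption).
  apply Rmult_lt_reg_r with (Cmod (u n) * Cmod l)%R; [nra|].
  unfold Rdiv. rewrite Rmult_assoc, Rinv_l by nra. rewrite Rmult_1_r.
  eapply Rlt_le_trans; [exact H2|].
  apply Rmult_le_compat_l; [lra|]. nra.
Qed.

Lemma Ccv_le (u : nat -> C) (l : C) (b : R) :
  Ccv u l -> (forall n, (Cmod (u n) <= b)%R) -> (Cmod l <= b)%R.
Proof.
  intros H Hb. apply Rnot_lt_le. intros Hlt.
  destruct (H (Cmod l - b)%R) as [N HN]; [lra|].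
  assert (G := Cmod_minus_le l (u N)).
  replace (l - u N) with (- (u N - l)) in G by ring.
  rewrite Cmod_opp in G. assert (G' := HN N (le_n N)). assert (G'' := Hb N). lra.
Qed.

Lemma Cmod_le_parts (z : C) : (Cmod z <= Rabs (Re z) + Rabs (Im z))%R.
Proof.
  replace z with (RtoC (Re z) + Ci * RtoC (Im z)) at 1.
  - eapply Rle_trans; [apply Cmod_triangle|].
    rewrite Cmod_mult, Cmod_Ci, !Cmod_R. lra.
  - destruct z as [x y]. apply injective_projections; simpl; ring.
Qed.

Lemma im_le_Cmod (z : C) : (Rabs (Im z) <= Cmod z)%R.
Proof. eapply Rle_trans; [apply Rmax_r | apply (Rmax_Cmod z)]. Qed.

Lemma Ccv_complete (u : nat -> C) :
  (forall eps, (0 < eps)%R -> exists N, forall n m,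
     (N <= n)%nat -> (N <= m)%nat -> (Cmod (u n - u m) < eps)%R) ->
  exists l, Ccv u l.
Proof.
  intros H.
  destruct (Rcomplete.R_complete (fun n => Re (u n))) as [x Hx].
  { intros eps Heps. destruct (H eps Heps) as [N HN]. exists N. intros n m Hn Hm.
    eapply Rle_lt_trans; [|apply (HN n m Hn Hm)].
    apply (re_le_Cmod (u n - u m)). }
  destruct (Rcomplete.R_complete (fun n => Im (u n))) as [y Hy].
  { intros eps Heps. destruct (H eps Heps) as [N HN]. exists N. intros n m Hn Hm.
    eapply Rle_lt_trans; [|apply (HN n m Hn Hm)].
    apply (im_le_Cmod (u n - u m)). }
  exists (x, y). intros eps Heps.
  destruct (Hx (eps / 2)%R) as [N HN]; [lra|].
  destruct (Hy (eps / 2)%R) as [M HM]; [lra|].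
  exists (max N M). intros n Hn.
  eapply Rle_lt_trans; [apply Cmod_le_parts|].
  assert (H1 := HN n ltac:(lia)). assert (H2 := HM n ltac:(lia)).
  unfold Rdist in H1, H2.
  change (Rabs (Re (u n) - x) + Rabs (Im (u n) - y) < eps)%R. lra.
Qed.

(** * Finite sums and products, geometric bounds and dominated convergence *)

Fixpoint csum (n : nat) (u : nat -> C) : C :=
  match n with O => 0 | S k => csum k u + u k end.

Fixpoint rsum (n : nat) (u : nat -> R) : R :=
  match n with O => 0%R | S k => (rsum k u + u k)%R end.

Fixpoint cprod (n : nat) (u : nat -> C) : C :=
  match n with O => 1 | S k => cprod k u * u k end.

Lemma is_series_csum (u : nat -> C) (l : C) :
  is_series (V := C_NormedModule) u l <-> Ccv (fun n => csum n u) l.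
Proof.
  assert (E : forall n, sum_n (G := C_AbelianMonoid) u n = csum (S n) u).
  { induction n.
    - rewrite sum_O. simpl. ring.
    - rewrite sum_Sn, IHn. reflexivity. }
  split.
  - intros H. assert (H' : Ccv (sum_n (G := C_AbelianMonoid) u) l) by (apply Ccv_filterlim, H).
    intros eps Heps. destruct (H' eps Heps) as [N HN]. exists (S N).
    intros [|n] Hn; [lia|]. rewrite <- E. apply HN. lia.
  - intros H. apply (proj1 (Ccv_filterlim (sum_n (G := C_AbelianMonoid) u) l)).
    intros eps Heps. destruct (H eps Heps) as [N HN]. exists N.
    intros n Hn. rewrite E. apply HN. lia.
Qed.

Lemma csum_ext (n : nat) (u v : nat -> C) :
  (forall i, (i < n)%nat -> u i = v i) -> csum n u = csum n v.
Proof.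
  induction n; intros H; simpl; [reflexivity|].
  rewrite IHn, (H n) by (intros; try apply H; lia). reflexivity.
Qed.

Lemma cprod_ext (n : nat) (u v : nat -> C) :
  (forall i, (i < n)%nat -> u i = v i) -> cprod n u = cprod n v.
Proof.
  induction n; intros H; simpl; [reflexivity|].
  rewrite IHn, (H n) by (intros; try apply H; lia). reflexivity.
Qed.

Lemma rsum_ext (n : nat) (u v : nat -> R) :
  (forall i, (i < n)%nat -> u i = v i) -> rsum n u = rsum n v.
Proof.
  induction n; intros H; simpl; [reflexivity|].
  rewrite IHn, (H n) by (intros; try apply H; lia). reflexivity.
Qed.

Lemma rsum_le (n : nat) (u v : nat -> R) :
  (forall i, (i < n)%nat -> (u i <= v i)%R) -> (rsum n u <= rsum n v)%R.
Proof.
  induction n; intros H; simpl; [lra|].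
  apply Rplus_le_compat; [apply IHn; intros; apply H; lia | apply H; lia].
Qed.

Lemma rsum_plus (n : nat) (u v : nat -> R) :
  rsum n (fun i => u i + v i)%R = (rsum n u + rsum n v)%R.
Proof. induction n; simpl; [ring|]. rewrite IHn. ring. Qed.

Lemma rsum_scal (n : nat) (c : R) (u : nat -> R) :
  rsum n (fun i => c * u i)%R = (c * rsum n u)%R.
Proof. induction n; simpl; [ring|]. rewrite IHn. ring. Qed.

Lemma csum_plus (n : nat) (u v : nat -> C) :
  csum n (fun i => u i + v i) = csum n u + csum n v.
Proof. induction n; simpl; [ring|]. rewrite IHn. ring. Qed.

Lemma csum_scal (n : nat) (c : C) (u : nat -> C) :
  csum n (fun i => c * u i) = c * csum n u.
Proof. induction n; simpl; [ring|]. rewrite IHn. ring. Qed.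

Lemma csum_0 (n : nat) (u : nat -> C) :
  (forall i, (i < n)%nat -> u i = 0) -> csum n u = 0.
Proof.
  induction n; intros H; simpl; [reflexivity|].
  rewrite IHn, (H n) by (intros; try apply H; lia). ring.
Qed.

Lemma csum_Sl (n : nat) (u : nat -> C) :
  csum (S n) u = u 0%nat + csum n (fun i => u (S i)).
Proof. induction n; [simpl; ring|]. cbn [csum] in *. rewrite IHn. ring. Qed.

Lemma rsum_Sl (n : nat) (u : nat -> R) :
  rsum (S n) u = (u 0%nat + rsum n (fun i => u (S i)))%R.
Proof. induction n; [simpl; ring|]. cbn [rsum] in *. rewrite IHn. ring. Qed.

Lemma csum_add (n m : nat) (u : nat -> C) :
  csum (n + m) u = csum n u + csum m (fun i => u (n + i)%nat).
Proof.
  induction m; simpl.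
  - rewrite Nat.add_0_r. ring.
  - rewrite Nat.add_succ_r. simpl. rewrite IHm. ring.
Qed.

Lemma cprod_add (n m : nat) (u : nat -> C) :
  cprod (n + m) u = cprod n u * cprod m (fun i => u (n + i)%nat).
Proof.
  induction m; simpl.
  - rewrite Nat.add_0_r. ring.
  - rewrite Nat.add_succ_r. simpl. rewrite IHm. ring.
Qed.

Lemma cprod_mult (n : nat) (u v : nat -> C) :
  cprod n (fun i => u i * v i) = cprod n u * cprod n v.
Proof. induction n; simpl; [ring|]. rewrite IHn. ring. Qed.

Lemma cprod_neq_0 (n : nat) (u : nat -> C) :
  (forall i, (i < n)%nat -> u i <> 0) -> cprod n u <> 0.
Proof.
  induction n; intros H; simpl; [apply C1_nz|].
  apply Cmult_neq_0; [apply IHn; intros; apply H; lia | apply H; lia].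
Qed.

Lemma csum_mod_le (n : nat) (u : nat -> C) :
  (Cmod (csum n u) <= rsum n (fun i => Cmod (u i)))%R.
Proof.
  induction n; simpl; [rewrite Cmod_0; lra|].
  eapply Rle_trans; [apply Cmod_triangle|]. lra.
Qed.

Lemma rsum_geom_le (n : nat) (rho : R) :
  (0 <= rho < 1)%R -> (rsum n (fun i => rho ^ i) <= / (1 - rho))%R.
Proof.
  intros H.
  assert (E : (rsum n (fun i => rho ^ i) * (1 - rho) = 1 - rho ^ n)%R).
  { induction n; simpl; [ring|]. rewrite Rmult_plus_distr_r, IHn. ring. }
  apply Rmult_le_reg_r with (1 - rho)%R; [lra|].
  rewrite E, Rinv_l by lra. assert (0 <= rho ^ n)%R by (apply pow_le; lra). lra.
Qed.

Lemma Rpow_cv_0 (rho b eps : R) :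
  (0 <= rho < 1)%R -> (0 < eps)%R ->
  exists N, forall n, (N <= n)%nat -> (b * rho ^ n < eps)%R.
Proof.
  intros Hr He.
  assert (Hb : (0 < Rabs b + 1)%R) by (assert (H := Rabs_pos b); lra).
  destruct (pow_lt_1_zero rho) with (y := (eps / (Rabs b + 1))%R) as [N HN].
  - rewrite Rabs_pos_eq; lra.
  - apply Rdiv_lt_0_compat; assumption.
  - exists N. intros n Hn. specialize (HN n Hn).
    assert (P : (0 <= rho ^ n)%R) by (apply pow_le; lra).
    rewrite Rabs_pos_eq in HN by exact P.
    apply Rle_lt_trans with ((Rabs b + 1) * rho ^ n)%R.
    + apply Rmult_le_compat_r; [exact P|]. assert (H := Rle_abs b). lra.
    + apply Rlt_le_trans with ((Rabs b + 1) * (eps / (Rabs b + 1)))%R.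
      * apply Rmult_lt_compat_l; assumption.
      * right. field. lra.
Qed.

Lemma csum_tail_le (u : nat -> C) (b rho : R) (n m : nat) :
  (0 <= rho < 1)%R -> (forall k, (Cmod (u k) <= b * rho ^ k)%R) ->
  (Cmod (csum (n + m) u - csum n u) <= b / (1 - rho) * rho ^ n)%R.
Proof.
  intros Hr Hu.
  assert (Hb : (0 <= b)%R).
  { assert (H := Hu 0%nat). assert (G := Cmod_ge_0 (u 0%nat)). simpl in H. lra. }
  assert (P : (0 <= rho ^ n)%R) by (apply pow_le; lra).
  rewrite csum_add.
  replace (csum n u + csum m (fun i => u (n + i)%nat) - csum n u)
    with (csum m (fun i => u (n + i)%nat)) by ring.
  eapply Rle_trans; [apply csum_mod_le|].
  apply Rle_trans with (rsum m (fun i => (b * rho ^ n) * rho ^ i))%R.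
  - apply rsum_le. intros i _. eapply Rle_trans; [apply Hu|].
    rewrite pow_add. right. ring.
  - rewrite rsum_scal.
    replace (b / (1 - rho) * rho ^ n)%R with (b * rho ^ n * / (1 - rho))%R by (field; lra).
    apply Rmult_le_compat_l; [apply Rmult_le_pos; assumption|].
    apply rsum_geom_le, Hr.
Qed.

(** The tail bound is part of the conclusion because it depends on [b] and [rho] only: this
    uniformity is what dominated convergence over [k] and uniform convergence on the contour rest
    on. *)
Lemma csum_geom_cv (u : nat -> C) (b rho : R) :
  (0 <= rho < 1)%R -> (forall k, (Cmod (u k) <= b * rho ^ k)%R) ->
  exists l, Ccv (fun n => csum n u) l /\
    forall n, (Cmod (l - csum n u) <= b / (1 - rho) * rho ^ n)%R.
Proof.
  intros Hr Hu.
  destruct (Ccv_complete (fun n => csum n u)) as [l Hl].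
  - intros eps Heps.
    destruct (Rpow_cv_0 rho (b / (1 - rho)) (eps / 2) Hr) as [N HN]; [lra|].
    assert (K : forall n, (N <= n)%nat -> (Cmod (csum n u - csum N u) < eps / 2)%R).
    { intros n Hn. replace n with (N + (n - N))%nat by lia.
      eapply Rle_lt_trans; [apply csum_tail_le; eassumption | apply HN; lia]. }
    exists N. intros n m Hn Hm.
    replace (csum n u - csum m u)
      with ((csum n u - csum N u) + - (csum m u - csum N u)) by ring.
    eapply Rle_lt_trans; [apply Cmod_triangle|]. rewrite Cmod_opp.
    assert (H1 := K n Hn). assert (H2 := K m Hm). lra.
  - exists l. split; [exact Hl|]. intros n.
    apply Ccv_le with (u := fun m => csum (n + m) u + - csum n u).
    + apply Ccv_plus; [|apply Ccv_const].
      apply (Ccv_subseq (fun m => n + m)%nat (fun m => csum m u)); [|exact Hl].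
      intros N. exists N. intros; lia.
    + intros m. apply csum_tail_le; assumption.
Qed.

(** Dominated convergence with a geometric dominating sequence. All rows share the tail bound b/(1 -
    rho) rho^n, so after cutting at one index only a finite sum is left, which converges term by
    term. Summability of the limit row is part of the conclusion. *)
Lemma tannery (u : nat -> nat -> C) (v s : nat -> C) (b rho : R) :
  (0 <= rho < 1)%R ->
  (forall K, Ccv (fun n => csum n (u K)) (s K)) ->
  (forall k, Ccv (fun K => u K k) (v k)) ->
  (forall K k, (Cmod (u K k) <= b * rho ^ k)%R) ->
  exists l, Ccv (fun n => csum n v) l /\ Ccv s l.
Proof.
  intros Hr Hs Hv Hb.
  assert (Hvb : forall k, (Cmod (v k) <= b * rho ^ k)%R).
  { intros k. apply (Ccv_le (fun K => u K k)); [apply Hv | intros; apply Hb]. }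
  destruct (csum_geom_cv v b rho Hr Hvb) as (l & Hl & Hlb).
  exists l. split; [exact Hl|].
  assert (Hsb : forall K n, (Cmod (s K - csum n (u K)) <= b / (1 - rho) * rho ^ n)%R).
  { intros K n. destruct (csum_geom_cv (u K) b rho Hr (Hb K)) as (l' & Hl' & Hlb').
    rewrite (Ccv_unique _ _ _ (Hs K) Hl'). apply Hlb'. }
  assert (Hfin : forall n, Ccv (fun K => csum n (u K)) (csum n v)).
  { induction n; simpl; [apply Ccv_const | apply Ccv_plus; [exact IHn | apply Hv]]. }
  intros eps Heps.
  destruct (Rpow_cv_0 rho (b / (1 - rho)) (eps / 3) Hr) as [N HN]; [lra|].
  destruct (Hfin N (eps / 3)%R) as [M HM]; [lra|].
  exists M. intros K HK.
  replace (s K - l) with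
    ((s K - csum N (u K)) + ((csum N (u K) - csum N v) + - (l - csum N v))) by ring.
  eapply Rle_lt_trans; [apply Cmod_triangle|].
  assert (T := Cmod_triangle (csum N (u K) - csum N v) (- (l - csum N v))).
  rewrite Cmod_opp in T.
  assert (H1 := Hsb K N). assert (H2 := HM K HK). assert (H3 := Hlb N).
  assert (H4 := HN N (le_n N)). lra.
Qed.

(** * Power series with majorants *)

(* A power series for [f] on the unit disc with first two coefficients [x] and
   [y] and majorant at radius [r] at most [M r]. Bounding coefficients rather
   than values makes the notion stable under pointwise limits with a common [M]
   (see [ps_lim]) without Cauchy's integral formula. *)
Definition ps (f : C -> C) (M : R -> R) (x y : C) : Prop :=
  exists a : nat -> C,
    a 0%nat = x /\ a 1%nat = y /\
    (forall r n, (0 <= r < 1)%R -> (rsum n (fun i => Cmod (a i) * r ^ i) <= M r)%R) /\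
    (forall s, (Cmod s < 1)%R -> Ccv (fun n => csum n (fun i => a i * s ^ i)) (f s)).

Lemma ps_pos (f : C -> C) (M : R -> R) (x y : C) (r : R) :
  ps f M x y -> (0 <= r < 1)%R -> (0 <= M r)%R.
Proof. intros (a & _ & _ & H & _) Hr. exact (H r 0%nat Hr). Qed.

Lemma ps_bound (f : C -> C) (M : R -> R) (x y s : C) :
  ps f M x y -> (Cmod s < 1)%R -> (Cmod (f s) <= M (Cmod s))%R.
Proof.
  intros (a & _ & _ & HM & Hf) Hs.
  apply (Ccv_le _ _ _ (Hf s Hs)). intros n.
  eapply Rle_trans; [apply csum_mod_le|].
  eapply Rle_trans; [|apply (HM (Cmod s) n); split; [apply Cmod_ge_0 | exact Hs]].
  apply rsum_le. intros i _. rewrite Cmod_mult, Cmod_pow. lra.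
Qed.

Lemma ps_ext (f g : C -> C) (M : R -> R) (x y : C) :
  (forall s, (Cmod s < 1)%R -> f s = g s) -> ps f M x y -> ps g M x y.
Proof.
  intros E (a & Ha0 & Ha1 & HM & Hf). exists a. do 3 (split; [assumption|]).
  intros s Hs. rewrite <- E by exact Hs. apply Hf, Hs.
Qed.

Lemma ps_weaken (f : C -> C) (M M' : R -> R) (x y : C) :
  (forall r, (0 <= r < 1)%R -> (M r <= M' r)%R) -> ps f M x y -> ps f M' x y.
Proof.
  intros E (a & Ha0 & Ha1 & HM & Hf). exists a. do 2 (split; [assumption|]).
  split; [|assumption]. intros r n Hr. eapply Rle_trans; [apply HM, Hr | apply E, Hr].
Qed.

Lemma ps_const (c : C) : ps (fun _ => c) (fun _ => Cmod c) c 0.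
Proof.
  exists (fun i => match i with O => c | S _ => 0 end).
  split; [reflexivity|]. split; [reflexivity|]. split.
  - intros r [|n] _; [apply Cmod_ge_0|]. rewrite rsum_Sl.
    rewrite (rsum_ext n _ (fun _ => 0 * 0)%R), rsum_scal by (intros; rewrite Cmod_0; ring).
    simpl. lra.
  - intros s _. apply (Ccv_ext_ev 1 (fun _ => c)); [|apply Ccv_const].
    intros [|n] Hn; [lia|]. rewrite csum_Sl, csum_0 by (intros; ring). simpl. ring.
Qed.

Lemma ps_plus (f g : C -> C) (M N : R -> R) (x y x' y' : C) :
  ps f M x y -> ps g N x' y' ->
  ps (fun s => f s + g s) (fun r => M r + N r)%R (x + x') (y + y').
Proof.
  intros (a & Ha0 & Ha1 & HM & Hf) (b & Hb0 & Hb1 & HN & Hg).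
  exists (fun i => a i + b i). split; [congruence|]. split; [congruence|]. split.
  - intros r n Hr. eapply Rle_trans; [|apply Rplus_le_compat; [apply (HM r n Hr) | apply (HN r n Hr)]].
    rewrite <- rsum_plus. apply rsum_le. intros i _. rewrite <- Rmult_plus_distr_r.
    apply Rmult_le_compat_r; [apply pow_le; lra | apply Cmod_triangle].
  - intros s Hs. eapply Ccv_ext; [|apply Ccv_plus; [apply (Hf s Hs) | apply (Hg s Hs)]].
    intros n. simpl. rewrite <- csum_plus. apply csum_ext. intros; ring.
Qed.

Lemma ps_scal (c : C) (f : C -> C) (M : R -> R) (x y : C) :
  ps f M x y -> ps (fun s => c * f s) (fun r => Cmod c * M r)%R (c * x) (c * y).
Proof.
  intros (a & Ha0 & Ha1 & HM & Hf).
  exists (fun i => c * a i). split; [congruence|]. split; [congruence|]. split.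
  - intros r n Hr.
    rewrite (rsum_ext n _ (fun i => Cmod c * (Cmod (a i) * r ^ i))%R)
      by (intros; rewrite Cmod_mult; ring).
    rewrite rsum_scal. apply Rmult_le_compat_l; [apply Cmod_ge_0 | apply HM, Hr].
  - intros s Hs. eapply Ccv_ext; [|apply Ccv_scal, (Hf s Hs)].
    intros n. simpl. rewrite <- csum_scal. apply csum_ext. intros; ring.
Qed.

Lemma ps_mul_var (f : C -> C) (M : R -> R) (x y : C) :
  ps f M x y -> ps (fun s => s * f s) (fun r => r * M r)%R 0 x.
Proof.
  intros (a & Ha0 & Ha1 & HM & Hf).
  exists (fun i => match i with O => RtoC 0 | S j => a j end).
  split; [reflexivity|]. split; [exact Ha0|]. split.
  - intros r n Hr.
    assert (P : (0 <= r * M r)%R).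
    { apply Rmult_le_pos; [lra|]. exact (HM r 0%nat Hr). }
    destruct n as [|n]; [exact P|]. rewrite rsum_Sl, Cmod_0.
    rewrite (rsum_ext n _ (fun i => r * (Cmod (a i) * r ^ i))%R) by (intros; simpl; ring).
    rewrite rsum_scal, Rmult_0_l, Rplus_0_l.
    apply Rmult_le_compat_l; [lra | apply HM, Hr].
  - intros s Hs.
    apply (Ccv_ext_ev 1 (fun n => s * csum (pred n) (fun i => a i * s ^ i))).
    + intros [|n] Hn; [lia|]. rewrite csum_Sl. simpl pred. rewrite <- csum_scal.
      rewrite Cmult_0_l, Cplus_0_l. apply csum_ext. intros. rewrite Cpow_S. ring.
    + apply Ccv_scal. apply (Ccv_subseq pred (fun n => csum n _)); [|apply Hf, Hs].
      intros N. exists (S N). intros; lia.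
Qed.

(** Multiplication by s^m shifts the coefficients by [m] places, so for m >= 2 nothing is left in
    the two tracked positions. This is how factors 1 - s^m with m >= 2 leave the tracked
    coefficients untouched. *)
Lemma ps_mul_pow (m : nat) (f : C -> C) (M : R -> R) (x y : C) :
  ps f M x y ->
  exists x' y', ps (fun s => s ^ m * f s) (fun r => r ^ m * M r)%R x' y' /\
    ((2 <= m)%nat \/ (x = 0 /\ y = 0) -> x' = 0 /\ y' = 0).
Proof.
  intros H.
  (* The extra clause for 1 <= m carries the induction: the linear coefficient after m + 1 shifts is
     the constant coefficient after m shifts. *)
  assert (G : exists x' y', ps (fun s => s ^ m * f s) (fun r => r ^ m * M r)%R x' y' /\
    ((1 <= m)%nat -> x' = 0) /\
    ((2 <= m)%nat \/ (x = 0 /\ y = 0) -> x' = 0 /\ y' = 0)).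
  { induction m as [|m IH].
    - exists x, y. split; [|split; [lia | intros [|]; [lia | assumption]]].
      apply (ps_ext f); [intros; simpl; ring|].
      apply (ps_weaken f M); [intros; simpl; lra | exact H].
    - destruct IH as (x' & y' & IH & H1 & H2). exists 0, x'.
      split; [|split; [reflexivity|]].
      + apply (ps_ext (fun s => s * (s ^ m * f s))); [intros; rewrite Cpow_S; ring|].
        apply (ps_weaken _ (fun r => r * (r ^ m * M r))%R); [intros; simpl; lra|].
        exact (ps_mul_var _ _ _ _ IH).
      + intros [L|E]; (split; [reflexivity|]); [apply H1; lia|].
        apply H2. right; exact E. }
  destruct G as (x' & y' & G & _ & G'). exists x', y'. split; assumption.
Qed.

Lemma ps_mul_one_minus_pow (m : nat) (f : C -> C) (M : R -> R) (x y : C) :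
  (2 <= m)%nat \/ (x = 0 /\ y = 0) -> ps f M x y ->
  ps (fun s => f s * (1 - s ^ m)) (fun r => M r * (1 + r ^ m))%R x y.
Proof.
  intros Hm H. destruct (ps_mul_pow m f M x y H) as (x' & y' & H1 & H2).
  destruct (H2 Hm) as [-> ->].
  apply (ps_ext (fun s => f s + - (1) * (s ^ m * f s))); [intros; ring|].
  apply (ps_weaken _ (fun r => M r + Cmod (- (1)) * (r ^ m * M r))%R).
  { intros. rewrite Cmod_m1. right; ring. }
  replace x with (x + - (1) * 0) by ring. replace y with (y + - (1) * 0) by ring.
  apply ps_plus; [exact H|]. apply ps_scal, H1.
Qed.

(** Under a common majorant, F K s differs from the constant coefficient of F K by O(|s|) uniformly
    in K, so pointwise convergence at a single small s makes the constant coefficients Cauchy.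
    Higher coefficients follow by subtracting the constant one and dividing by s. The disc is
    punctured because this division makes no sense at 0. *)
Lemma ps_coef_cv (n : nat) : forall (a : nat -> nat -> C) (F : nat -> C -> C) (M : R),
  (forall K N, (rsum N (fun i => Cmod (a K i) * (1 / 2) ^ i) <= M)%R) ->
  (forall K s, (0 < Cmod s < 1 / 2)%R ->
     Ccv (fun N => csum N (fun i => a K i * s ^ i)) (F K s)) ->
  (forall s, (0 < Cmod s < 1 / 2)%R -> exists l, Ccv (fun K => F K s) l) ->
  exists l, Ccv (fun K => a K n) l.
Proof.
  assert (Base : forall (a : nat -> nat -> C) (F : nat -> C -> C) (M : R),
    (forall K N, (rsum N (fun i => Cmod (a K i) * (1 / 2) ^ i) <= M)%R) ->
    (forall K s, (0 < Cmod s < 1 / 2)%R ->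
       Ccv (fun N => csum N (fun i => a K i * s ^ i)) (F K s)) ->
    (forall s, (0 < Cmod s < 1 / 2)%R -> exists l, Ccv (fun K => F K s) l) ->
    exists l, Ccv (fun K => a K 0%nat) l).
  { intros a F M HM HF Hcv.
    assert (M0 : (0 <= M)%R) by exact (HM 0%nat 0%nat).
    assert (D : forall K s, (0 < Cmod s < 1 / 2)%R ->
       (Cmod (F K s - a K 0%nat) <= 2 * Cmod s * M)%R).
    { intros K s Hs.
      apply Ccv_le with (u := fun N => csum (S N) (fun i => a K i * s ^ i) + - a K 0%nat).
      - apply Ccv_plus; [|apply Ccv_const].
        apply (Ccv_subseq S (fun N => csum N (fun i => a K i * s ^ i))); [|apply HF, Hs].
        intros N. exists N. intros; lia.
      - intros N. rewrite csum_Sl.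
        replace (a K 0%nat * s ^ 0 + csum N (fun i => a K (S i) * s ^ S i) + - a K 0%nat)
          with (csum N (fun i => a K (S i) * s ^ S i)) by (simpl; ring).
        eapply Rle_trans; [apply csum_mod_le|].
        apply Rle_trans with (rsum N (fun i => (2 * Cmod s) * (Cmod (a K (S i)) * (1 / 2) ^ S i)))%R.
        + apply rsum_le. intros i _. rewrite Cmod_mult, Cmod_pow. cbn [pow].
          assert (P : (Cmod s ^ i <= (1 / 2) ^ i)%R) by (apply pow_incr; lra).
          assert (A := Cmod_ge_0 (a K (S i))).
          replace (2 * Cmod s * (Cmod (a K (S i)) * (1 / 2 * (1 / 2) ^ i)))%R
            with (Cmod (a K (S i)) * (Cmod s * (1 / 2) ^ i))%R by field.
          apply Rmult_le_compat_l; [exact A|]. apply Rmult_le_compat_l; lra.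
        + rewrite rsum_scal. apply Rmult_le_compat_l; [lra|].
          assert (G := HM K (S N)). rewrite rsum_Sl in G.
          assert (A := Cmod_ge_0 (a K 0%nat)). simpl pow in G at 1. lra. }
    apply Ccv_complete. intros eps Heps.
    (* With this d, each of the two errors 2 d M is at most eps/4; the distances of F K d and F L d
       to their limit account for the other two quarters. The bound 1/4 keeps d inside the disc of
       radius 1/2. *)
    set (d := Rmin (1 / 4) (eps / (8 * (M + 1)))).
    assert (Hd0 : (0 < d)%R).
    { apply Rmin_pos; [lra|]. apply Rdiv_lt_0_compat; lra. }
    assert (Hd1 : (d <= 1 / 4)%R) by apply Rmin_l.
    assert (Hd2 : (d * (8 * (M + 1)) <= eps)%R).
    { apply Rle_trans with (eps / (8 * (M + 1)) * (8 * (M + 1)))%R.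
      - apply Rmult_le_compat_r; [lra | apply Rmin_r].
      - right. field. lra. }
    assert (Hmd : Cmod (RtoC d) = d) by (rewrite Cmod_R; apply Rabs_pos_eq; lra).
    destruct (Hcv (RtoC d)) as [l Hl]; [rewrite Hmd; lra|].
    destruct (Hl (eps / 4)%R) as [N HN]; [lra|].
    exists N. intros K L HK HL.
    assert (DK := D K (RtoC d)). assert (DL := D L (RtoC d)). rewrite Hmd in DK, DL.
    specialize (DK ltac:(lra)). specialize (DL ltac:(lra)).
    assert (NK := HN K HK). assert (NL := HN L HL).
    replace (a K 0%nat - a L 0%nat) with
      ((- (F K (RtoC d) - a K 0%nat) + (F K (RtoC d) - l))
       + (- (F L (RtoC d) - l) + (F L (RtoC d) - a L 0%nat))) by ring.
    eapply Rle_lt_trans; [apply Cmod_triangle|].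
    assert (T1 := Cmod_triangle (- (F K (RtoC d) - a K 0%nat)) (F K (RtoC d) - l)).
    assert (T2 := Cmod_triangle (- (F L (RtoC d) - l)) (F L (RtoC d) - a L 0%nat)).
    rewrite Cmod_opp in T1, T2. nra. }
  induction n as [|n IH]; intros a F M HM HF Hcv; [exact (Base a F M HM HF Hcv)|].
  destruct (Base a F M HM HF Hcv) as [l0 Hl0].
  (* Lowering all indices by one doubles the majorant, since the radius is 1/2. *)
  apply (IH (fun K i => a K (S i)) (fun K s => / s * (F K s + - a K 0%nat)) (2 * M)%R).
  - intros K N. assert (G := HM K (S N)). rewrite rsum_Sl in G.
    assert (A := Cmod_ge_0 (a K 0%nat)). simpl pow in G at 1.
    rewrite (rsum_ext N _ (fun i => / 2 * (Cmod (a K (S i)) * (1 / 2) ^ i))%R) in G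
      by (intros; simpl; field).
    rewrite rsum_scal in G. lra.
  - intros K s Hs.
    assert (s0 : s <> 0) by (apply Cmod_gt_0; lra).
    apply (Ccv_ext (fun N => / s * (csum (S N) (fun i => a K i * s ^ i) + - a K 0%nat))).
    + intros N. rewrite csum_Sl.
      rewrite (csum_ext N (fun i => a K (S i) * s ^ S i) (fun i => s * (a K (S i) * s ^ i)))
        by (intros; rewrite Cpow_S; ring).
      rewrite csum_scal. simpl. field. exact s0.
    + apply Ccv_scal, Ccv_plus; [|apply Ccv_const].
      apply (Ccv_subseq S (fun N => csum N (fun i => a K i * s ^ i))); [|apply HF, Hs].
      intros N. exists N. intros; lia.
  - intros s Hs. destruct (Hcv s Hs) as [l Hl]. exists (/ s * (l + - (l0))).
    apply Ccv_scal, Ccv_plus; [exact Hl|].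
    apply (Ccv_ext (fun K => - (1) * a K 0%nat)); [intros; ring|].
    replace (- l0) with (- (1) * l0) by ring. apply Ccv_scal, Hl0.
Qed.

Lemma Rlim_rsum_le (a : nat -> nat -> C) (al : nat -> C) (r b : R) (n : nat) :
  (0 <= r)%R -> (forall i, Ccv (fun K => a K i) (al i)) ->
  (forall K, (rsum n (fun i => Cmod (a K i) * r ^ i) <= b)%R) ->
  (rsum n (fun i => Cmod (al i) * r ^ i) <= b)%R.
Proof.
  intros Hr Ha Hb. apply Rnot_lt_le. intros Hlt.
  assert (G : forall m eps, (0 < eps)%R -> exists N, forall K, (N <= K)%nat ->
    (rsum m (fun i => Cmod (al i) * r ^ i) < rsum m (fun i => Cmod (a K i) * r ^ i) + eps)%R).
  { induction m; intros eps Heps; simpl; [exists 0%nat; intros; lra|].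
    assert (P : (0 <= r ^ m)%R) by (apply pow_le; exact Hr).
    destruct (IHm (eps / 2)%R) as [N HN]; [lra|].
    destruct (Ha m (eps / (2 * (r ^ m + 1)))%R) as [N' HN'].
    { apply Rdiv_lt_0_compat; lra. }
    exists (max N N'). intros K HK.
    assert (H1 := HN K ltac:(lia)). assert (H2 := HN' K ltac:(lia)).
    assert (H3 := Cmod_minus_le (al m) (a K m)).
    replace (al m - a K m) with (- (a K m - al m)) in H3 by ring. rewrite Cmod_opp in H3.
    assert (H4 : (Cmod (a K m - al m) * (r ^ m + 1) < eps / 2)%R).
    { apply Rlt_le_trans with (eps / (2 * (r ^ m + 1)) * (r ^ m + 1))%R.
      - apply Rmult_lt_compat_r; lra.
      - right. field. lra. }
    assert (A := Cmod_ge_0 (a K m - al m)). nra. }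
  destruct (G n (rsum n (fun i => Cmod (al i) * r ^ i) - b)%R) as [N HN]; [lra|].
  assert (H1 := HN N (le_n N)). assert (H2 := Hb N). lra.
Qed.

Lemma rsum_term_le (n : nat) (u : nat -> R) :
  (forall i, (0 <= u i)%R) -> (u n <= rsum (S n) u)%R.
Proof.
  intros H. simpl. assert (G : (0 <= rsum n u)%R).
  { induction n; simpl; [lra|]. specialize (H n). lra. }
  lra.
Qed.

(** A form of the Weierstrass convergence theorem: the coefficients converge, their limits inherit
    the bound [M], and dominated convergence identifies the limit series with [f]. *)
Lemma ps_lim (F : nat -> C -> C) (f : C -> C) (M : R -> R) (x y : C) :
  (forall K, ps (F K) M x y) ->
  (forall s, (Cmod s < 1)%R -> Ccv (fun K => F K s) (f s)) ->
  ps f M x y.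
Proof.
  intros HF Hf.
  destruct (functional_choice _ HF) as [a Ha].
  destruct (functional_choice (fun i l => Ccv (fun K => a K i) l)) as [al Hal].
  { intros i. apply (ps_coef_cv i a F (M (1 / 2)%R)).
    - intros K N. apply (proj1 (proj2 (proj2 (Ha K)))). lra.
    - intros K s Hs. apply (proj2 (proj2 (proj2 (Ha K)))). lra.
    - intros s Hs. exists (f s). apply Hf. lra. }
  exists al. split; [|split; [|split]].
  - apply (Ccv_unique (fun K => a K 0%nat)); [apply Hal|].
    apply (Ccv_ext (fun _ => x)); [|apply Ccv_const]. intros K. symmetry. apply Ha.
  - apply (Ccv_unique (fun K => a K 1%nat)); [apply Hal|].
    apply (Ccv_ext (fun _ => y)); [|apply Ccv_const]. intros K. symmetry. apply Ha.
  - intros r n Hr. apply (Rlim_rsum_le a); [lra | exact Hal|].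
    intros K. apply (proj1 (proj2 (proj2 (Ha K)))), Hr.
  - intros s Hs.
    assert (Hs0 := Cmod_ge_0 s).
    (* A radius strictly between |s| and 1: the bound |a K i| r^i <= M r dominates the i-th term at
       s by M r (|s|/r)^i. *)
    set (r := ((1 + Cmod s) / 2)%R). assert (Hr : (Cmod s < r < 1)%R) by (unfold r; lra).
    destruct (tannery (fun K i => a K i * s ^ i) (fun i => al i * s ^ i) (fun K => F K s)
                (M r) (Cmod s / r)) as (l & H1 & H2).
    + split; [apply Rdiv_le_0_compat; lra|].
      apply Rmult_lt_reg_r with r; [lra|]. unfold Rdiv.
      rewrite Rmult_assoc, Rinv_l by lra. lra.
    + intros K. apply (proj2 (proj2 (proj2 (Ha K)))), Hs.
    + intros i. apply Ccv_mult; [apply Hal | apply Ccv_const].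
    + intros K i. rewrite Cmod_mult, Cmod_pow.
      assert (Pi : (0 < r ^ i)%R) by (apply pow_lt; lra).
      unfold Rdiv. rewrite Rpow_mult_distr, pow_inv.
      assert (B : (Cmod (a K i) * r ^ i <= M r)%R).
      { eapply Rle_trans; [|apply (proj1 (proj2 (proj2 (Ha K))) r (S i)); lra].
        apply (rsum_term_le i (fun i => Cmod (a K i) * r ^ i)%R). intros j.
        apply Rmult_le_pos; [apply Cmod_ge_0 | apply pow_le; lra]. }
      assert (Ps : (0 <= Cmod s ^ i)%R) by (apply pow_le; lra).
      replace (Cmod (a K i) * Cmod s ^ i)%R
        with (Cmod (a K i) * r ^ i * (Cmod s ^ i * / r ^ i))%R by (field; lra).
      apply Rmult_le_compat_r; [|exact B].
      apply Rmult_le_pos; [exact Ps | left; apply Rinv_0_lt_compat, Pi].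
    + rewrite (Ccv_unique _ _ _ (Hf s Hs) H2). exact H1.
Qed.

Lemma Cpow_cv_0 (s : C) : (Cmod s < 1)%R -> Ccv (fun n => s ^ n) 0.
Proof.
  intros Hs eps Heps.
  destruct (Rpow_cv_0 (Cmod s) 1 eps) as [N HN]; [split; [apply Cmod_ge_0 | exact Hs] | exact Heps|].
  exists N. intros n Hn. replace (s ^ n - 0) with (s ^ n) by ring.
  rewrite Cmod_pow. assert (H := HN n Hn). lra.
Qed.

Lemma pow_lt_1_pos (r : R) (m : nat) : (0 <= r < 1)%R -> (1 <= m)%nat -> (0 <= r ^ m <= r)%R.
Proof.
  intros Hr Hm. destruct m; [lia|]. simpl.
  assert (0 <= r ^ m <= 1)%R.
  { split; [apply pow_le; lra|]. rewrite <- (pow1 m). apply pow_incr; lra. }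
  nra.
Qed.

Lemma one_minus_pow_neq_0 (s : C) (m : nat) :
  (Cmod s < 1)%R -> (1 <= m)%nat -> 1 - s ^ m <> 0.
Proof.
  intros Hs Hm E.
  assert (E' : s ^ m = 1) by (replace (s ^ m) with (1 - (1 - s ^ m)) by ring; rewrite E; ring).
  assert (F : Cmod (s ^ m) = 1%R) by (rewrite E'; apply Cmod_1).
  rewrite Cmod_pow in F.
  assert (G := pow_lt_1_pos (Cmod s) m (conj (Cmod_ge_0 s) Hs) Hm). lra.
Qed.

(** The quotient is the limit of the products of [f] with the partial sums of the geometric series
    in s^m, all of which obey the same bound M r / (1 - r^m). *)
Lemma ps_div_one_minus_pow (m : nat) (f : C -> C) (M : R -> R) (x y : C) :
  (1 <= m)%nat -> (2 <= m)%nat \/ (x = 0 /\ y = 0) -> ps f M x y ->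
  ps (fun s => f s / (1 - s ^ m)) (fun r => M r / (1 - r ^ m))%R x y.
Proof.
  intros Hm1 Hm H.
  apply (ps_lim (fun J s => f s * csum (S J) (fun j => (s ^ m) ^ j))).
  - induction K as [|K IH].
    + apply (ps_ext f); [intros; simpl; ring|].
      apply (ps_weaken f M); [|exact H]. intros r Hr.
      assert (G := pow_lt_1_pos r m Hr Hm1). assert (P := ps_pos f M x y r H Hr).
      apply Rmult_le_reg_r with (1 - r ^ m)%R; [lra|].
      unfold Rdiv. rewrite Rmult_assoc, Rinv_l by lra. nra.
    + destruct (ps_mul_pow m _ _ x y IH) as (x' & y' & H1 & H2).
      destruct (H2 Hm) as [-> ->].
      replace x with (x + 0) by ring. replace y with (y + 0) by ring.
      (* A partial product is [f] plus s^m times the previous one. The bound M/(1 - r^m) is the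
         fixed point of the map sending B to M + r^m B, so it is preserved. *)
      apply (ps_ext (fun s => f s + s ^ m * (f s * csum (S K) (fun j => (s ^ m) ^ j)))).
      { intros s _. rewrite (csum_Sl (S K)).
        rewrite (csum_ext (S K) (fun i => (s ^ m) ^ S i) (fun i => s ^ m * (s ^ m) ^ i))
          by (intros; rewrite Cpow_S; reflexivity).
        rewrite csum_scal. change ((s ^ m) ^ 0) with (RtoC 1).
        change (fun j => (s ^ m) ^ j) with (Cpow (s ^ m)). ring. }
      apply (ps_weaken _ (fun r => M r + r ^ m * (M r / (1 - r ^ m)))%R).
      { intros r Hr. assert (G := pow_lt_1_pos r m Hr Hm1). right. field. lra. }
      apply ps_plus; assumption.
  - intros s Hs. unfold Cdiv. apply Ccv_scal.
    assert (N0 := one_minus_pow_neq_0 s m Hs Hm1).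
    apply (Ccv_ext (fun K => / (1 - s ^ m) * (1 + - (1) * (s ^ m * (s ^ m) ^ K)))).
    + intros K.
      assert (E : forall n, csum n (fun j => (s ^ m) ^ j) * (1 - s ^ m) = 1 - (s ^ m) ^ n).
      { induction n; cbn [csum]; [simpl; ring|]. rewrite Cmult_plus_distr_r, IHn.
        rewrite Cpow_S. ring. }
      assert (E' := E (S K)).
      replace (csum (S K) (fun j => (s ^ m) ^ j)) with
        (/ (1 - s ^ m) * (csum (S K) (fun j => (s ^ m) ^ j) * (1 - s ^ m)))
        by (field; exact N0).
      rewrite E', Cpow_S. ring.
    + apply (Ccv_eq _ (/ (1 - s ^ m) * (1 + - (1) * (s ^ m * 0)))); [ring|].
      apply Ccv_scal, Ccv_plus; [apply Ccv_const|]. apply Ccv_scal, Ccv_scal, Cpow_cv_0.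
      rewrite Cmod_pow. assert (G := pow_lt_1_pos (Cmod s) m (conj (Cmod_ge_0 s) Hs) Hm1). lra.
Qed.

(** * q-Pochhammer symbols *)

Lemma qpoch_ext (A B Q : C) (n : nat) : A = B -> qpoch A Q n = qpoch B Q n.
Proof. intros ->. reflexivity. Qed.

Lemma qpoch_add (A Q : C) (n m : nat) :
  qpoch A Q (n + m) = qpoch A Q n * qpoch (A * Q ^ n) Q m.
Proof.
  induction m; simpl.
  - rewrite Nat.add_0_r. ring.
  - rewrite Nat.add_succ_r. simpl. rewrite IHm, Cpow_add_r. ring.
Qed.

Lemma qpoch_Sl (A Q : C) (n : nat) : qpoch A Q (S n) = (1 - A) * qpoch (A * Q) Q n.
Proof.
  change (S n) with (1 + n)%nat. rewrite qpoch_add. simpl. rewrite (qpoch_ext (A * (Q * 1)) (A * Q)) by ring. ring.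
Qed.

Lemma qpoch_0_l (Q : C) (n : nat) : qpoch 0 Q n = 1.
Proof. induction n; simpl; [reflexivity|]. rewrite IHn. ring. Qed.

Lemma qpoch_neq_0 (A Q : C) (n : nat) :
  (forall k, (k < n)%nat -> 1 - A * Q ^ k <> 0) -> qpoch A Q n <> 0.
Proof.
  induction n; intros H; simpl; [apply C1_nz|].
  apply Cmult_neq_0; [apply IHn; intros; apply H; lia | apply H; lia].
Qed.

Lemma exp_le_compat (x y : R) : (x <= y)%R -> (exp x <= exp y)%R.
Proof. intros [H | ->]; [left; apply exp_increasing, H | right; reflexivity]. Qed.

(** A bound for |(A; Q)_n|, uniform in n, when |A| <= r and |Q| = rho: the k-th factor is at most
    exp(r rho^k), and the exponents form a geometric series. *)
Definition ebound (r rho : R) : R := exp (r * / (1 - rho)).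

Lemma qpoch_le_rsum (A Q : C) (r : R) (n : nat) :
  (Cmod A <= r)%R -> (Cmod (qpoch A Q n) <= exp (r * rsum n (fun k => Cmod Q ^ k)))%R.
Proof.
  intros HA. induction n; simpl; [rewrite Cmod_1, Rmult_0_r, exp_0; lra|].
  rewrite Cmod_mult, Rmult_plus_distr_l, exp_plus.
  apply Rmult_le_compat; [apply Cmod_ge_0 | apply Cmod_ge_0 | exact IHn|].
  eapply Rle_trans; [apply (Cmod_triangle 1 (- (A * Q ^ n)))|].
  rewrite Cmod_1, Cmod_opp, Cmod_mult, Cmod_pow.
  assert (P : (0 <= Cmod Q ^ n)%R) by (apply pow_le, Cmod_ge_0).
  assert (G := exp_ineq1_le (r * Cmod Q ^ n)). nra.
Qed.

Lemma qpoch_le (A Q : C) (r : R) (n : nat) :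
  (Cmod Q < 1)%R -> (Cmod A <= r)%R -> (Cmod (qpoch A Q n) <= ebound r (Cmod Q))%R.
Proof.
  intros HQ HA. eapply Rle_trans; [apply qpoch_le_rsum, HA|].
  assert (r0 : (0 <= r)%R) by (eapply Rle_trans; [apply Cmod_ge_0 | exact HA]).
  unfold ebound. apply exp_le_compat, Rmult_le_compat_l; [exact r0|].
  apply rsum_geom_le. split; [apply Cmod_ge_0 | exact HQ].
Qed.

(** The increments (A; Q)_(k+1) - (A; Q)_k = - (A; Q)_k A Q^k decay geometrically, so the product is
    a convergent telescoping series. The rate depends on A only through the bound r, hence is
    uniform for A in a disc. *)
Lemma qpoch_inf_spec (A Q : C) (r : R) :
  (Cmod Q < 1)%R -> (Cmod A <= r)%R ->
  Ccv (qpoch A Q) (qpoch_inf A Q) /\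
  forall n, (Cmod (qpoch_inf A Q - qpoch A Q n)
             <= ebound r (Cmod Q) * r / (1 - Cmod Q) * Cmod Q ^ n)%R.
Proof.
  intros HQ HA.
  assert (Et : forall n, csum n (fun k => qpoch A Q (S k) - qpoch A Q k) = qpoch A Q n - 1).
  { induction n; cbn [csum]; [simpl; ring|]. rewrite IHn. ring. }
  destruct (csum_geom_cv (fun k => qpoch A Q (S k) - qpoch A Q k)
              (ebound r (Cmod Q) * r) (Cmod Q)) as (l & Hl & Hb).
  - split; [apply Cmod_ge_0 | exact HQ].
  - intros k. simpl.
    replace (qpoch A Q k * (1 - A * Q ^ k) - qpoch A Q k)
      with (- (qpoch A Q k * (A * Q ^ k))) by ring.
    rewrite Cmod_opp, !Cmod_mult, Cmod_pow, Rmult_assoc.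
    assert (P : (0 <= Cmod Q ^ k)%R) by (apply pow_le, Cmod_ge_0).
    apply Rmult_le_compat; [apply Cmod_ge_0 | | apply qpoch_le; assumption|].
    + apply Rmult_le_pos; [apply Cmod_ge_0 | exact P].
    + apply Rmult_le_compat_r; [exact P | exact HA].
  - assert (Hc : Ccv (qpoch A Q) (1 + l)).
    { apply (Ccv_ext (fun n => 1 + csum n (fun k => qpoch A Q (S k) - qpoch A Q k))).
      - intros n. rewrite Et. ring.
      - apply Ccv_plus; [apply Ccv_const | exact Hl]. }
    assert (E : qpoch_inf A Q = 1 + l).
    { unfold qpoch_inf.
      apply (iota_filterlim_locally (V := C_CompleteNormedModule)
               (F := eventually) (qpoch A Q) (1 + l)).
      apply Ccv_filterlim, Hc. }
    rewrite E. split; [exact Hc|]. intros n.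
    replace (1 + l - qpoch A Q n) with (l - (qpoch A Q n - 1)) by ring.
    rewrite <- Et. apply Hb.
Qed.

Lemma qpoch_inf_cv (A Q : C) : (Cmod Q < 1)%R -> Ccv (qpoch A Q) (qpoch_inf A Q).
Proof. intros HQ. apply (qpoch_inf_spec A Q (Cmod A) HQ (Rle_refl _)). Qed.

Lemma qpoch_inf_le (A Q : C) (r : R) :
  (Cmod Q < 1)%R -> (Cmod A <= r)%R -> (Cmod (qpoch_inf A Q) <= ebound r (Cmod Q))%R.
Proof.
  intros HQ HA. apply (Ccv_le _ _ _ (qpoch_inf_cv A Q HQ)).
  intros n. apply qpoch_le; assumption.
Qed.

Lemma qpoch_inf_add (A Q : C) (n : nat) :
  (Cmod Q < 1)%R -> qpoch_inf A Q = qpoch A Q n * qpoch_inf (A * Q ^ n) Q.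
Proof.
  intros HQ. apply (Ccv_unique (fun m => qpoch A Q (n + m))).
  - apply (Ccv_subseq (fun m => n + m)%nat (qpoch A Q)); [|apply qpoch_inf_cv, HQ].
    intros N. exists N. intros; lia.
  - apply (Ccv_ext (fun m => qpoch A Q n * qpoch (A * Q ^ n) Q m)).
    + intros m. symmetry. apply qpoch_add.
    + apply Ccv_scal, qpoch_inf_cv, HQ.
Qed.

Lemma qpoch_inf_0_l (Q : C) : (Cmod Q < 1)%R -> qpoch_inf 0 Q = 1.
Proof.
  intros HQ. apply (Ccv_unique (qpoch 0 Q)); [apply qpoch_inf_cv, HQ|].
  apply (Ccv_ext (fun _ => 1)); [intros; symmetry; apply qpoch_0_l | apply Ccv_const].
Qed.

Lemma qpoch_lipschitz (A B Q : C) (r : R) (n : nat) :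
  (Cmod Q < 1)%R -> (Cmod A <= r)%R -> (Cmod B <= r)%R ->
  (Cmod (qpoch A Q n - qpoch B Q n) <= ebound r (Cmod Q) / (1 - Cmod Q) * Cmod (A - B))%R.
Proof.
  intros HQ HA HB.
  set (S_ := fun n => rsum n (fun k => Cmod Q ^ k)%R).
  assert (r0 : (0 <= r)%R) by (eapply Rle_trans; [apply Cmod_ge_0 | exact HA]).
  assert (AB := Cmod_ge_0 (A - B)).
  assert (Sn : forall n, (0 <= S_ n)%R).
  { induction n0; unfold S_ in *; simpl; [lra|].
    assert (P : (0 <= Cmod Q ^ n0)%R) by (apply pow_le, Cmod_ge_0). lra. }
  (* The induction closes only with the partial geometric sum [S_ n], which grows by exactly |Q|^n
     at each step; it is replaced by its limit afterwards. *)
  assert (G : (Cmod (qpoch A Q n - qpoch B Q n) <= exp (r * S_ n) * S_ n * Cmod (A - B))%R).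
  { induction n as [|n IH]; [simpl; unfold S_; simpl|].
    { replace (1 - 1) with (RtoC 0) by ring. rewrite Cmod_0. lra. }
    cbn [qpoch].
    replace (qpoch A Q n * (1 - A * Q ^ n) - qpoch B Q n * (1 - B * Q ^ n))
      with ((qpoch A Q n - qpoch B Q n) * (1 - A * Q ^ n)
            + - (qpoch B Q n * ((A - B) * Q ^ n))) by ring.
    assert (P : (0 <= Cmod Q ^ n)%R) by (apply pow_le, Cmod_ge_0).
    assert (E1 : (Cmod (1 - A * Q ^ n) <= exp (r * Cmod Q ^ n))%R).
    { eapply Rle_trans; [apply (Cmod_triangle 1 (- (A * Q ^ n)))|].
      rewrite Cmod_1, Cmod_opp, Cmod_mult, Cmod_pow.
      assert (G := exp_ineq1_le (r * Cmod Q ^ n)). nra. }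
    assert (E2 : (1 <= exp (r * Cmod Q ^ n))%R).
    { assert (G := exp_ineq1_le (r * Cmod Q ^ n)). nra. }
    assert (E3 := qpoch_le_rsum B Q r n HB). fold (S_ n) in E3.
    eapply Rle_trans; [apply Cmod_triangle|]. rewrite Cmod_opp, !Cmod_mult, Cmod_pow.
    change (S_ (S n)) with (S_ n + Cmod Q ^ n)%R.
    rewrite (Rmult_plus_distr_l r), exp_plus.
    set (x := exp (r * S_ n)) in *. set (y := exp (r * Cmod Q ^ n)) in *.
    assert (x0 : (0 < x)%R) by apply exp_pos.
    replace (x * y * (S_ n + Cmod Q ^ n) * Cmod (A - B))%R
      with (x * S_ n * Cmod (A - B) * y + (x * y) * (Cmod (A - B) * Cmod Q ^ n))%R by ring.
    apply Rplus_le_compat.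
    - apply Rmult_le_compat; try apply Cmod_ge_0; assumption.
    - apply Rmult_le_compat; [apply Cmod_ge_0 | nra | | lra].
      eapply Rle_trans; [exact E3|]. nra. }
  eapply Rle_trans; [exact G|]. apply Rmult_le_compat_r; [exact AB|].
  assert (L := rsum_geom_le n (Cmod Q) (conj (Cmod_ge_0 Q) HQ)). fold (S_ n) in L.
  unfold Rdiv, ebound. apply Rmult_le_compat; [left; apply exp_pos | apply Sn | | exact L].
  apply exp_le_compat, Rmult_le_compat_l; assumption.
Qed.

Lemma qpoch_inf_lipschitz (A B Q : C) (r : R) :
  (Cmod Q < 1)%R -> (Cmod A <= r)%R -> (Cmod B <= r)%R ->
  (Cmod (qpoch_inf A Q - qpoch_inf B Q)
   <= ebound r (Cmod Q) / (1 - Cmod Q) * Cmod (A - B))%R.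
Proof.
  intros HQ HA HB.
  apply Ccv_le with (u := fun n => qpoch A Q n + - (1) * qpoch B Q n).
  - apply (Ccv_eq _ (qpoch_inf A Q + - (1) * qpoch_inf B Q)); [ring|].
    apply Ccv_plus; [|apply Ccv_scal]; apply qpoch_inf_cv, HQ.
  - intros n. replace (qpoch A Q n + - (1) * qpoch B Q n) with (qpoch A Q n - qpoch B Q n) by ring.
    apply qpoch_lipschitz; assumption.
Qed.

(* The tails (A Q^n; Q)_oo tend to (0; Q)_oo = 1, so one of them is nonzero. *)
Lemma qpoch_inf_neq_0 (A Q : C) :
  (Cmod Q < 1)%R -> (forall k, 1 - A * Q ^ k <> 0) -> qpoch_inf A Q <> 0.
Proof.
  intros HQ HA.
  set (L := (ebound (Cmod A) (Cmod Q) / (1 - Cmod Q))%R).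
  destruct (Rpow_cv_0 (Cmod Q) (L * Cmod A) 1) as [N HN];
    [split; [apply Cmod_ge_0 | exact HQ] | lra |].
  rewrite (qpoch_inf_add A Q N HQ).
  apply Cmult_neq_0; [apply qpoch_neq_0; intros; apply HA|].
  intros E.
  assert (Hs : (Cmod (A * Q ^ N) <= Cmod A)%R).
  { rewrite Cmod_mult, Cmod_pow. assert (G := Cmod_ge_0 A).
    assert (P : (Cmod Q ^ N <= 1)%R).
    { rewrite <- (pow1 N). apply pow_incr. split; [apply Cmod_ge_0 | lra]. }
    nra. }
  assert (G := qpoch_inf_lipschitz (A * Q ^ N) 0 Q (Cmod A) HQ Hs).
  rewrite Cmod_0 in G. specialize (G (Cmod_ge_0 A)).
  rewrite E, qpoch_inf_0_l in G by exact HQ.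
  replace (0 - 1) with (- (1)) in G by ring. rewrite Cmod_m1 in G.
  replace (A * Q ^ N - 0) with (A * Q ^ N) in G by ring.
  rewrite Cmod_mult, Cmod_pow in G. fold L in G.
  assert (H := HN N (le_n N)). nra.
Qed.

Lemma Cinv_neq_0 (z : C) : z <> 0 -> / z <> 0.
Proof.
  intros Hz E. apply C1_nz. rewrite <- (Cinv_r z Hz), E. ring.
Qed.

(** The cost of multiplying or dividing a power series by a q-Pochhammer symbol, whatever its
    length. Multiplication needs only exp(1/(1 - r)). Division needs the square in the exponent,
    because for t <= r one has 1/(1 - t) = 1 + t/(1 - t) <= exp(t/(1 - r)). One function serves
    both. *)
Definition majorant (r : R) : R := exp (/ (1 - r) * / (1 - r)).

Lemma rsum_pow_progression_le (r : R) (a b n : nat) :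
  (0 <= r < 1)%R -> (1 <= b)%nat -> (rsum n (fun k => r ^ (a + b * k)) <= / (1 - r))%R.
Proof.
  intros Hr Hb. eapply Rle_trans; [|apply (rsum_geom_le n r Hr)].
  apply rsum_le. intros k _.
  replace (a + b * k)%nat with (k + (a + (b - 1) * k))%nat by nia.
  rewrite pow_add.
  assert (P : (0 <= r ^ k)%R) by (apply pow_le; lra).
  assert (P' : (r ^ (a + (b - 1) * k) <= 1)%R).
  { rewrite <- (pow1 (a + (b - 1) * k)). apply pow_incr; lra. }
  nra.
Qed.

Lemma Rinv_one_minus_ge_1 (r : R) : (0 <= r < 1)%R -> (1 <= / (1 - r))%R.
Proof. intros H. rewrite <- Rinv_1 at 1. apply Rinv_le_contravar; lra. Qed.

Lemma ps_mul_qpoch (a b n : nat) (f : C -> C) (M : R -> R) (x y : C) :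
  (1 <= b)%nat -> ((2 <= a)%nat \/ (x = 0 /\ y = 0)) \/ n = 0%nat -> ps f M x y ->
  ps (fun s => f s * qpoch (s ^ a) (s ^ b) n) (fun r => M r * majorant r)%R x y.
Proof.
  intros Hb Ha H.
  apply (ps_weaken _ (fun r => M r * exp (rsum n (fun k => r ^ (a + b * k))))%R).
  { intros r Hr. apply Rmult_le_compat_l; [exact (ps_pos f M x y r H Hr)|].
    apply exp_le_compat. eapply Rle_trans; [apply rsum_pow_progression_le; assumption|].
    assert (G := Rinv_one_minus_ge_1 r Hr). nra. }
  revert Ha. induction n as [|n IH]; intros Ha.
  - apply (ps_ext f); [intros; simpl; ring|].
    apply (ps_weaken f M); [|exact H]. intros r Hr. simpl. rewrite exp_0. lra.
  - destruct Ha as [Ha|]; [|discriminate].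
    apply (ps_ext (fun s => f s * qpoch (s ^ a) (s ^ b) n * (1 - s ^ (a + b * n)))).
    { intros s _. simpl. rewrite Cpow_add_r, Cpow_mult_r. ring. }
    apply (ps_weaken _ (fun r => M r * exp (rsum n (fun k => r ^ (a + b * k)))
                                * (1 + r ^ (a + b * n)))%R).
    { intros r Hr. cbn [rsum]. rewrite exp_plus, <- Rmult_assoc.
      apply Rmult_le_compat_l; [|apply exp_ineq1_le].
      apply Rmult_le_pos; [exact (ps_pos f M x y r H Hr) | left; apply exp_pos]. }
    apply ps_mul_one_minus_pow; [|apply IH; left; exact Ha].
    destruct Ha as [Ha|Ha]; [left; lia | right; exact Ha].
Qed.

Lemma qpoch_pow_neq_0 (s : C) (a b n : nat) :
  (Cmod s < 1)%R -> (1 <= a)%nat -> qpoch (s ^ a) (s ^ b) n <> 0.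
Proof.
  intros Hs Ha. apply qpoch_neq_0. intros k _.
  rewrite <- Cpow_mult_r, <- Cpow_add_r. apply one_minus_pow_neq_0; [exact Hs | lia].
Qed.

Lemma ps_div_qpoch (a b n : nat) (f : C -> C) (M : R -> R) (x y : C) :
  (1 <= b)%nat -> (2 <= a)%nat -> ps f M x y ->
  ps (fun s => f s / qpoch (s ^ a) (s ^ b) n) (fun r => M r * majorant r)%R x y.
Proof.
  intros Hb Ha H.
  apply (ps_weaken _ (fun r => M r * exp (rsum n (fun k => r ^ (a + b * k)) * / (1 - r)))%R).
  { intros r Hr. apply Rmult_le_compat_l; [exact (ps_pos f M x y r H Hr)|].
    assert (G := Rinv_one_minus_ge_1 r Hr).
    apply exp_le_compat, Rmult_le_compat_r; [lra|]. apply rsum_pow_progression_le; assumption. }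
  induction n as [|n IH].
  - apply (ps_ext f); [intros; simpl; field; apply C1_nz|].
    apply (ps_weaken f M); [|exact H]. intros r Hr. simpl. rewrite Rmult_0_l, exp_0. lra.
  - apply (ps_ext (fun s => f s / qpoch (s ^ a) (s ^ b) n / (1 - s ^ (a + b * n)))).
    { intros s Hs. cbn [qpoch]. rewrite <- Cpow_mult_r, <- Cpow_add_r. field. split.
      - apply one_minus_pow_neq_0; [exact Hs | lia].
      - apply qpoch_pow_neq_0; [exact Hs | lia]. }
    apply (ps_weaken _ (fun r => M r * exp (rsum n (fun k => r ^ (a + b * k)) * / (1 - r))
                                / (1 - r ^ (a + b * n)))%R).
    { intros r Hr. cbn [rsum]. rewrite Rmult_plus_distr_r, exp_plus, <- Rmult_assoc.
      apply Rmult_le_compat_l.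
      { apply Rmult_le_pos; [exact (ps_pos f M x y r H Hr) | left; apply exp_pos]. }
      assert (G := pow_lt_1_pos r (a + b * n) Hr ltac:(lia)).
      set (t := (r ^ (a + b * n))%R) in *.
      eapply Rle_trans; [|apply exp_ineq1_le].
      replace (/ (1 - t))%R with (1 + t * / (1 - t))%R by (field; lra).
      apply Rplus_le_compat_l, Rmult_le_compat_l; [lra|].
      apply Rinv_le_contravar; lra. }
    apply ps_div_one_minus_pow; [lia | left; lia | exact IH].
Qed.

(** * Truncations of the function to be huffed and their limit *)

Definition hexp (k : nat) : nat := (3 * (k * (k - 1) / 2) + 4 * k)%nat.

(* Times [(1 - 1/s) / 3], this is minus the residue at [z = s^-(4+3k)] of the
   integrand with all products truncated at level [K] (see [residue_eq]). *)
Definition approx_term (K k : nat) (s : C) : C :=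
  (- (1)) ^ k * (s ^ hexp k * 1 *
    qpoch (s ^ 2) (s ^ 3) (K - k) * qpoch (s ^ 2) (s ^ 3) (K - 1 - k) *
    qpoch (s ^ 4) (s ^ 3) (K + k) * qpoch (s ^ 1) (s ^ 3) k /
    qpoch (s ^ 9) (s ^ 9) (K - 1 - k) / qpoch (s ^ 9) (s ^ 9) k).

Definition approx_sum (K : nat) (s : C) : C := csum K (fun k => approx_term K k s).

(** Each of the six q-Pochhammer symbols costs one [majorant], and hexp k >= k yields the factor
    r^k. The bound is independent of [K] and geometric in [k], as dominated convergence requires.
    For k >= 1 the exponent [hexp k] is at least 4, so both tracked coefficients vanish; the term k
    = 0 is 1 + O(s^2). *)
Lemma ps_approx_term (K k : nat) :
  ps (approx_term K k) (fun r => majorant r ^ 6 * r ^ k)%R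
    (match k with O => RtoC 1 | S _ => RtoC 0 end) 0.
Proof.
  set (x := match k with O => RtoC 1 | S _ => RtoC 0 end).
  assert (H0 : ps (fun s => s ^ hexp k * 1) (fun r => r ^ k)%R x 0).
  { destruct (ps_mul_pow (hexp k) _ _ _ _ (ps_const 1)) as (x' & y' & H & E).
    apply (ps_weaken _ (fun r => r ^ hexp k * Cmod 1)%R).
    - intros r Hr. rewrite Cmod_1, Rmult_1_r.
      replace (hexp k) with (k + (hexp k - k))%nat by (unfold hexp; lia).
      rewrite pow_add. assert (P : (0 <= r ^ k)%R) by (apply pow_le; lra).
      assert (P' : (r ^ (hexp k - k) <= 1)%R).
      { rewrite <- (pow1 (hexp k - k)). apply pow_incr; lra. }
      nra.
    - destruct k as [|k].
      + apply (ps_ext (fun _ => 1)); [intros; simpl; ring|].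
        apply (ps_weaken _ (fun _ => Cmod 1)); [intros; simpl; lra | apply ps_const].
      + destruct E as [-> ->]; [left; unfold hexp; lia | exact H]. }
  (* The symbol (s; s^3)_k contains the factor 1 - s as soon as k >= 1, but then the power s^hexp k
     has already cleared the tracked coefficients. *)
  assert (Hk : ((2 <= 1)%nat \/ (x = 0 /\ RtoC 0 = 0)) \/ k = 0%nat).
  { destruct k; [right; reflexivity | left; right; split; reflexivity]. }
  apply (ps_mul_qpoch 2 3 (K - k)) in H0; [|lia | left; left; lia].
  apply (ps_mul_qpoch 2 3 (K - 1 - k)) in H0; [|lia | left; left; lia].
  apply (ps_mul_qpoch 4 3 (K + k)) in H0; [|lia | left; left; lia].
  apply (ps_mul_qpoch 1 3 k) in H0; [|lia | exact Hk].
  apply (ps_div_qpoch 9 9 (K - 1 - k)) in H0; [|lia|lia].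
  apply (ps_div_qpoch 9 9 k) in H0; [|lia|lia].
  apply (ps_scal ((- (1)) ^ k)) in H0.
  replace x with ((- (1)) ^ k * x) by (unfold x; destruct k; simpl; ring).
  replace (RtoC 0) with ((- (1)) ^ k * 0) by ring.
  revert H0. apply ps_weaken. intros r Hr. rewrite Cmod_pow, Cmod_m1, pow1. right; ring.
Qed.

Lemma ps_approx_sum (K : nat) :
  (1 <= K)%nat -> ps (approx_sum K) (fun r => majorant r ^ 6 * / (1 - r))%R 1 0.
Proof.
  intros HK.
  apply (ps_weaken _ (fun r => majorant r ^ 6 * rsum K (fun k => r ^ k))%R).
  { intros r Hr. apply Rmult_le_compat_l; [apply pow_le; left; apply exp_pos|].
    apply rsum_geom_le, Hr. }
  unfold approx_sum.
  assert (G : forall n, ps (fun s => csum (S n) (fun k => approx_term K k s))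
    (fun r => majorant r ^ 6 * rsum (S n) (fun k => r ^ k))%R 1 0).
  { induction n.
    - apply (ps_ext (approx_term K 0)); [intros; simpl; ring|].
      apply (ps_weaken _ (fun r => majorant r ^ 6 * r ^ 0)%R); [intros; simpl; lra|].
      apply ps_approx_term.
    - replace (RtoC 1) with (1 + 0) by ring. replace (RtoC 0) with (0 + 0) at 2 by ring.
      apply (ps_weaken _ (fun r => majorant r ^ 6 * rsum (S n) (fun k => r ^ k)
                                   + majorant r ^ 6 * r ^ (S n))%R).
      { intros r _. cbn [rsum]. right; ring. }
      apply (ps_plus _ _ _ _ _ _ _ _ IHn (ps_approx_term K (S n))). }
  destruct K; [lia | apply G].
Qed.

(** The function to be huffed with its factor 1 - 1/s removed: splitting off the first factor of
    (1/s; s^3)_oo leaves a second copy of (s^2; s^3)_oo. Unlike the original it is a power series at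
    0. *)
Definition approx_lim (s : C) : C :=
  qpoch_inf (s ^ 2) (s ^ 3) * qpoch_inf (s ^ 2) (s ^ 3) * qpoch_inf (s ^ 4) (s ^ 3) /
  qpoch_inf (s ^ 9) (s ^ 9) *
  CSeries (fun n : nat =>
    (- (1)) ^ n * s ^ (3 * (n * (n - 1) / 2) + 4 * n)%nat *
    qpoch s (s ^ 3) n / qpoch (s ^ 9) (s ^ 9) n).

Lemma Cmod_pow_lt_1 (s : C) (m : nat) : (Cmod s < 1)%R -> (1 <= m)%nat -> (Cmod (s ^ m) < 1)%R.
Proof.
  intros Hs Hm. rewrite Cmod_pow.
  assert (G := pow_lt_1_pos (Cmod s) m (conj (Cmod_ge_0 s) Hs) Hm). lra.
Qed.

Lemma qpoch_inf_pow_neq_0 (s : C) (a b : nat) :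
  (Cmod s < 1)%R -> (1 <= a)%nat -> (1 <= b)%nat -> qpoch_inf (s ^ a) (s ^ b) <> 0.
Proof.
  intros Hs Ha Hb. apply qpoch_inf_neq_0; [apply Cmod_pow_lt_1; assumption|].
  intros k. rewrite <- Cpow_mult_r, <- Cpow_add_r. apply one_minus_pow_neq_0; [exact Hs | lia].
Qed.

Lemma approx_sum_cv (s : C) :
  (Cmod s < 1)%R -> Ccv (fun K => approx_sum K s) (approx_lim s).
Proof.
  intros Hs.
  assert (H3 := Cmod_pow_lt_1 s 3 Hs ltac:(lia)). assert (H9 := Cmod_pow_lt_1 s 9 Hs ltac:(lia)).
  set (c := qpoch_inf (s ^ 2) (s ^ 3) * qpoch_inf (s ^ 2) (s ^ 3) * qpoch_inf (s ^ 4) (s ^ 3) /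
    qpoch_inf (s ^ 9) (s ^ 9)).
  set (w := fun n : nat =>
    (- (1)) ^ n * s ^ (3 * (n * (n - 1) / 2) + 4 * n)%nat *
    qpoch s (s ^ 3) n / qpoch (s ^ 9) (s ^ 9) n).
  assert (c0 : c <> 0).
  { unfold c. apply Cmult_neq_0.
    - repeat apply Cmult_neq_0; apply qpoch_inf_pow_neq_0; (exact Hs || lia).
    - apply Cinv_neq_0, qpoch_inf_pow_neq_0; (exact Hs || lia). }
  (* Terms are extended by zero beyond [K], so that every truncation becomes a series dominated by
     the same geometric sequence. *)
  destruct (tannery (fun K k => if (k <? K)%nat then approx_term K k s else RtoC 0)
              (fun k => c * w k) (fun K => approx_sum K s)
              (majorant (Cmod s) ^ 6) (Cmod s)) as (l & Hl1 & Hl2).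
  - split; [apply Cmod_ge_0 | exact Hs].
  - intros K. unfold approx_sum. apply (Ccv_ext_ev K (fun _ => csum K (fun k => approx_term K k s)));
      [|apply Ccv_const].
    intros n Hn. replace n with (K + (n - K))%nat by lia. rewrite csum_add.
    rewrite (csum_0 (n - K)), Cplus_0_r.
    + apply csum_ext. intros i Hi. rewrite (proj2 (Nat.ltb_lt i K) Hi). reflexivity.
    + intros i _. rewrite (proj2 (Nat.ltb_ge (K + i) K)) by lia. reflexivity.
  - intros k. apply (Ccv_ext_ev (S k) (fun K => approx_term K k s)).
    { intros K HK. rewrite (proj2 (Nat.ltb_lt k K)) by lia. reflexivity. }
    unfold approx_term.
    apply (Ccv_eq _ ((- (1)) ^ k * (s ^ hexp k * 1 *
      qpoch_inf (s ^ 2) (s ^ 3) * qpoch_inf (s ^ 2) (s ^ 3) *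
      qpoch_inf (s ^ 4) (s ^ 3) * qpoch (s ^ 1) (s ^ 3) k /
      qpoch_inf (s ^ 9) (s ^ 9) / qpoch (s ^ 9) (s ^ 9) k))).
    { unfold c, w, hexp. rewrite Cpow_1_r. field. split.
      - apply qpoch_pow_neq_0; [exact Hs | lia].
      - apply qpoch_inf_pow_neq_0; (exact Hs || lia). }
    assert (Hphi1 : forall N, exists M, forall n, (M <= n)%nat -> (N <= n - k)%nat)
      by (intros N; exists (N + k)%nat; intros; lia).
    assert (Hphi2 : forall N, exists M, forall n, (M <= n)%nat -> (N <= n - 1 - k)%nat)
      by (intros N; exists (N + k + 1)%nat; intros; lia).
    assert (Hphi3 : forall N, exists M, forall n, (M <= n)%nat -> (N <= n + k)%nat)
      by (intros N; exists N; intros; lia).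
    apply Ccv_scal. unfold Cdiv. apply Ccv_mult; [|apply Ccv_const].
    apply Ccv_mult; [apply Ccv_mult; [|apply Ccv_const]|].
    2: { apply Ccv_inv; [apply qpoch_inf_pow_neq_0; (exact Hs || lia)|].
         apply (Ccv_subseq _ (qpoch _ _) _ Hphi2), qpoch_inf_cv, H9. }
    apply Ccv_mult; [apply Ccv_mult; [apply Ccv_scal|]|].
    + apply (Ccv_subseq _ (qpoch _ _) _ Hphi1), qpoch_inf_cv, H3.
    + apply (Ccv_subseq _ (qpoch _ _) _ Hphi2), qpoch_inf_cv, H3.
    + apply (Ccv_subseq _ (qpoch _ _) _ Hphi3), qpoch_inf_cv, H3.
  - intros K k.
    assert (G := ps_bound _ _ _ _ s (ps_approx_term K k) Hs). cbv beta in G.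
    destruct (k <? K)%nat; [exact G|]. rewrite Cmod_0.
    apply Rmult_le_pos; [apply pow_le; left; apply exp_pos | apply pow_le, Cmod_ge_0].
  (* Dominated convergence concerns the terms c w_n. Since [c] is not 0, the series of the w_n
     converges as well, which is what gives [CSeries] its value. *)
  - assert (Hw : Ccv (fun n => csum n w) (/ c * l)).
    { apply (Ccv_ext (fun n => / c * csum n (fun k => c * w k))).
      - intros n. rewrite csum_scal. field. exact c0.
      - apply Ccv_scal, Hl1. }
    assert (E : CSeries w = / c * l).
    { unfold CSeries.
      apply (iota_unique (V := C_CompleteNormedModule)).
      - intros y Hy. apply is_series_csum in Hy. exact (Ccv_unique _ _ _ Hy Hw).
      - apply is_series_csum, Hw. }
    apply (Ccv_eq _ l); [|exact Hl2].
    unfold approx_lim. fold c. fold w. rewrite E. field. exact c0.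
Qed.

Lemma ps_approx_lim : ps approx_lim (fun r => majorant r ^ 6 * / (1 - r))%R 1 0.
Proof.
  (* The index starts at 1: the empty sum has constant coefficient 0 instead of 1. *)
  apply (ps_lim (fun K => approx_sum (S K))).
  - intros K. apply ps_approx_sum. lia.
  - intros s Hs. apply (Ccv_subseq S (fun K => approx_sum K s)); [|apply approx_sum_cv, Hs].
    intros N. exists N. intros; lia.
Qed.

Lemma huffed_function_eq (s : C) :
  (0 < Cmod s < 1)%R -> huffed_function s = (1 - / s) * approx_lim s.
Proof.
  intros Hs. assert (s0 : s <> 0) by (apply Cmod_gt_0; lra).
  unfold huffed_function, approx_lim, qpoch_inf3.
  rewrite (qpoch_inf_add (/ s) (s ^ 3) 1) by (apply Cmod_pow_lt_1; [lra | lia]).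
  replace (/ s * (s ^ 3) ^ 1) with (s ^ 2) by (simpl; field; exact s0).
  simpl qpoch. field. split; [|exact s0].
  apply qpoch_inf_pow_neq_0; [lra | lia | lia].
Qed.

(** * Partial fractions and residues *)

Lemma one_minus_div_neq_0 (x y : C) : x <> 0 -> y <> x -> 1 - y / x <> 0.
Proof.
  intros Hx H E. apply H. replace y with (x - x * (1 - y / x)) by (field; exact Hx).
  rewrite E. ring.
Qed.

(** The coefficient of 1/(1 - x_i z): numerator and remaining denominator factors at z = 1/x_i, the
    factor of index [i] being replaced by 1. With one numerator factor fewer than denominator
    factors, no polynomial part arises. *)
Definition pf_coef (u x : nat -> C) (n i : nat) : C :=
  cprod n (fun l => 1 - u l / x i) /
  cprod (S n) (fun j => if (j =? i)%nat then RtoC 1 else 1 - x j / x i).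

(* Evaluating the decomposition for n + 1 points at z = 1 / x (n + 1) gives the
   coefficient at the new point. *)
Lemma partial_fractions (u x : nat -> C) (n : nat) :
  (forall i, (i <= n)%nat -> x i <> 0) ->
  (forall i j, (i <= n)%nat -> (j <= n)%nat -> i <> j -> x i <> x j) ->
  forall z, (forall i, (i <= n)%nat -> 1 - x i * z <> 0) ->
  cprod n (fun l => 1 - u l * z) / cprod (S n) (fun i => 1 - x i * z)
  = csum (S n) (fun i => pf_coef u x n i / (1 - x i * z)).
Proof.
  induction n as [|n IH]; intros Hx0 Hinj z Hz.
  - unfold pf_coef. simpl. field. apply Hz. lia.
  - assert (IH1 := IH ltac:(intros; apply Hx0; lia) ltac:(intros; apply Hinj; lia)).
    set (y := x (S n)) in *.
    assert (y0 : y <> 0) by (apply Hx0; lia).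
    assert (Hy : 1 - y * z <> 0) by (apply Hz; lia).
    assert (Hxy : forall i, (i <= n)%nat -> x i <> y) by (intros; apply Hinj; lia).
    assert (Hcz : cprod (S n) (fun i => 1 - x i * z) <> 0)
      by (apply cprod_neq_0; intros; apply Hz; lia).
    assert (Hcy : cprod (S n) (fun i => 1 - x i / y) <> 0)
      by (apply cprod_neq_0; intros; apply one_minus_div_neq_0; [exact y0 | apply Hxy; lia]).
    assert (Ez := IH1 z ltac:(intros; apply Hz; lia)).
    assert (Ey := IH1 (/ y) ltac:(intros; apply one_minus_div_neq_0; [exact y0 | apply Hxy; lia])).
    change (cprod (S n) (fun l => 1 - u l * z)) with (cprod n (fun l => 1 - u l * z) * (1 - u n * z)).
    change (cprod (S (S n)) (fun i => 1 - x i * z))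
      with (cprod (S n) (fun i => 1 - x i * z) * (1 - y * z)).
    replace (cprod n (fun l => 1 - u l * z) * (1 - u n * z) /
             (cprod (S n) (fun i => 1 - x i * z) * (1 - y * z)))
      with ((1 - u n * z) / (1 - y * z) *
            (cprod n (fun l => 1 - u l * z) / cprod (S n) (fun i => 1 - x i * z)))
      by (field; split; assumption).
    rewrite Ez, <- csum_scal.
    change (csum (S (S n)) (fun i => pf_coef u x (S n) i / (1 - x i * z)))
      with (csum (S n) (fun i => pf_coef u x (S n) i / (1 - x i * z))
            + pf_coef u x (S n) (S n) / (1 - y * z)).
    assert (Elast : pf_coef u x (S n) (S n)
      = csum (S n) (fun i => (1 - u n / y) * (pf_coef u x n i / (1 - x i * / y)))).
    { rewrite csum_scal, <- Ey. unfold pf_coef.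
      change (cprod (S n) (fun l => 1 - u l / x (S n)))
        with (cprod n (fun l => 1 - u l * / y) * (1 - u n / y)).
      change (cprod (S (S n)) (fun j => if (j =? S n)%nat then RtoC 1 else 1 - x j / x (S n)))
        with (cprod (S n) (fun j => if (j =? S n)%nat then RtoC 1 else 1 - x j / x (S n))
              * (if (S n =? S n)%nat then RtoC 1 else 1 - x (S n) / x (S n))).
      rewrite Nat.eqb_refl.
      rewrite (cprod_ext (S n) (fun j => if (j =? S n)%nat then RtoC 1 else 1 - x j / x (S n))
                 (fun i => 1 - x i * / y)).
      2: { intros i Hi. rewrite (proj2 (Nat.eqb_neq i (S n))) by lia. reflexivity. }
      unfold Cdiv in *. set (P := cprod (S n) (fun i => 1 - x i * / y)) in *.
      field. split; assumption. }
    rewrite Elast.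
    replace (csum (S n) (fun i => (1 - u n / y) * (pf_coef u x n i / (1 - x i * / y))) / (1 - y * z))
      with (/ (1 - y * z) * csum (S n) (fun i => (1 - u n / y) * (pf_coef u x n i / (1 - x i * / y))))
      by (unfold Cdiv; ring).
    (* Term by term this is the decomposition of (1 - u z) / ((1 - x_i z) (1 - y z)) at its two
       poles. *)
    rewrite <- csum_scal, <- csum_plus. apply csum_ext. intros i Hi.
    assert (Hxi : x i <> 0) by (apply Hx0; lia).
    assert (Hzi : 1 - x i * z <> 0) by (apply Hz; lia).
    assert (Hxyi : x i <> y) by (apply Hxy; lia).
    assert (Hd1 : y - x i <> 0).
    { intros E. apply Hxyi. replace (x i) with (y - (y - x i)) by ring. rewrite E. ring. }
    assert (Hd2 : x i - y <> 0).
    { intros E. apply Hd1. replace (y - x i) with (- (x i - y)) by ring. rewrite E. ring. }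
    replace (pf_coef u x (S n) i) with (pf_coef u x n i * ((1 - u n / x i) / (1 - y / x i))).
    2: { unfold pf_coef.
      change (cprod (S n) (fun l => 1 - u l / x i))
        with (cprod n (fun l => 1 - u l / x i) * (1 - u n / x i)).
      change (cprod (S (S n)) (fun j => if (j =? i)%nat then RtoC 1 else 1 - x j / x i))
        with (cprod (S n) (fun j => if (j =? i)%nat then RtoC 1 else 1 - x j / x i)
              * (if (S n =? i)%nat then RtoC 1 else 1 - x (S n) / x i)).
      rewrite (proj2 (Nat.eqb_neq (S n) i)) by lia. fold y.
      assert (Hc : cprod (S n) (fun j => if (j =? i)%nat then RtoC 1 else 1 - x j / x i) <> 0).
      { apply cprod_neq_0. intros j Hj. destruct (Nat.eqb_spec j i) as [|Hji]; [apply C1_nz|].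
        apply one_minus_div_neq_0; [exact Hxi | apply Hinj; lia]. }
      set (P := cprod (S n) (fun j => if (j =? i)%nat then RtoC 1 else 1 - x j / x i)) in *.
      field. repeat split; assumption. }
    field. repeat split; assumption.
Qed.

Lemma cprod_3 (K : nat) (f : nat -> C) :
  cprod (3 * K) f = cprod K (fun k => f (3 * k)%nat * f (3 * k + 1)%nat * f (3 * k + 2)%nat).
Proof.
  induction K; [reflexivity|].
  replace (3 * S K)%nat with (S (S (S (3 * K)))) by lia. cbn [cprod]. rewrite IHK.
  replace (S (S (3 * K))) with (3 * K + 2)%nat by lia.
  replace (S (3 * K)) with (3 * K + 1)%nat by lia. ring.
Qed.

Lemma csum_3 (K : nat) (f : nat -> C) :
  csum (3 * K) f = csum K (fun k => f (3 * k)%nat + f (3 * k + 1)%nat + f (3 * k + 2)%nat).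
Proof.
  induction K; [reflexivity|].
  replace (3 * S K)%nat with (S (S (S (3 * K)))) by lia. cbn [csum]. rewrite IHK.
  replace (S (S (3 * K))) with (3 * K + 2)%nat by lia.
  replace (S (3 * K)) with (3 * K + 1)%nat by lia. ring.
Qed.

(** * Cube roots of unity and the nodes of the truncated integrand *)

Lemma omega_sum : 1 + omega + omega ^ 2 = 0.
Proof.
  unfold omega.
  replace (2 * PI / 3)%R with (2 * (PI / 3))%R by field.
  rewrite cos_2PI3, sin_2PI3.
  assert (S3 : (sqrt 3 * sqrt 3 = 3)%R) by (apply sqrt_sqrt; lra).
  apply injective_projections; simpl; nra.
Qed.

Lemma omega_3 : omega ^ 3 = 1.
Proof.
  replace (omega ^ 3) with (1 + (omega - 1) * (1 + omega + omega ^ 2)) by ring.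
  rewrite omega_sum. ring.
Qed.

Lemma omega_neq_0 : omega <> 0.
Proof. intros E. apply C1_nz. rewrite <- omega_3, E. simpl. ring. Qed.

Lemma Cmod_omega : Cmod omega = 1%R.
Proof.
  assert (H : (Cmod omega ^ 3 = 1)%R) by (rewrite <- Cmod_pow, omega_3; apply Cmod_1).
  assert (G := Cmod_ge_0 omega).
  assert (F : ((Cmod omega - 1) * (Cmod omega ^ 2 + Cmod omega + 1) = 0)%R) by (simpl in *; lra).
  apply Rmult_integral in F. destruct F as [F|F]; [lra|].
  exfalso. simpl in F. nra.
Qed.

Lemma one_minus_omega_prod (y : C) :
  (1 - y) * (1 - omega * y) * (1 - omega ^ 2 * y) = 1 - y ^ 3.
Proof.
  replace ((1 - y) * (1 - omega * y) * (1 - omega ^ 2 * y))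
    with (1 - omega ^ 3 * y ^ 3 + (1 + omega + omega ^ 2) * (omega * y ^ 2 - y)) by ring.
  rewrite omega_sum, omega_3. ring.
Qed.

(** Inverses of the zeros of the denominator. The index 3k + j stands for omega^j q^(4+3k), so that
    three consecutive nodes form an orbit under multiplication by [omega]. *)
Definition node (q : C) (i : nat) : C := omega ^ (i mod 3) * q ^ (4 + 3 * (i / 3)).

(** The parameters of the numerator in the same indexing. There are only 2K of them against 3K
    nodes, so every third one is 0 and contributes a factor 1. *)
Definition num_node (q : C) (i : nat) : C :=
  match (i mod 3)%nat with
  | 0%nat => q ^ 6 * (q ^ 3) ^ (i / 3)
  | 1%nat => q ^ 3 * (q ^ 3) ^ (i / 3)
  | _ => 0
  end.

Lemma div_mod_3 (k j : nat) :
  (j < 3)%nat -> ((3 * k + j) / 3 = k /\ (3 * k + j) mod 3 = j)%nat.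
Proof.
  intros Hj. rewrite (Nat.mul_comm 3 k), Nat.add_comm. split.
  - rewrite Nat.div_add by lia. rewrite Nat.div_small by exact Hj. reflexivity.
  - rewrite Nat.Div0.mod_add. apply Nat.mod_small, Hj.
Qed.

Lemma node_3 (q : C) (k j : nat) :
  (j < 3)%nat -> node q (3 * k + j) = omega ^ j * q ^ (4 + 3 * k).
Proof. intros Hj. unfold node. destruct (div_mod_3 k j Hj) as [-> ->]. reflexivity. Qed.

Lemma node_3_0 (q : C) (k : nat) : node q (3 * k) = omega ^ 0 * q ^ (4 + 3 * k).
Proof. rewrite <- (Nat.add_0_r (3 * k)) at 1. apply node_3. lia. Qed.

Lemma num_node_0 (q : C) (k : nat) : num_node q (3 * k) = q ^ 6 * (q ^ 3) ^ k.
Proof.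
  unfold num_node. rewrite <- (Nat.add_0_r (3 * k)).
  destruct (div_mod_3 k 0 ltac:(lia)) as [-> ->]. reflexivity.
Qed.

Lemma num_node_1 (q : C) (k : nat) : num_node q (3 * k + 1) = q ^ 3 * (q ^ 3) ^ k.
Proof. unfold num_node. destruct (div_mod_3 k 1 ltac:(lia)) as [-> ->]. reflexivity. Qed.

Lemma num_node_2 (q : C) (k : nat) : num_node q (3 * k + 2) = 0.
Proof. unfold num_node. destruct (div_mod_3 k 2 ltac:(lia)) as [-> ->]. reflexivity. Qed.

Lemma node_neq_0 (q : C) (i : nat) : q <> 0 -> node q i <> 0.
Proof.
  intros Hq. apply Cmult_neq_0; apply Cpow_nz; [exact omega_neq_0 | exact Hq].
Qed.

Lemma omega_pow_inj (i j : nat) :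
  (i < 3)%nat -> (j < 3)%nat -> omega ^ i = omega ^ j -> i = j.
Proof.
  assert (o1 : omega <> 1).
  { intros E. assert (H := omega_sum). rewrite E in H.
    apply (f_equal fst) in H. simpl in H. lra. }
  assert (o2 : omega ^ 2 <> 1).
  { intros E. apply o1. rewrite <- omega_3.
    replace (omega ^ 3) with (omega * omega ^ 2) by ring. rewrite E. ring. }
  assert (o3 : omega ^ 2 <> omega).
  { intros E. apply o2. rewrite <- omega_3.
    replace (omega ^ 3) with (omega * omega ^ 2) by ring. rewrite E at 2. ring. }
  intros Hi Hj E.
  destruct i as [|[|[|i]]]; [| | |lia]; (destruct j as [|[|[|j]]]; [| | |lia]);
    try reflexivity; exfalso; rewrite ?Cpow_1_r in E;
    change (omega ^ 0) with (RtoC 1) in E; (tauto || (symmetry in E; tauto)).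
Qed.

Lemma pow_inj_lt_1 (r : R) (n m : nat) : (0 < r < 1)%R -> (r ^ n = r ^ m)%R -> n = m.
Proof.
  assert (G : forall n m, (0 < r < 1)%R -> (n < m)%nat -> (r ^ m < r ^ n)%R).
  { intros a b Hr Hab. replace b with (a + (b - a))%nat by lia. rewrite pow_add.
    assert (P : (0 < r ^ a)%R) by (apply pow_lt; lra).
    assert (P' := pow_lt_1_pos r (b - a) ltac:(lra) ltac:(lia)). nra. }
  intros Hr E. destruct (Nat.lt_trichotomy n m) as [L|[L|L]]; [|exact L|];
    assert (F := G _ _ Hr L); lra.
Qed.

(** Moduli separate the exponents of [q]; for equal exponents the powers of [omega] separate the
    nodes. *)
Lemma node_inj (q : C) (i j : nat) :
  (0 < Cmod q < 1)%R -> i <> j -> node q i <> node q j.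
Proof.
  intros Hq Hij E. apply Hij.
  assert (q0 : q <> 0) by (apply Cmod_gt_0; lra).
  assert (Em := f_equal Cmod E). unfold node in Em, E.
  rewrite !Cmod_mult, !Cmod_pow, Cmod_omega, !pow1, !Rmult_1_l in Em.
  apply pow_inj_lt_1 in Em; [|exact Hq].
  assert (Ed : (i / 3 = j / 3)%nat) by lia. rewrite Ed in E.
  assert (Eo : omega ^ (i mod 3) = omega ^ (j mod 3)).
  { apply (f_equal (fun z => z * / q ^ (4 + 3 * (j / 3)))) in E.
    rewrite <- !Cmult_assoc, !Cinv_r, !Cmult_1_r in E by (apply Cpow_nz, q0). exact E. }
  apply omega_pow_inj in Eo; [|apply Nat.mod_upper_bound; lia|apply Nat.mod_upper_bound; lia].
  rewrite (Nat.div_mod_eq i 3), (Nat.div_mod_eq j 3). congruence.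
Qed.

Lemma qpoch_cprod (A Q : C) (n : nat) : qpoch A Q n = cprod n (fun k => 1 - A * Q ^ k).
Proof. induction n; simpl; [reflexivity|]. rewrite IHn. reflexivity. Qed.

Lemma cprod_num_node (q z : C) (K : nat) :
  cprod (3 * K) (fun l => 1 - num_node q l * z)
  = qpoch (q ^ 6 * z) (q ^ 3) K * qpoch (q ^ 3 * z) (q ^ 3) K.
Proof.
  rewrite cprod_3, !qpoch_cprod, <- cprod_mult. apply cprod_ext. intros k _.
  rewrite num_node_0, num_node_1, num_node_2. ring.
Qed.

Lemma cprod_node (q z : C) (K : nat) :
  cprod (3 * K) (fun i => 1 - node q i * z)
  = qpoch (q ^ 4 * z) (q ^ 3) K * qpoch (omega * q ^ 4 * z) (q ^ 3) K
    * qpoch (omega ^ 2 * q ^ 4 * z) (q ^ 3) K.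
Proof.
  rewrite cprod_3, !qpoch_cprod, <- !cprod_mult. apply cprod_ext. intros k _.
  rewrite node_3_0, !node_3, Cpow_add_r, Cpow_mult_r by lia. simpl. ring.
Qed.

(** The last index 3(K - 1) + 2 is a padding one, so its factor is 1. Dropping it provides the one
    numerator factor fewer that [partial_fractions] asks for. *)
Lemma cprod_num_node_pred (q z : C) (K : nat) :
  (1 <= K)%nat ->
  cprod (3 * K - 1) (fun l => 1 - num_node q l * z) = cprod (3 * K) (fun l => 1 - num_node q l * z).
Proof.
  intros HK. replace (3 * K)%nat with (S (3 * K - 1)) at 2 by lia. cbn [cprod].
  replace (3 * K - 1)%nat with (3 * (K - 1) + 2)%nat at 3 by lia. rewrite num_node_2. ring.
Qed.

(** * Evaluation of the residues *)

Fixpoint tri (k : nat) : nat := match k with O => O | S j => (tri j + S j)%nat end.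

Lemma hexp_tri (k : nat) : hexp k = (k + 3 * tri k)%nat.
Proof.
  assert (G : (k * (k - 1) / 2 + k = tri k)%nat).
  { induction k as [|k IH]; [reflexivity|]. cbn [tri]. rewrite <- IH.
    replace (S k * (S k - 1))%nat with (k * (k - 1) + k * 2)%nat by nia.
    rewrite Nat.div_add by lia. lia. }
  unfold hexp. rewrite <- G. lia.
Qed.

(** Each factor 1 - B/Q^i, with i from 1 to k, equals (- B/Q^i) (1 - Q^i/B), and the powers Q^i
    multiply to Q^(k(k+1)/2). *)
Lemma qpoch_reverse (B Q : C) (k : nat) :
  B <> 0 -> Q <> 0 ->
  qpoch (B / Q ^ k) Q k * Q ^ tri k = (- B) ^ k * qpoch (Q / B) Q k.
Proof.
  intros HB HQ. induction k as [|k IH]; [simpl; ring|].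
  assert (Hk : Q ^ k <> 0) by (apply Cpow_nz, HQ).
  rewrite qpoch_Sl. cbn [tri]. rewrite Cpow_add_r.
  rewrite (qpoch_ext (B / Q ^ S k * Q) (B / Q ^ k)) by (rewrite Cpow_S; field; split; assumption).
  replace ((1 - B / Q ^ S k) * qpoch (B / Q ^ k) Q k * (Q ^ tri k * Q ^ S k))
    with ((Q ^ S k - B) * (qpoch (B / Q ^ k) Q k * Q ^ tri k))
    by (rewrite Cpow_S; field; split; assumption).
  rewrite IH. cbn [qpoch]. rewrite !Cpow_S. field. exact HB.
Qed.

(** Indices above [k] give (P; P)_(K-1-k). Indices below [k] give negative powers of P, and
    reversing that product yields (P; P)_k with its sign and the power of P. The entry 3 at [k] is
    what [cprod_node_punctured] leaves of the node's own orbit. *)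
Lemma cprod_punctured (P : C) (K k : nat) :
  P <> 0 -> (k < K)%nat ->
  cprod K (fun k' => if (k' =? k)%nat then RtoC 3 else 1 - P ^ k' / P ^ k) * P ^ tri k
  = 3 * ((- (1)) ^ k * qpoch P P k * qpoch P P (K - 1 - k)).
Proof.
  intros HP Hk.
  assert (Pk : P ^ k <> 0) by (apply Cpow_nz, HP).
  replace (cprod K (fun k' => if (k' =? k)%nat then RtoC 3 else 1 - P ^ k' / P ^ k))
    with (3 * (qpoch (1 / P ^ k) P k * qpoch P P (K - 1 - k))).
  - replace (3 * (qpoch (1 / P ^ k) P k * qpoch P P (K - 1 - k)) * P ^ tri k)
      with (3 * (qpoch (1 / P ^ k) P k * P ^ tri k * qpoch P P (K - 1 - k))) by ring.
    rewrite qpoch_reverse by (exact C1_nz || exact HP).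
    rewrite (qpoch_ext (P / 1) P) by (field; exact C1_nz). ring.
  - replace K with (S k + (K - 1 - k))%nat at 2 by lia. rewrite cprod_add. cbn [cprod].
    rewrite Nat.eqb_refl, !qpoch_cprod.
    rewrite (cprod_ext k (fun k' => if (k' =? k)%nat then RtoC 3 else 1 - P ^ k' / P ^ k)
               (fun k' => 1 - 1 / P ^ k * P ^ k')).
    2: { intros i Hi. rewrite (proj2 (Nat.eqb_neq i k)) by lia. field. exact Pk. }
    rewrite (cprod_ext (K - 1 - k)
      (fun i => if (S k + i =? k)%nat then RtoC 3 else 1 - P ^ (S k + i) / P ^ k)
      (fun i => 1 - P * P ^ i)).
    2: { intros i _. rewrite (proj2 (Nat.eqb_neq (S k + i) k)) by lia.
         replace (S k + i)%nat with (k + S i)%nat by lia. rewrite Cpow_add_r, Cpow_S.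
         field. exact Pk. }
    ring.
Qed.

Lemma omega_pow_3 (j : nat) : (omega ^ j) ^ 3 = 1.
Proof. rewrite <- Cpow_mult_r, Nat.mul_comm, Cpow_mult_r, omega_3. apply Cpow_1_l. Qed.

(** Over a full orbit the product of 1 - omega^j y is 1 - y^3, which turns q^3 into q^9. In the
    orbit of the omitted node the two remaining factors are 1 - omega and 1 - omega^2, with product
    3; this is the origin of the factor one third. *)
Lemma cprod_node_punctured (q : C) (K k j : nat) :
  q <> 0 -> (j < 3)%nat ->
  cprod (3 * K) (fun i => if (i =? 3 * k + j)%nat then RtoC 1
                          else 1 - node q i / node q (3 * k + j))
  = cprod K (fun k' => if (k' =? k)%nat then RtoC 3
                       else 1 - (q ^ 9) ^ k' / (q ^ 9) ^ k).
Proof.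
  intros q0 Hj. rewrite cprod_3. apply cprod_ext. intros k' _.
  assert (Hq : forall m, q ^ m <> 0) by (intros; apply Cpow_nz, q0).
  rewrite node_3_0, !node_3 by lia.
  destruct (Nat.eqb_spec k' k) as [->|Hkk].
  - assert (E3 : (1 - omega) * (1 - omega ^ 2) = 3).
    { replace ((1 - omega) * (1 - omega ^ 2))
        with (2 + omega ^ 3 - (1 + omega + omega ^ 2)) by ring.
      rewrite omega_sum, omega_3. ring. }
    assert (Hn := Hq (4 + 3 * k)%nat). set (X := q ^ (4 + 3 * k)) in *.
    assert (o0 := omega_neq_0).
    assert (Ei : / omega = omega ^ 2).
    { replace (omega ^ 2) with (omega ^ 3 * / omega) by (field; exact o0).
      rewrite omega_3. ring. }
    assert (Ei2 : / (omega ^ 2) = omega).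
    { replace omega with (omega ^ 3 * / (omega ^ 2)) at 2 by (field; exact o0).
      rewrite omega_3. ring. }
    destruct j as [|[|[|j]]]; [| | |lia];
      rewrite ?Nat.add_0_r, ?Nat.eqb_refl;
      repeat (rewrite (proj2 (Nat.eqb_neq _ _)) by lia).
    + rewrite <- E3. simpl. field. exact Hn.
    + replace (omega ^ 0 * X / (omega ^ 1 * X)) with (/ omega) by (simpl; field; split; assumption).
      replace (omega ^ 2 * X / (omega ^ 1 * X)) with omega by (simpl; field; split; assumption).
      rewrite Ei, <- E3. ring.
    + replace (omega ^ 0 * X / (omega ^ 2 * X)) with (/ omega ^ 2) by (simpl; field; split; assumption).
      replace (omega ^ 1 * X / (omega ^ 2 * X)) with (/ omega) by (simpl; field; split; assumption).
      rewrite Ei, Ei2, <- E3. ring.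
  - rewrite !(proj2 (Nat.eqb_neq _ _)) by lia.
    assert (Ho : omega ^ j <> 0) by (apply Cpow_nz, omega_neq_0).
    assert (Hn := Hq (4 + 3 * k)%nat).
    set (y := q ^ (4 + 3 * k') / (omega ^ j * q ^ (4 + 3 * k))).
    replace (omega ^ 0 * q ^ (4 + 3 * k') / (omega ^ j * q ^ (4 + 3 * k))) with y
      by (unfold y; field; split; assumption).
    replace (omega ^ 1 * q ^ (4 + 3 * k') / (omega ^ j * q ^ (4 + 3 * k))) with (omega * y)
      by (unfold y; field; split; assumption).
    replace (omega ^ 2 * q ^ (4 + 3 * k') / (omega ^ j * q ^ (4 + 3 * k))) with (omega ^ 2 * y)
      by (unfold y; field; split; assumption).
    rewrite one_minus_omega_prod. f_equal. f_equal. unfold y.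
    replace ((q ^ (4 + 3 * k') / (omega ^ j * q ^ (4 + 3 * k))) ^ 3)
      with ((q ^ (4 + 3 * k')) ^ 3 / ((omega ^ j) ^ 3 * (q ^ (4 + 3 * k)) ^ 3))
      by (field; split; assumption).
    rewrite omega_pow_3, <- !Cpow_mult_r.
    replace ((4 + 3 * k') * 3)%nat with (12 + 9 * k')%nat by lia.
    replace ((4 + 3 * k) * 3)%nat with (12 + 9 * k)%nat by lia.
    rewrite (Cpow_add_r q 12 (9 * k')), (Cpow_add_r q 12 (9 * k)).
    field. split; (exact q0 || apply Hq).
Qed.

Lemma finite_integrand_partial_fractions (q z : C) (K : nat) :
  (0 < Cmod q < 1)%R -> (1 <= K)%nat ->
  (forall i, 1 - node q i * z <> 0) ->
  qpoch (q ^ 6 * z) (q ^ 3) K * qpoch (q ^ 3 * z) (q ^ 3) K /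
  (qpoch (q ^ 4 * z) (q ^ 3) K * qpoch (omega * q ^ 4 * z) (q ^ 3) K
   * qpoch (omega ^ 2 * q ^ 4 * z) (q ^ 3) K)
  = csum (3 * K) (fun i => pf_coef (num_node q) (node q) (3 * K - 1) i / (1 - node q i * z)).
Proof.
  intros Hq HK Hz. assert (q0 : q <> 0) by (apply Cmod_gt_0; lra).
  rewrite <- cprod_num_node, <- cprod_node, <- cprod_num_node_pred by exact HK.
  replace (3 * K)%nat with (S (3 * K - 1)) at 2 3 by lia.
  apply partial_fractions.
  - intros i _. apply node_neq_0, q0.
  - intros i j _ _ Hij. apply node_inj; assumption.
  - intros i _. apply Hz.
Qed.

(** In terms of s = omega^j q the index [j] disappears: powers of q with exponent divisible by 3
    agree with those of s, and the node is s^(4+3k). It remains to reverse the factors with negative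
    powers of s. The reversed (1/s)-product becomes (s^4; s^3)_k, which joins (s^4 s^(3k); s^3)_K to
    form (s^4; s^3)_(K+k). *)
Lemma residue_eq (q : C) (K k j : nat) :
  (0 < Cmod q < 1)%R -> (k < K)%nat -> (j < 3)%nat ->
  pf_coef (num_node q) (node q) (3 * K - 1) (3 * k + j)
    * qpoch (node q (3 * k + j)) (q ^ 3) K
  = / 3 * ((1 - / (omega ^ j * q)) * approx_term K k (omega ^ j * q)).
Proof.
  intros Hq Hk Hj. assert (q0 : q <> 0) by (apply Cmod_gt_0; lra).
  assert (Ho : omega ^ j <> 0) by (apply Cpow_nz, omega_neq_0).
  unfold pf_coef.
  rewrite (cprod_ext (3 * K - 1) (fun l => 1 - num_node q l / node q (3 * k + j))
    (fun l => 1 - num_node q l * / node q (3 * k + j))) by reflexivity.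
  rewrite cprod_num_node_pred, cprod_num_node by lia.
  replace (S (3 * K - 1)) with (3 * K)%nat by lia.
  rewrite cprod_node_punctured, node_3 by assumption.
  assert (Ho3 := omega_pow_3 j).
  set (s := omega ^ j * q).
  assert (s0 : s <> 0) by (apply Cmult_neq_0; assumption).
  assert (Hs1 : (Cmod s < 1)%R).
  { unfold s. rewrite Cmod_mult, Cmod_pow, Cmod_omega, pow1. lra. }
  assert (E3 : q ^ 3 = s ^ 3).
  { unfold s. rewrite Cpow_mult_l, Ho3. ring. }
  assert (E6 : q ^ 6 = s ^ 6).
  { replace (q ^ 6) with ((q ^ 3) ^ 2) by ring. rewrite E3. ring. }
  assert (E9 : q ^ 9 = s ^ 9).
  { replace (q ^ 9) with ((q ^ 3) ^ 3) by ring. rewrite E3. ring. }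
  (* Since 4 = 3 + 1, exactly one factor omega^j is needed to turn q^4 into s^4. *)
  assert (E4 : omega ^ j * q ^ (4 + 3 * k) = s ^ 4 * (s ^ 3) ^ k).
  { rewrite Cpow_add_r, Cpow_mult_r, E3.
    replace (q ^ 4) with (q ^ 3 * q) by ring. rewrite E3. unfold s at 3. unfold s. ring. }
  rewrite E4, E3, E6, E9.
  set (Q := s ^ 3). assert (Q0 : Q <> 0) by (apply Cpow_nz, s0).
  set (P := s ^ 9). assert (P0 : P <> 0) by (apply Cpow_nz, s0).
  assert (Qk : Q ^ k <> 0) by (apply Cpow_nz, Q0).
  assert (Qt : Q ^ tri k <> 0) by (apply Cpow_nz, Q0).
  assert (Pt : P ^ tri k <> 0) by (apply Cpow_nz, P0).
  assert (D1 : qpoch P P k <> 0) by (unfold P; apply qpoch_pow_neq_0; [exact Hs1 | lia]).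
  assert (D2 : qpoch P P (K - 1 - k) <> 0) by (unfold P; apply qpoch_pow_neq_0; [exact Hs1 | lia]).
  assert (R1 := qpoch_reverse (s ^ 2) Q k ltac:(apply Cpow_nz, s0) Q0).
  assert (R2 := qpoch_reverse (/ s) Q k ltac:(apply Cinv_neq_0, s0) Q0).
  rewrite (qpoch_ext (Q / s ^ 2) (s ^ 1)) in R1 by (unfold Q; field; exact s0).
  rewrite (qpoch_ext (Q / / s) (s ^ 4)) in R2 by (unfold Q; field; exact s0).
  assert (R3 := cprod_punctured P K k P0 Hk).
  set (D := cprod K _) in *.
  rewrite (qpoch_ext (s ^ 6 * / (s ^ 4 * Q ^ k)) (s ^ 2 / Q ^ k)) by (field; split; assumption).
  rewrite (qpoch_ext (Q * / (s ^ 4 * Q ^ k)) (/ s / Q ^ k))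
    by (unfold Q at 1; field; split; assumption).
  (* Both numerator products are cut after k factors: the first part carries the negative powers of
     Q and is reversed, the second starts at s^2 or at 1/s. *)
  replace K with (k + (K - k))%nat at 1 2 by lia.
  rewrite !qpoch_add.
  rewrite (qpoch_ext (s ^ 2 / Q ^ k * Q ^ k) (s ^ 2)) by (field; exact Qk).
  rewrite (qpoch_ext (/ s / Q ^ k * Q ^ k) (/ s)) by (field; split; assumption).
  assert (Hm : qpoch (/ s) Q (K - k) = (1 - / s) * qpoch (s ^ 2) Q (K - 1 - k)).
  { replace (K - k)%nat with (S (K - 1 - k)) by lia. rewrite qpoch_Sl.
    rewrite (qpoch_ext (/ s * Q) (s ^ 2)) by (unfold Q; field; exact s0). reflexivity. }
  rewrite Hm.
  unfold approx_term. fold Q. fold P.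
  replace (K + k)%nat with (k + K)%nat by lia. rewrite (qpoch_add (s ^ 4) Q k K).
  rewrite hexp_tri, (Cpow_add_r s k (3 * tri k)), (Cpow_mult_r s 3 (tri k)). fold Q.
  (* Balance of powers: the two reversals in the numerator give Q^(-2 tri k), the one in the
     denominator P^(-tri k) = Q^(-3 tri k). The quotient s^k Q^(tri k) is s^(hexp k). *)
  assert (Es : (- s ^ 2) ^ k * (- / s) ^ k = s ^ k).
  { rewrite <- Cpow_mult_l. f_equal. field. exact s0. }
  assert (EP : P ^ tri k = Q ^ tri k * Q ^ tri k * Q ^ tri k).
  { replace P with (Q * Q * Q) by (unfold P, Q; ring). rewrite !Cpow_mult_l. reflexivity. }
  assert (Em : (- (1)) ^ k * (- (1)) ^ k = 1).
  { rewrite <- Cpow_mult_l. replace (- (1) * - (1)) with (RtoC 1) by ring. apply Cpow_1_l. }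
  assert (m0 : (- (1)) ^ k <> 0).
  { intros E. apply C1_nz. rewrite <- Em, E. ring. }
  assert (H3 : RtoC 3 <> 0) by (intros E; apply (f_equal fst) in E; simpl in E; lra).
  assert (D0 : D <> 0).
  { intros E. rewrite E in R3. assert (F : 3 * ((- (1)) ^ k * qpoch P P k * qpoch P P (K - 1 - k)) <> 0)
      by (repeat apply Cmult_neq_0; assumption).
    apply F. rewrite <- R3. ring. }
  assert (ED : D = 3 * ((- (1)) ^ k * qpoch P P k * qpoch P P (K - 1 - k)) / P ^ tri k).
  { rewrite <- R3. field. exact Pt. }
  assert (EA : qpoch (s ^ 2 / Q ^ k) Q k = (- s ^ 2) ^ k * qpoch (s ^ 1) Q k / Q ^ tri k).
  { rewrite <- R1. field. exact Qt. }
  assert (EB : qpoch (/ s / Q ^ k) Q k = (- / s) ^ k * qpoch (s ^ 4) Q k / Q ^ tri k).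
  { rewrite <- R2. field. exact Qt. }
  rewrite ED, EA, EB.
  set (a1 := (- s ^ 2) ^ k) in *. set (a2 := (- / s) ^ k) in *. set (m := (- (1)) ^ k) in *.
  set (t := Q ^ tri k) in *. rewrite <- Es, EP. clearbody a1 a2 m t.
  (* The sign comes from the denominator, where it is its own inverse. *)
  replace m with (/ m) at 2.
  2: { replace (/ m) with (m * m * / m) by (rewrite Em; ring). field. exact m0. }
  generalize (qpoch (s ^ 2) Q (K - k)) (qpoch (s ^ 2) Q (K - 1 - k)) (qpoch (s ^ 1) Q k)
    (qpoch (s ^ 4) Q k) (qpoch (s ^ 4 * Q ^ k) Q K). intros v1 v2 v3 v4 v5.
  field. repeat split; assumption.
Qed.

Definition huffed_approx (K : nat) (s : C) : C := (1 - / s) * approx_sum K s.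

Lemma residue_sum_eq (q : C) (K : nat) :
  (0 < Cmod q < 1)%R ->
  csum (3 * K) (fun i => pf_coef (num_node q) (node q) (3 * K - 1) i
                         * qpoch (node q i) (q ^ 3) K)
  = / 3 * (huffed_approx K q + huffed_approx K (omega * q) + huffed_approx K (omega ^ 2 * q)).
Proof.
  intros Hq. rewrite csum_3.
  rewrite (csum_ext K _ (fun k =>
    / 3 * ((1 - / q) * approx_term K k q)
    + / 3 * ((1 - / (omega * q)) * approx_term K k (omega * q))
    + / 3 * ((1 - / (omega ^ 2 * q)) * approx_term K k (omega ^ 2 * q)))).
  - rewrite !csum_plus, !csum_scal. unfold huffed_approx, approx_sum. ring.
  - intros k Hk.
    assert (H0 := residue_eq q K k 0 Hq Hk ltac:(lia)).
    rewrite Nat.add_0_r in H0. replace (omega ^ 0 * q) with q in H0 by (simpl; ring).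
    assert (H1 := residue_eq q K k 1 Hq Hk ltac:(lia)). rewrite Cpow_1_r in H1.
    rewrite H0, H1, (residue_eq q K k 2 Hq Hk) by lia. reflexivity.
Qed.

(** * Contour integrals *)

Local Notation Ccontinuous := (continuous (U := C_UniformSpace)).
Local Notation Cis_derive := (is_derive (K := R_AbsRing) (V := C_R_NormedModule)).
Local Notation Cis_RInt := (is_RInt (V := C_R_NormedModule)).

Lemma Ccontinuous_parts {T : UniformSpace} (f : T -> C) (t : T) :
  Ccontinuous f t <->
  continuous (fun s => Re (f s)) t /\ continuous (fun s => Im (f s)) t.
Proof.
  split.
  - intros H. split.
    + apply (continuous_comp (V := C_UniformSpace) f fst); [exact H|].
      destruct (f t). apply continuous_fst.
    + apply (continuous_comp (V := C_UniformSpace) f snd); [exact H|].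
      destruct (f t). apply continuous_snd.
  - intros [H1 H2].
    apply (continuous_ext (fun s => (Re (f s), Im (f s)))).
    { intros s. symmetry. apply surjective_pairing. }
    apply (continuous_comp_2 (U := T) (X := C_UniformSpace)
             (fun s => Re (f s)) (fun s => Im (f s)) pair t H1 H2).
    apply (continuous_ext (fun x => x)); [|apply continuous_id].
    intros x. apply surjective_pairing.
Qed.

Lemma Ccontinuous_const {T : UniformSpace} (c : C) (t : T) : Ccontinuous (fun _ => c) t.
Proof. apply continuous_const. Qed.

Lemma Ccontinuous_mult {T : UniformSpace} (f g : T -> C) (t : T) :
  Ccontinuous f t -> Ccontinuous g t -> Ccontinuous (fun s => f s * g s) t.
Proof.
  rewrite !Ccontinuous_parts. intros [F1 F2] [G1 G2]. split.
  - apply (continuous_minus (V := R_NormedModule) (fun s => Re (f s) * Re (g s))%R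
             (fun s => Im (f s) * Im (g s))%R);
      apply (continuous_mult (K := R_AbsRing)); assumption.
  - apply (continuous_plus (V := R_NormedModule) (fun s => Re (f s) * Im (g s))%R
             (fun s => Im (f s) * Re (g s))%R);
      apply (continuous_mult (K := R_AbsRing)); assumption.
Qed.

Lemma Re2_Im2_neq_0 (z : C) : z <> 0 -> (Re z ^ 2 + Im z ^ 2 <> 0)%R.
Proof.
  intros Hz E. apply Hz. destruct z as [x y]. unfold Re, Im in E. simpl in E.
  apply injective_projections; simpl; nra.
Qed.

Lemma Ccontinuous_inv {T : UniformSpace} (f : T -> C) (t : T) :
  Ccontinuous f t -> f t <> 0 -> Ccontinuous (fun s => / f s) t.
Proof.
  rewrite !Ccontinuous_parts. intros [F1 F2] H0.
  assert (D : continuous (fun s => / (Re (f s) ^ 2 + Im (f s) ^ 2))%R t).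
  { apply (continuous_comp (fun s => Re (f s) ^ 2 + Im (f s) ^ 2)%R Rinv);
      [|apply continuous_Rinv, Re2_Im2_neq_0, H0].
    apply (continuous_ext (fun s => Re (f s) * Re (f s) + Im (f s) * Im (f s))%R).
    { intros s. simpl. ring. }
    apply (continuous_plus (V := R_NormedModule));
      apply (continuous_mult (K := R_AbsRing)); assumption. }
  split.
  - apply (continuous_mult (K := R_AbsRing)); assumption.
  - apply (continuous_mult (K := R_AbsRing) (fun s => - Im (f s))%R); [|assumption].
    apply (continuous_opp (V := R_NormedModule)). assumption.
Qed.

Lemma Ccontinuous_pow {T : UniformSpace} (f : T -> C) (m : nat) (t : T) :
  Ccontinuous f t -> Ccontinuous (fun s => f s ^ m) t.
Proof.
  intros H. induction m; [apply continuous_const|]. apply Ccontinuous_mult; assumption.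
Qed.

Lemma Ccontinuous_Cmod {T : UniformSpace} (f : T -> C) (t : T) :
  Ccontinuous f t -> continuous (fun s => Cmod (f s)) t.
Proof.
  intros H. apply (continuous_comp (V := C_UniformSpace) f Cmod); [exact H|].
  apply (filterlim_norm (V := C_NormedModule)).
Qed.

Lemma Ccontinuous_bounded (f : R -> C) (a b : R) :
  (a <= b)%R -> (forall t, (a <= t <= b)%R -> Ccontinuous f t) ->
  exists B, (0 < B)%R /\ forall t, (a <= t <= b)%R -> (Cmod (f t) <= B)%R.
Proof.
  intros Hab H.
  destruct (continuity_ab_maj (fun t => Cmod (f t)) a b Hab) as (m & Hm & _).
  { intros c Hc. apply continuity_pt_filterlim, Ccontinuous_Cmod, H, Hc. }
  exists (Cmod (f m) + 1)%R. split; [assert (G := Cmod_ge_0 (f m)); lra|].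
  intros t Ht. specialize (Hm t Ht). lra.
Qed.

Lemma Ccontinuous_bounded_below (f : R -> C) (a b : R) :
  (a <= b)%R -> (forall t, (a <= t <= b)%R -> Ccontinuous f t) ->
  (forall t, (a <= t <= b)%R -> f t <> 0) ->
  exists B, (0 < B)%R /\ forall t, (a <= t <= b)%R -> (B <= Cmod (f t))%R.
Proof.
  intros Hab H H0.
  destruct (continuity_ab_min (fun t => Cmod (f t)) a b Hab) as (m & Hm & Hm').
  { intros c Hc. apply continuity_pt_filterlim, Ccontinuous_Cmod, H, Hc. }
  exists (Cmod (f m)). split; [apply Cmod_gt_0, H0, Hm' | exact Hm].
Qed.

Lemma Cis_derive_parts (f : R -> C) (t : R) (d : C) :
  Cis_derive f t d <->
  is_derive (fun s => Re (f s)) t (Re d) /\ is_derive (fun s => Im (f s)) t (Im d).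
Proof.
  split.
  - intros H. split.
    + assert (G := filterdiff_comp' (K := R_AbsRing) (U := R_NormedModule)
        (V := C_R_NormedModule) (W := R_NormedModule) f fst t _ fst H
        (filterdiff_linear fst is_linear_fst)).
      exact G.
    + assert (G := filterdiff_comp' (K := R_AbsRing) (U := R_NormedModule)
        (V := C_R_NormedModule) (W := R_NormedModule) f snd t _ snd H
        (filterdiff_linear snd is_linear_snd)).
      exact G.
  - intros [H1 H2].
    assert (G := is_derive_plus (K := R_AbsRing) (V := C_R_NormedModule) _ _ t _ _
      (is_derive_scal_l (K := R_AbsRing) (V := C_R_NormedModule) _ t _ (1, 0)%R H1)
      (is_derive_scal_l (K := R_AbsRing) (V := C_R_NormedModule) _ t _ (0, 1)%R H2)).
    assert (E : forall x y : R, @plus C_R_NormedModule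
      (@scal R_AbsRing C_R_NormedModule x (1, 0)%R)
      (@scal R_AbsRing C_R_NormedModule y (0, 1)%R) = (x, y)).
    { intros x y. apply injective_projections; cbn;
        unfold plus, mult; simpl; ring. }
    rewrite E in G.
    replace d with (Re d, Im d) by (symmetry; apply surjective_pairing).
    revert G. apply is_derive_ext. intros s. rewrite E. symmetry. apply surjective_pairing.
Qed.

Lemma Cis_derive_mult (f g : R -> C) (t : R) (df dg : C) :
  Cis_derive f t df -> Cis_derive g t dg ->
  Cis_derive (fun s => f s * g s) t (df * g t + f t * dg).
Proof.
  rewrite !Cis_derive_parts. intros [F1 F2] [G1 G2].
  assert (M : forall u v (du dv : R), is_derive u t du -> is_derive v t dv ->
    is_derive (fun s => u s * v s)%R t (du * v t + u t * dv)%R).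
  { intros u v du dv Hu Hv. apply (is_derive_mult (K := R_AbsRing) u v t du dv Hu Hv).
    intros; apply Rmult_comm. }
  split.
  - replace (Re (df * g t + f t * dg)) with
      ((Re df * Re (g t) + Re (f t) * Re dg) - (Im df * Im (g t) + Im (f t) * Im dg))%R
      by (simpl; unfold Re, Im; ring).
    apply (is_derive_minus (V := R_NormedModule) (fun s => Re (f s) * Re (g s))%R
             (fun s => Im (f s) * Im (g s))%R); apply M; assumption.
  - replace (Im (df * g t + f t * dg)) with
      ((Re df * Im (g t) + Re (f t) * Im dg) + (Im df * Re (g t) + Im (f t) * Re dg))%R
      by (simpl; unfold Re, Im; ring).
    apply (is_derive_plus (V := R_NormedModule) (fun s => Re (f s) * Im (g s))%R
             (fun s => Im (f s) * Re (g s))%R); apply M; assumption.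
Qed.

Lemma Cis_derive_inv (f : R -> C) (t : R) (df : C) :
  f t <> 0 -> Cis_derive f t df -> Cis_derive (fun s => / f s) t (- (df * (/ f t) ^ 2)).
Proof.
  intros H0. rewrite !Cis_derive_parts. intros [F1 F2].
  assert (N0 := Re2_Im2_neq_0 _ H0).
  set (D := fun s => (Re (f s) ^ 2 + Im (f s) ^ 2)%R).
  assert (HD : is_derive D t (2 * Re (f t) * Re df + 2 * Im (f t) * Im df)%R).
  { unfold D. evar_last.
    - apply (is_derive_plus (V := R_NormedModule) (fun s => Re (f s) ^ 2)%R (fun s => Im (f s) ^ 2)%R);
        apply is_derive_pow; eassumption.
    - unfold plus; simpl. ring. }
  destruct (f t) as [x y] eqn:Ef. destruct df as [dx dy].
  unfold Re, Im in *. simpl fst in *. simpl snd in *.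
  split.
  - evar_last.
    + apply (is_derive_div (fun s => fst (f s)) D); [exact F1 | exact HD|].
      unfold D, Re, Im. rewrite Ef. exact N0.
    + unfold D, Re, Im. rewrite Ef. simpl. field. simpl in N0. lra.
  - evar_last.
    + apply (is_derive_div (fun s => - snd (f s))%R D);
        [apply (is_derive_opp (V := R_NormedModule)), F2 | exact HD|].
      unfold D, Re, Im. rewrite Ef. exact N0.
    + unfold D, Re, Im, opp. rewrite Ef. simpl. field. simpl in N0. lra.
Qed.

Lemma Cis_derive_inv_pow (f : R -> C) (t : R) (df : C) (m : nat) :
  f t <> 0 -> Cis_derive f t df ->
  Cis_derive (fun s => (/ f s) ^ m) t (- (INR m * (/ f t) ^ S m * df)).
Proof.
  intros H0 H. induction m.
  - simpl INR. replace (- (0 * (/ f t) ^ 1 * df)) with (RtoC 0) by ring.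
    apply (is_derive_const (V := C_R_NormedModule) (RtoC 1)).
  - assert (G := Cis_derive_mult _ _ _ _ _ (Cis_derive_inv f t df H0 H) IHm).
    rewrite S_INR, RtoC_plus.
    replace (- ((INR m + 1) * (/ f t) ^ S (S m) * df))
      with (- (df * (/ f t) ^ 2) * (/ f t) ^ m + / f t * - (INR m * (/ f t) ^ S m * df)).
    + exact G.
    + rewrite !Cpow_S. simpl. ring.
Qed.

(** A fundamental theorem of calculus for a derivative known only inside the interval, as between
    break points of a contour. The mean value theorem makes the difference of [v] and the integral
    of [phi] constant, and continuity includes the end points. *)
Lemma is_RInt_derive_open (v phi : R -> R) (a b : R) :
  (a <= b)%R -> (forall t, continuous v t) -> (forall t, continuous phi t) ->
  (forall t, (a < t < b)%R -> is_derive v t (phi t)) ->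
  is_RInt phi a b (v b - v a)%R.
Proof.
  intros Hab Hv Hphi Hd.
  set (Phi := fun x => RInt (V := R_CompleteNormedModule) phi a x).
  assert (Hi : forall x, is_RInt phi a x (Phi x)).
  { intros x. apply (RInt_correct (V := R_CompleteNormedModule)).
    apply (ex_RInt_continuous (V := R_CompleteNormedModule)). intros; apply Hphi. }
  assert (HPhi : forall x, is_derive Phi x (phi x)).
  { intros x. apply (is_derive_RInt (V := R_NormedModule) phi Phi a x); [|apply Hphi].
    apply filter_forall. intros; apply Hi. }
  destruct (MVT_gen (fun x => v x - Phi x)%R a b (fun _ => 0)%R) as (c & _ & Hc).
  - intros x Hx. rewrite Rmin_left, Rmax_right in Hx by exact Hab.
    evar_last; [apply (is_derive_minus (V := R_NormedModule)); [apply Hd, Hx | apply HPhi]|].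
    unfold minus, plus, opp; simpl. ring.
  - intros x _. apply continuity_pt_filterlim.
    apply (continuous_minus (V := R_NormedModule)); [apply Hv|].
    apply (ex_derive_continuous (V := R_NormedModule)). exists (phi x). apply HPhi.
  - assert (E : Phi a = 0%R) by exact (RInt_point (V := R_CompleteNormedModule) a phi).
    replace (v b - v a)%R with (Phi b) by lra. apply Hi.
Qed.

Lemma Cis_RInt_derive_open (v phi : R -> C) (a b : R) :
  (a <= b)%R -> (forall t, Ccontinuous v t) -> (forall t, Ccontinuous phi t) ->
  (forall t, (a < t < b)%R -> Cis_derive v t (phi t)) ->
  Cis_RInt phi a b (v b - v a).
Proof.
  intros Hab Hv Hphi Hd.
  apply (is_RInt_fct_extend_pair (U := R_NormedModule) (V := R_NormedModule) phi).
  - apply (is_RInt_derive_open (fun s => Re (v s)) (fun s => Re (phi s))); try exact Hab.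
    + intros t. apply Ccontinuous_parts, Hv.
    + intros t. apply Ccontinuous_parts, Hphi.
    + intros t Ht. apply Cis_derive_parts, Hd, Ht.
  - apply (is_RInt_derive_open (fun s => Im (v s)) (fun s => Im (phi s))); try exact Hab.
    + intros t. apply Ccontinuous_parts, Hv.
    + intros t. apply Ccontinuous_parts, Hphi.
    + intros t Ht. apply Cis_derive_parts, Hd, Ht.
Qed.

Lemma Cis_RInt_scal (c : C) (f : R -> C) (a b : R) (l : C) :
  Cis_RInt f a b l -> Cis_RInt (fun t => c * f t) a b (c * l).
Proof.
  intros H.
  assert (H1 := is_RInt_fct_extend_fst (U := R_NormedModule) (V := R_NormedModule) f a b l H).
  assert (H2 := is_RInt_fct_extend_snd (U := R_NormedModule) (V := R_NormedModule) f a b l H).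
  apply (is_RInt_fct_extend_pair (U := R_NormedModule) (V := R_NormedModule) (fun t => c * f t)).
  - exact (is_RInt_minus (V := R_NormedModule) _ _ a b _ _
      (is_RInt_scal _ a b (fst c) _ H1) (is_RInt_scal _ a b (snd c) _ H2)).
  - exact (is_RInt_plus (V := R_NormedModule) _ _ a b _ _
      (is_RInt_scal _ a b (fst c) _ H2) (is_RInt_scal _ a b (snd c) _ H1)).
Qed.

Lemma contour_integral_ext (g : R -> C) (f h : C -> C) (l : C) :
  (forall t, (0 <= t <= 1)%R -> f (g t) = h (g t)) ->
  is_contour_integral g f l -> is_contour_integral g h l.
Proof.
  intros E. apply is_RInt_ext. intros t Ht.
  rewrite Rmin_left, Rmax_right in Ht by lra. rewrite E by lra. reflexivity.
Qed.

Lemma contour_integral_plus (g : R -> C) (f h : C -> C) (l m : C) :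
  is_contour_integral g f l -> is_contour_integral g h m ->
  is_contour_integral g (fun z => f z + h z) (l + m).
Proof.
  intros Hf Hh.
  apply (is_RInt_ext (V := C_R_NormedModule)
    (fun t => @plus C_R_NormedModule (f (g t) * path_derive g t) (h (g t) * path_derive g t))).
  - intros t _. change (f (g t) * path_derive g t + h (g t) * path_derive g t
                        = (f (g t) + h (g t)) * path_derive g t). ring.
  - exact (is_RInt_plus (V := C_R_NormedModule) _ _ _ _ _ _ Hf Hh).
Qed.

Lemma contour_integral_scal (g : R -> C) (c : C) (f : C -> C) (l : C) :
  is_contour_integral g f l -> is_contour_integral g (fun z => c * f z) (c * l).
Proof.
  intros H. apply (is_RInt_ext (V := C_R_NormedModule) (fun t => c * (f (g t) * path_derive g t))).
  - intros t _. apply Cmult_assoc.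
  - apply Cis_RInt_scal, H.
Qed.

Lemma contour_integral_eq (g : R -> C) (f : C -> C) (l m : C) :
  l = m -> is_contour_integral g f l -> is_contour_integral g f m.
Proof. intros ->. exact (fun H => H). Qed.

Lemma contour_integral_zero (g : R -> C) : is_contour_integral g (fun _ => 0) 0.
Proof.
  apply (is_RInt_ext (V := C_R_NormedModule) (fun _ => RtoC 0)).
  - intros t _. symmetry. apply Cmult_0_l.
  - assert (H := is_RInt_const (V := C_R_NormedModule) 0 1 (RtoC 0)).
    assert (E : @scal R_AbsRing C_R_NormedModule (1 - 0)%R (RtoC 0) = RtoC 0)
      by (apply injective_projections; apply Rmult_0_r).
    exact (eq_ind _ (fun l => Cis_RInt (fun _ => RtoC 0) 0 1 l) H _ E).
Qed.

Lemma contour_integral_csum (g : R -> C) (n : nat) (f : nat -> C -> C) (l : nat -> C) :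
  (forall i, is_contour_integral g (f i) (l i)) ->
  is_contour_integral g (fun z => csum n (fun i => f i z)) (csum n l).
Proof.
  intros H. induction n; [apply contour_integral_zero|].
  apply contour_integral_plus; [exact IHn | apply H].
Qed.

Lemma path_derive_eq (g : R -> C) (t : R) (d : C) : Cis_derive g t d -> path_derive g t = d.
Proof.
  intros H. apply Cis_derive_parts in H. destruct H as [H1 H2].
  apply injective_projections; apply is_derive_unique; assumption.
Qed.

Lemma path_derive_bounded (g : R -> C) :
  piecewise_C1 g ->
  exists B, (0 < B)%R /\ forall t, (0 <= t <= 1)%R -> (Cmod (path_derive g t) <= B)%R.
Proof.
  intros (_ & n & t & H0 & H1 & H).
  assert (G : forall m, (m <= n)%nat -> exists B, (0 < B)%R /\
    forall s, (0 <= s <= t m)%R -> (Cmod (path_derive g s) <= B)%R).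
  { induction m as [|m IH]; intros Hm.
    - exists (Cmod (path_derive g 0) + 1)%R.
      split; [assert (P := Cmod_ge_0 (path_derive g 0)); lra|].
      intros s Hs. rewrite H0 in Hs. replace s with 0%R by lra. lra.
    - destruct IH as (B & B0 & HB); [lia|].
      destruct (H m ltac:(lia)) as (Hlt & d & Hd & Hder).
      destruct (Ccontinuous_bounded d (t m) (t (S m))) as (B' & B'0 & HB'); [lra | intros; apply Hd|].
      (* At a break point [path_derive] is unrelated to the one-sided derivatives, so its value
         there enters the bound separately. *)
      set (E := Cmod (path_derive g (t (S m)))).
      assert (E0 : (0 <= E)%R) by apply Cmod_ge_0.
      exists (B + B' + E)%R. split; [lra|]. intros s Hs.
      destruct (Rle_lt_dec s (t m)) as [L|L].
      + assert (F := HB s ltac:(lra)). lra.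
      + destruct (Rle_lt_or_eq_dec s (t (S m))) as [L'|L']; [lra| |].
        * rewrite (path_derive_eq g s (d s)) by (apply Hder; lra).
          assert (F := HB' s ltac:(lra)). lra.
        * rewrite L'. unfold E. lra. }
  destruct (G n (le_n n)) as (B & B0 & HB). rewrite H1 in HB. exists B. split; assumption.
Qed.

(** The retraction of the line onto [0, 1]. The hypotheses control [g] on [0, 1] only; composing
    with it gives functions that are continuous, or converge uniformly, on the whole line. *)
Definition clamp (t : R) : R := Rmax 0 (Rmin 1 t).

Lemma clamp_range (t : R) : (0 <= clamp t <= 1)%R.
Proof.
  unfold clamp. split; [apply Rmax_l|]. apply Rmax_lub; [lra | apply Rmin_l].
Qed.

Lemma clamp_id (t : R) : (0 <= t <= 1)%R -> clamp t = t.
Proof. intros H. unfold clamp. rewrite Rmin_right, Rmax_right by lra. reflexivity. Qed.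

Lemma clamp_lipschitz (s t : R) : (Rabs (clamp s - clamp t) <= Rabs (s - t))%R.
Proof.
  unfold clamp, Rmax, Rmin.
  repeat destruct (Rle_dec _ _); unfold Rabs; repeat destruct (Rcase_abs _); lra.
Qed.

Lemma continuous_clamp (g : R -> C) (t : R) :
  continuous_on (T := R_UniformSpace) (U := C_UniformSpace)
    (fun t : R => (0 <= t <= 1)%R) g ->
  Ccontinuous (fun s => g (clamp s)) t.
Proof.
  intros H.
  apply (filterlim_comp _ _ _ clamp g (locally t)
    (within (fun t : R => (0 <= t <= 1)%R) (locally (T := R_UniformSpace) (clamp t)))).
  - intros P [eps HP]. exists eps. intros s Hs. apply HP; [|apply clamp_range].
    change (Rabs (clamp s - clamp t) < eps)%R.
    eapply Rle_lt_trans; [apply clamp_lipschitz | exact Hs].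
  - apply H, clamp_range.
Qed.

Lemma clamp_locally (g : R -> C) (t : R) :
  (0 < t < 1)%R -> locally t (fun s => g s = g (clamp s)).
Proof.
  intros Ht. assert (P : (0 < Rmin t (1 - t))%R) by (apply Rmin_pos; lra).
  exists (mkposreal _ P). intros s Hs.
  change (Rabs (s - t) < Rmin t (1 - t))%R in Hs.
  assert (L1 := Rmin_l t (1 - t)). assert (L2 := Rmin_r t (1 - t)).
  rewrite clamp_id; [reflexivity|].
  unfold Rabs in Hs. destruct (Rcase_abs (s - t)); lra.
Qed.

Lemma breakpoints_range (n : nat) (t : nat -> R) :
  t 0%nat = 0%R -> t n = 1%R -> (forall i, (i < n)%nat -> (t i < t (S i))%R) ->
  forall i, (i <= n)%nat -> (0 <= t i <= 1)%R.
Proof.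
  intros H0 H1 H i Hi. split.
  - induction i; [lra|]. specialize (IHi ltac:(lia)). assert (G := H i ltac:(lia)). lra.
  - rewrite <- H1. replace i with (n - (n - i))%nat by lia.
    assert (G : forall k, (k <= n)%nat -> (t (n - k)%nat <= t n)%R).
    { induction k; intros Hk; [rewrite Nat.sub_0_r; lra|].
      specialize (IHk ltac:(lia)). assert (F := H (n - S k)%nat ltac:(lia)).
      replace (S (n - S k)) with (n - k)%nat in F by lia. lra. }
    apply G. lia.
Qed.

(** A primitive is - z^-(m+1) / (m+1). Its increments over the smooth pieces add up to the
    difference of its values at the two coinciding ends of the contour. *)
Lemma contour_integral_inv_pow (g : R -> C) (m : nat) :
  simple_closed_contour g -> (forall t, (0 <= t <= 1)%R -> g t <> 0) ->
  is_contour_integral g (fun z => (/ z) ^ (m + 2)) 0.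
Proof.
  intros ((Hc & n & t & H0 & H1 & H) & Hcl & _) Hg.
  assert (Ht := breakpoints_range n t H0 H1 (fun i Hi => proj1 (H i Hi))).
  assert (Hgc : forall s, Ccontinuous (fun s => g (clamp s)) s)
    by (intros; apply continuous_clamp, Hc).
  assert (Hic : forall s, Ccontinuous (fun s => / g (clamp s)) s).
  { intros s. apply (Ccontinuous_inv (fun s => g (clamp s))); [apply Hgc | apply Hg, clamp_range]. }
  set (c := - / INR (S m)).
  assert (cm : RtoC (INR (S m)) <> 0).
  { intros E. apply (f_equal fst) in E. change (INR (S m) = 0%R) in E.
    assert (G := lt_0_INR (S m) ltac:(lia)). lra. }
  set (v := fun s => c * (/ g (clamp s)) ^ S m).
  assert (G : forall i, (i <= n)%nat ->
    Cis_RInt (fun s => (/ g s) ^ (m + 2) * path_derive g s) 0 (t i) (v (t i) - v 0%R)).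
  { induction i as [|i IH]; intros Hi.
    - rewrite H0. replace (v 0%R - v 0%R) with (RtoC 0) by ring.
      apply (is_RInt_point (V := C_R_NormedModule)).
    - destruct (H i ltac:(lia)) as (Hlt & d & Hd & Hder).
      assert (R1 := Ht i ltac:(lia)). assert (R2 := Ht (S i) ltac:(lia)).
      replace (v (t (S i)) - v 0%R) with
        (@plus C_R_NormedModule (v (t i) - v 0%R) (v (t (S i)) - v (t i)))
        by (change (v (t i) - v 0%R + (v (t (S i)) - v (t i)) = v (t (S i)) - v 0%R); ring).
      apply (is_RInt_Chasles (V := C_R_NormedModule) _ 0 (t i)); [apply IH; lia|].
      apply (is_RInt_ext (V := C_R_NormedModule) (fun s => (/ g (clamp s)) ^ (m + 2) * d s)).
      { intros s Hs. rewrite Rmin_left, Rmax_right in Hs by lra.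
        rewrite clamp_id by lra. rewrite (path_derive_eq g s (d s)) by (apply Hder, Hs).
        reflexivity. }
      apply Cis_RInt_derive_open; [lra | | |].
      + intros s. apply Ccontinuous_mult; [apply Ccontinuous_const | apply Ccontinuous_pow, Hic].
      + intros s. apply Ccontinuous_mult; [apply Ccontinuous_pow, Hic | apply Hd].
      + intros s Hs.
        assert (D1 : Cis_derive (fun s => g (clamp s)) s (d s)).
        { apply (is_derive_ext_loc (V := C_R_NormedModule) g); [|apply Hder, Hs].
          apply clamp_locally. lra. }
        assert (D2 := Cis_derive_inv_pow (fun s => g (clamp s)) s (d s) (S m)
          (Hg _ (clamp_range s)) D1).
        assert (D3 := Cis_derive_mult (fun _ => c) _ s 0 _
          (is_derive_const (V := C_R_NormedModule) c s) D2).
        replace ((/ g (clamp s)) ^ (m + 2) * d s) with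
          (0 * (/ g (clamp s)) ^ S m
           + c * - (INR (S m) * (/ g (clamp s)) ^ S (S m) * d s)); [exact D3|].
        replace (m + 2)%nat with (S (S m)) by lia. unfold c.
        generalize ((/ g (clamp s)) ^ S m) ((/ g (clamp s)) ^ S (S m)). intros; field. exact cm. }
  specialize (G n (le_n n)). rewrite H1 in G.
  replace (RtoC 0) with (v 1%R - v 0%R); [exact G|].
  unfold v. rewrite !clamp_id, Hcl by lra. ring.
Qed.

Lemma contour_integral_lim (g : R -> C) (F : nat -> C -> C) (f : C -> C) (h : nat -> C) (l : C) :
  piecewise_C1 g ->
  (forall K, is_contour_integral g (F K) (h K)) ->
  (forall eps, (0 < eps)%R -> exists N, forall K t, (N <= K)%nat -> (0 <= t <= 1)%R ->
     (Cmod (F K (g t) - f (g t)) < eps)%R) ->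
  Ccv h l -> is_contour_integral g f l.
Proof.
  intros Hg HF Hu Hh.
  destruct (path_derive_bounded g Hg) as (B & B0 & HB).
  assert (Hu' : forall eps, (0 < eps)%R -> exists N, forall K t, (N <= K)%nat -> (0 <= t <= 1)%R ->
     (Cmod (F K (g t) * path_derive g t - f (g t) * path_derive g t) < eps)%R).
  { intros eps Heps. destruct (Hu (eps / B)%R) as [N HN]; [apply Rdiv_lt_0_compat; lra|].
    exists N. intros K t HK Ht.
    replace (F K (g t) * path_derive g t - f (g t) * path_derive g t)
      with ((F K (g t) - f (g t)) * path_derive g t) by ring.
    rewrite Cmod_mult. specialize (HN K t HK Ht). specialize (HB t Ht).
    assert (P := Cmod_ge_0 (F K (g t) - f (g t))).
    apply Rle_lt_trans with (Cmod (F K (g t) - f (g t)) * B)%R;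
      [apply Rmult_le_compat_l; assumption|].
    apply Rlt_le_trans with (eps / B * B)%R; [apply Rmult_lt_compat_r; assumption|].
    right. field. lra. }
  (* Real and imaginary part are handled at once as 1-Lipschitz maps [p], through which uniform
     convergence passes. *)
  assert (Part : forall p : C -> R,
    (forall z w, (Rabs (p z - p w) <= Cmod (z - w))%R) ->
    (forall K, is_RInt (V := R_NormedModule) (fun t => p (F K (g t) * path_derive g t)) 0 1 (p (h K))) ->
    is_RInt (V := R_NormedModule) (fun t => p (f (g t) * path_derive g t)) 0 1 (p l)).
  { intros p Hp Hi.
    destruct (filterlim_RInt (V := R_CompleteNormedModule)
      (fun K s => p (F K (g (clamp s)) * path_derive g (clamp s))) 0 1 eventually _
      (fun s => p (f (g (clamp s)) * path_derive g (clamp s)))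
      (fun K => p (h K))) as (If & HIf1 & HIf2).
    - intros K. eapply (is_RInt_ext (V := R_NormedModule)); [|apply Hi].
      intros t Ht. rewrite Rmin_left, Rmax_right in Ht by lra.
      cbv beta. rewrite clamp_id by lra. reflexivity.
    - apply filterlim_locally. intros eps.
      destruct (Hu' eps (cond_pos eps)) as [N HN]. exists N. intros K HK s.
      eapply Rle_lt_trans; [apply Hp|]. apply HN; [exact HK | apply clamp_range].
    - assert (E : If = p l).
      { apply (filterlim_locally_unique (V := R_NormedModule) (F := eventually) (fun K => p (h K)));
          [exact HIf1|].
        apply filterlim_locally. intros eps.
        destruct (Hh eps (cond_pos eps)) as [N HN]. exists N. intros K HK.
        eapply Rle_lt_trans; [apply Hp|]. apply HN, HK. }
      rewrite <- E. eapply (is_RInt_ext (V := R_NormedModule)); [|exact HIf2].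
      intros t Ht. rewrite Rmin_left, Rmax_right in Ht by lra.
      cbv beta. rewrite clamp_id by lra. reflexivity. }
  unfold is_contour_integral. rewrite (surjective_pairing l).
  apply (is_RInt_fct_extend_pair (U := R_NormedModule) (V := R_NormedModule)).
  - apply (Part fst).
    + intros z w. apply (re_le_Cmod (z - w)).
    + intros K. apply (is_RInt_fct_extend_fst (U := R_NormedModule) (V := R_NormedModule)
        (fun t => F K (g t) * path_derive g t)), HF.
  - apply (Part snd).
    + intros z w. apply (im_le_Cmod (z - w)).
    + intros K. apply (is_RInt_fct_extend_snd (U := R_NormedModule) (V := R_NormedModule)
        (fun t => F K (g t) * path_derive g t)), HF.
Qed.

(** * Poles of the integrand *)

Local Notation CCcontinuous := (continuous (T := C_UniformSpace) (U := C_UniformSpace)).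

Lemma Ccontinuous_qpoch_inf {T : UniformSpace} (f : T -> C) (t : T) (Q : C) :
  (Cmod Q < 1)%R -> Ccontinuous f t -> Ccontinuous (fun s => qpoch_inf (f s) Q) t.
Proof.
  intros HQ Hf. apply (continuous_comp (V := C_UniformSpace) f (fun A => qpoch_inf A Q)); [exact Hf|].
  set (A0 := f t).
  apply (filterlim_locally_ball_norm (U := C_NormedModule)). intros eps.
  apply (locally_le_locally_norm (V := C_NormedModule)).
  set (r := (Cmod A0 + 1)%R).
  set (L := (ebound r (Cmod Q) / (1 - Cmod Q) + 1)%R).
  assert (L0 : (0 < L)%R).
  { assert (G : (0 < ebound r (Cmod Q) / (1 - Cmod Q))%R)
      by (apply Rdiv_lt_0_compat; [apply exp_pos | lra]).
    unfold L. lra. }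
  assert (D0 : (0 < Rmin 1 (eps / L))%R).
  { apply Rmin_pos; [lra|]. apply Rdiv_lt_0_compat; [apply cond_pos | exact L0]. }
  exists (mkposreal _ D0). intros A HA.
  change (Cmod (A - A0) < Rmin 1 (eps / L))%R in HA.
  change (Cmod (qpoch_inf A Q - qpoch_inf A0 Q) < eps)%R.
  assert (H1 := Rmin_l 1 (eps / L)). assert (H2 := Rmin_r 1 (eps / L)).
  assert (HA1 : (Cmod A <= r)%R).
  { replace A with (A0 + (A - A0)) by ring.
    eapply Rle_trans; [apply Cmod_triangle|]. unfold r. lra. }
  eapply Rle_lt_trans.
  { apply (qpoch_inf_lipschitz A A0 Q r HQ HA1). unfold r; lra. }
  assert (P := Cmod_ge_0 (A - A0)).
  apply Rle_lt_trans with (L * Cmod (A - A0))%R.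
  { apply Rmult_le_compat_r; [exact P | unfold L; lra]. }
  apply Rlt_le_trans with (L * (eps / L))%R; [apply Rmult_lt_compat_l; lra|].
  right. field. lra.
Qed.

Lemma locally_Cmod_gt {T : UniformSpace} (f : T -> C) (t : T) (b : R) :
  Ccontinuous f t -> (b < Cmod (f t))%R -> locally t (fun s => (b < Cmod (f s))%R).
Proof.
  intros Hf Hb.
  assert (D0 : (0 < Cmod (f t) - b)%R) by lra.
  apply (Ccontinuous_Cmod f t Hf (fun y => (b < y)%R)).
  exists (mkposreal _ D0). intros y Hy.
  change (Rabs (y - Cmod (f t)) < Cmod (f t) - b)%R in Hy.
  unfold Rabs in Hy. destruct (Rcase_abs _) in Hy; lra.
Qed.

Lemma locally_neq_0 {T : UniformSpace} (f : T -> C) (t : T) :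
  Ccontinuous f t -> f t <> 0 -> locally t (fun s => f s <> 0).
Proof.
  intros Hf H0. apply (filter_imp (fun s => (0 < Cmod (f s))%R)).
  - intros s Hs. apply Cmod_gt_0, Hs.
  - apply locally_Cmod_gt; [exact Hf | apply Cmod_gt_0, H0].
Qed.

Lemma is_pole_simple (f H : C -> C) (x : C) :
  x <> 0 -> Ccontinuous H (/ x) -> H (/ x) <> 0 ->
  locally (T := C_UniformSpace) (/ x) (fun z => z <> / x -> f z = H z / (1 - x * z)) ->
  is_pole f (/ x).
Proof.
  intros x0 Hc H0 Hf P [M HP].
  set (h := Cmod (H (/ x))). assert (h0 : (0 < h)%R) by (apply Cmod_gt_0, H0).
  assert (Mx : (0 < Cmod x)%R) by (apply Cmod_gt_0, x0).
  assert (M1 : (0 < Rabs M + 1)%R) by (assert (G := Rabs_pos M); lra).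
  (* Within this radius |1 - x z| < (h/2) / (|M| + 1), while |H z| > h/2 nearby, so the quotient
     exceeds |M| + 1. *)
  assert (D0 : (0 < h / 2 / (Rabs M + 1) / Cmod x)%R).
  { repeat apply Rdiv_lt_0_compat; lra. }
  assert (N1 : locally (T := C_UniformSpace) (/ x)
                 (fun z => (Cmod (z - / x) < h / 2 / (Rabs M + 1) / Cmod x)%R)).
  { apply (locally_le_locally_norm (V := C_NormedModule)). exists (mkposreal _ D0).
    intros y Hy. exact Hy. }
  assert (N2 : locally (T := C_UniformSpace) (/ x) (fun z => (h / 2 < Cmod (H z))%R)).
  { apply locally_Cmod_gt; [exact Hc | fold h; lra]. }
  unfold filtermap, locally', within.
  generalize (filter_and _ _ Hf (filter_and _ _ N1 N2)).
  apply filter_imp. intros z' (E & B1 & B2) Hz. apply HP. rewrite (E Hz).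
  clear E. revert z' B1 B2 Hz. refine (fun z : C => _). intros B1 B2 Hz.
  change (not (@eq C z (/ x))) in Hz.
  assert (Ex : 1 - x * z = - (x * (z - / x))) by (field; exact x0).
  assert (zn : z - / x <> 0).
  { intros F. apply Hz. replace z with (/ x + (z - / x)) by ring. rewrite F. ring. }
  assert (dn : 1 - x * z <> 0).
  { rewrite Ex. intros F. apply (Cmult_neq_0 x (z - / x) x0 zn).
    replace (x * (z - / x)) with (- - (x * (z - / x))) by ring. rewrite F. ring. }
  rewrite Cmod_div by exact dn. rewrite Ex, Cmod_opp, Cmod_mult.
  assert (zp : (0 < Cmod (z - / x))%R) by (apply Cmod_gt_0, zn).
  assert (B3 : (Cmod x * Cmod (z - / x) < h / 2 / (Rabs M + 1))%R).
  { apply Rlt_le_trans with (Cmod x * (h / 2 / (Rabs M + 1) / Cmod x))%R.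
    - apply Rmult_lt_compat_l; assumption.
    - right. field. lra. }
  set (w := (Cmod x * Cmod (z - / x))%R) in *.
  assert (w0 : (0 < w)%R) by (apply Rmult_lt_0_compat; assumption).
  apply Rmult_lt_reg_r with w; [exact w0|].
  unfold Rdiv at 1. rewrite Rmult_assoc, Rinv_l, Rmult_1_r by lra.
  apply Rlt_trans with (h / 2)%R; [|exact B2].
  apply Rle_lt_trans with ((Rabs M + 1) * w)%R.
  - apply Rmult_le_compat_r; [lra|]. assert (G := Rle_abs M). lra.
  - apply Rlt_le_trans with ((Rabs M + 1) * (h / 2 / (Rabs M + 1)))%R.
    + apply Rmult_lt_compat_l; assumption.
    + right. field. lra.
Qed.

Lemma two_PI_Ci_neq_0 : 2 * PI * Ci <> 0.
Proof.
  assert (P := PI_RGT_0). repeat apply Cmult_neq_0.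
  - intros E. apply (f_equal fst) in E. simpl in E. lra.
  - intros E. apply (f_equal fst) in E. simpl in E. lra.
  - intros E. apply (f_equal snd) in E. simpl in E. lra.
Qed.

Lemma Ccontinuous_scal_id (c : C) (p : C) : CCcontinuous (fun z : C => c * z) p.
Proof.
  apply (Ccontinuous_mult (T := C_UniformSpace)); [apply Ccontinuous_const | apply continuous_id].
Qed.

(** Only the factor of index [k] of (a z; Q)_oo vanishes at the point; the conditions on [b] and [c]
    keep the other two products away from 0. Each of the three families in the denominator of the
    integrand takes the role of [a] in turn. *)
Lemma is_pole_qpoch_quotient (N : C -> C) (a b c Q : C) (k : nat) :
  (0 < Cmod Q < 1)%R -> a <> 0 ->
  CCcontinuous N (/ (a * Q ^ k)) -> N (/ (a * Q ^ k)) <> 0 ->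
  (forall n, b * Q ^ n <> a * Q ^ k) -> (forall n, c * Q ^ n <> a * Q ^ k) ->
  is_pole (fun z => N z / (qpoch_inf (a * z) Q * qpoch_inf (b * z) Q * qpoch_inf (c * z) Q)
                    / (2 * PI * Ci * z)) (/ (a * Q ^ k)).
Proof.
  intros HQ a0 HN N0 Hb Hc.
  assert (Q0 : Q <> 0) by (apply Cmod_gt_0; lra).
  set (x := a * Q ^ k) in *.
  assert (x0 : x <> 0) by (apply Cmult_neq_0; [exact a0 | apply Cpow_nz, Q0]).
  (* The denominator without its vanishing factor 1 - x z. *)
  set (R := fun z => cprod k (fun n => 1 - a * z * Q ^ n) * qpoch_inf (a * Q ^ S k * z) Q
                     * qpoch_inf (b * z) Q * qpoch_inf (c * z) Q * (2 * PI * Ci * z)).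
  assert (RC : CCcontinuous R (/ x)).
  { assert (F : forall y, CCcontinuous (fun z : C => qpoch_inf (y * z) Q) (/ x)).
    { intros y. apply (Ccontinuous_qpoch_inf (T := C_UniformSpace));
        [lra | apply Ccontinuous_scal_id]. }
    unfold R. apply (Ccontinuous_mult (T := C_UniformSpace)); [|apply Ccontinuous_scal_id].
    apply (Ccontinuous_mult (T := C_UniformSpace)); [|apply F].
    apply (Ccontinuous_mult (T := C_UniformSpace)); [|apply F].
    apply (Ccontinuous_mult (T := C_UniformSpace)); [|apply F].
    generalize (/ x) k. clear. intros p k. induction k; [apply Ccontinuous_const|].
    apply (Ccontinuous_mult (T := C_UniformSpace)); [exact IHk|].
    apply (continuous_plus (U := C_UniformSpace) (V := C_NormedModule) (fun _ => RtoC 1)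
             (fun z => - (a * z * Q ^ k))).
    - apply continuous_const.
    - apply (continuous_opp (U := C_UniformSpace) (V := C_NormedModule) (fun z => a * z * Q ^ k)).
      apply (Ccontinuous_mult (T := C_UniformSpace)); [apply Ccontinuous_scal_id | apply Ccontinuous_const]. }
  assert (Hne : forall y, y <> x -> 1 - y * / x <> 0)
    by (intros y Hy; apply (one_minus_div_neq_0 x y); assumption).
  assert (Hpow : forall n, n <> k -> a * Q ^ n <> x).
  { intros n Hn E. apply Hn. apply (pow_inj_lt_1 (Cmod Q)); [exact HQ|].
    rewrite <- !Cmod_pow. f_equal.
    replace (Q ^ n) with (/ a * (a * Q ^ n)) by (field; exact a0).
    rewrite E. unfold x. field. exact a0. }
  assert (R0 : R (/ x) <> 0).
  { unfold R. repeat apply Cmult_neq_0;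
      try (apply qpoch_inf_neq_0; [lra|]; intros n).
    - apply cprod_neq_0. intros n Hn. replace (a * / x * Q ^ n) with (a * Q ^ n * / x) by ring.
      apply Hne, Hpow. lia.
    - replace (a * Q ^ S k * / x * Q ^ n) with (a * Q ^ (S k + n) * / x)
        by (rewrite Cpow_add_r; ring).
      apply Hne, Hpow. lia.
    - replace (b * / x * Q ^ n) with (b * Q ^ n * / x) by ring. apply Hne, Hb.
    - replace (c * / x * Q ^ n) with (c * Q ^ n * / x) by ring. apply Hne, Hc.
    - intros E. apply (f_equal fst) in E. simpl in E. lra.
    - intros E. apply (f_equal fst) in E. simpl in E. assert (P := PI_RGT_0). lra.
    - intros E. apply (f_equal snd) in E. simpl in E. lra.
    - apply Cinv_neq_0, x0. }
  apply (is_pole_simple _ (fun z => N z * / R z)); [exact x0 | | |].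
  - apply (Ccontinuous_mult (T := C_UniformSpace)); [exact HN|].
    apply (Ccontinuous_inv (T := C_UniformSpace)); assumption.
  - apply Cmult_neq_0; [exact N0 | apply Cinv_neq_0, R0].
  - generalize (locally_neq_0 (T := C_UniformSpace) R (/ x) RC R0).
    apply filter_imp. refine (fun z : C => _). intros Rz Hz.
    change (not (@eq C z (/ x))) in Hz.
    assert (zn : z - / x <> 0).
    { intros F. apply Hz. replace z with (/ x + (z - / x)) by ring. rewrite F. ring. }
    assert (dn : 1 - x * z <> 0).
    { intros F. apply (Cmult_neq_0 x (z - / x) x0 zn).
      replace (x * (z - / x)) with (- (1 - x * z)) by (field; exact x0). rewrite F. ring. }
    rewrite (qpoch_inf_add (a * z) Q (S k)) by lra. cbn [qpoch].
    rewrite qpoch_cprod. replace (a * z * Q ^ k) with (x * z) by (unfold x; ring).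
    replace (a * z * Q ^ S k) with (a * Q ^ S k * z) by ring.
    unfold R in *. clear RC R0.
    set (r1 := cprod k (fun n => 1 - a * z * Q ^ n)) in *.
    set (r2 := qpoch_inf (a * Q ^ S k * z) Q) in *.
    set (r3 := qpoch_inf (b * z) Q) in *. set (r4 := qpoch_inf (c * z) Q) in *.
    set (r5 := 2 * PI * Ci * z) in *.
    assert (F : r1 <> 0 /\ r2 <> 0 /\ r3 <> 0 /\ r4 <> 0 /\ r5 <> 0).
    { repeat split; intros F; apply Rz; rewrite F; ring. }
    destruct F as (F1 & F2 & F3 & F4 & F5).
    field. repeat split; assumption.
Qed.

Lemma is_pole_ext (f h : C -> C) (p : C) : (forall z, f z = h z) -> is_pole f p -> is_pole h p.
Proof.
  intros E H. unfold is_pole. apply (filterlim_ext (fun z => Cmod (f z))); [|exact H].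
  intros z. rewrite E. reflexivity.
Qed.

Lemma omega_q_pow_neq (q : C) (i j k n : nat) :
  (0 < Cmod q < 1)%R -> (i < 3)%nat -> (j < 3)%nat -> i <> j ->
  omega ^ i * q ^ 4 * (q ^ 3) ^ n <> omega ^ j * q ^ 4 * (q ^ 3) ^ k.
Proof.
  intros Hq Hi Hj Hij E. apply (node_inj q (3 * n + i) (3 * k + j) Hq); [lia|].
  rewrite !node_3, !Cpow_add_r, !Cpow_mult_r by assumption.
  rewrite !Cmult_assoc. exact E.
Qed.

(** The numerator does not cancel the pole. A zero of one of the first two products would make x a
    power of q with exponent divisible by 3, whereas |x| = |q|^(4+3k). In the third product the
    numbers x q^(3n) all have modulus below 1. *)
Lemma integrand_num_neq_0 (q : C) (k j : nat) :
  (0 < Cmod q < 1)%R ->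
  let x := omega ^ j * q ^ 4 * (q ^ 3) ^ k in
  qpoch_inf3 (q ^ 6 * / x) (q ^ 3 * / x) (/ / x) (q ^ 3) <> 0.
Proof.
  intros Hq x. assert (q0 : q <> 0) by (apply Cmod_gt_0; lra).
  assert (Hx : Cmod x = (Cmod q ^ (4 + 3 * k))%R).
  { unfold x. rewrite !Cmod_mult, !Cmod_pow, Cmod_omega, pow1, pow_add, pow_mult. ring. }
  assert (x0 : x <> 0).
  { apply Cmult_neq_0; [apply Cmult_neq_0|]; repeat apply Cpow_nz;
      (exact omega_neq_0 || exact q0). }
  assert (Hne : forall n m, (n mod 3 = 0)%nat -> (m mod 3 = 0)%nat -> q ^ n * / x * q ^ m <> 1).
  { intros n m Hn Hm E.
    assert (E' : q ^ (n + m) = x).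
    { rewrite Cpow_add_r. replace (q ^ n * q ^ m) with (q ^ n * / x * q ^ m * x) by (field; exact x0).
      rewrite E. ring. }
    apply (f_equal Cmod) in E'. rewrite Hx, Cmod_pow in E'. apply pow_inj_lt_1 in E'; [|exact Hq].
    assert (D1 := Nat.div_mod_eq n 3). assert (D2 := Nat.div_mod_eq m 3). lia. }
  assert (H3 : (Cmod (q ^ 3) < 1)%R) by (apply Cmod_pow_lt_1; [lra | lia]).
  assert (Hsub : forall y : C, y <> 1 -> 1 - y <> 0).
  { intros y Hy E. apply Hy. replace y with (1 - (1 - y)) by ring. rewrite E. ring. }
  assert (M3 : forall n, ((3 * n) mod 3 = 0)%nat)
    by (intros n; rewrite Nat.mul_comm; apply Nat.Div0.mod_mul).
  unfold qpoch_inf3. apply Cmult_neq_0; [apply Cmult_neq_0|]; apply qpoch_inf_neq_0; try exact H3;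
    intros n; rewrite <- Cpow_mult_r; apply Hsub.
  - apply Hne; [reflexivity | apply M3].
  - apply Hne; [reflexivity | apply M3].
  - intros E. assert (E' : Cmod (/ / x * q ^ (3 * n)) = 1%R) by (rewrite E; apply Cmod_1).
    replace (/ / x * q ^ (3 * n)) with (x * q ^ (3 * n)) in E' by (field; exact x0).
    rewrite Cmod_mult, Hx, Cmod_pow, <- pow_add in E'.
    assert (G := pow_lt_1_pos (Cmod q) (4 + 3 * k + 3 * n) ltac:(lra) ltac:(lia)). lra.
Qed.

Lemma is_pole_integrand (q : C) (i : nat) :
  (0 < Cmod q < 1)%R -> is_pole (integrand q) (/ node q i).
Proof.
  intros Hq. assert (q0 : q <> 0) by (apply Cmod_gt_0; lra).
  set (k := (i / 3)%nat). set (j := (i mod 3)%nat).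
  assert (Hj : (j < 3)%nat) by (apply Nat.mod_upper_bound; lia).
  assert (En : node q i = omega ^ j * q ^ 4 * (q ^ 3) ^ k).
  { unfold node. fold j k. rewrite Cpow_add_r, Cpow_mult_r. ring. }
  set (Nf := fun z => qpoch_inf3 (q ^ 6 * z) (q ^ 3 * z) (/ z) (q ^ 3)).
  assert (H3 : (0 < Cmod (q ^ 3) < 1)%R).
  { split; [apply Cmod_gt_0, Cpow_nz, q0 | apply Cmod_pow_lt_1; [lra | lia]]. }
  assert (x0 : omega ^ j * q ^ 4 * (q ^ 3) ^ k <> 0) by (rewrite <- En; apply node_neq_0, q0).
  assert (HN : CCcontinuous Nf (/ (omega ^ j * q ^ 4 * (q ^ 3) ^ k))).
  { set (p := / _) in *.
    assert (F : forall y, CCcontinuous (fun z : C => qpoch_inf (y * z) (q ^ 3)) p).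
    { intros y. apply (Ccontinuous_qpoch_inf (T := C_UniformSpace));
        [lra | apply Ccontinuous_scal_id]. }
    unfold Nf, qpoch_inf3. apply (Ccontinuous_mult (T := C_UniformSpace)).
    - apply (Ccontinuous_mult (T := C_UniformSpace)); apply F.
    - apply (Ccontinuous_qpoch_inf (T := C_UniformSpace) Cinv); [lra|].
      apply (Ccontinuous_inv (T := C_UniformSpace) (fun z => z));
        [apply continuous_id | apply Cinv_neq_0, x0]. }
  assert (HN0 := integrand_num_neq_0 q k j Hq). cbv zeta in HN0.
  rewrite En.
  assert (Ha : forall m, omega ^ m * q ^ 4 <> 0)
    by (intros; apply Cmult_neq_0; apply Cpow_nz; (exact omega_neq_0 || exact q0)).
  assert (P : forall j1 j2, (j1 < 3)%nat -> (j2 < 3)%nat -> j1 <> j -> j2 <> j ->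
    is_pole (fun z => Nf z / (qpoch_inf (omega ^ j * q ^ 4 * z) (q ^ 3)
      * qpoch_inf (omega ^ j1 * q ^ 4 * z) (q ^ 3) * qpoch_inf (omega ^ j2 * q ^ 4 * z) (q ^ 3))
                    / (2 * PI * Ci * z)) (/ (omega ^ j * q ^ 4 * (q ^ 3) ^ k))).
  { intros j1 j2 L1 L2 N1 N2. apply is_pole_qpoch_quotient; try assumption; try apply Ha;
      intros n; apply omega_q_pow_neq; assumption. }
  assert (E0 : omega ^ 0 * q ^ 4 = q ^ 4) by (simpl; ring).
  destruct j as [|[|[|j]]]; [| | |lia].
  - eapply is_pole_ext; [|apply (P 1%nat 2%nat); lia]. intros z. rewrite E0, Cpow_1_r. reflexivity.
  - eapply is_pole_ext; [|apply (P 0%nat 2%nat); lia]. intros z. rewrite E0, Cpow_1_r.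
    unfold integrand, qpoch_inf3, Nf, qpoch_inf3. f_equal. f_equal. ring.
  - eapply is_pole_ext; [|apply (P 0%nat 1%nat); lia]. intros z. rewrite E0, Cpow_1_r.
    unfold integrand, qpoch_inf3, Nf, qpoch_inf3. f_equal. f_equal. ring.
Qed.

(** * The integral and the huffing operator *)

Lemma contour_integral_inv_node (g : R -> C) (x : C) :
  x <> 0 -> leaves_outside g (/ x) -> is_contour_integral g (fun z => / (1 - x * z)) 0.
Proof.
  intros x0 [Hg H].
  apply (contour_integral_eq g _ (- (2 * PI * Ci / x) * 0)); [ring|].
  eapply contour_integral_ext; [|apply contour_integral_scal, H].
  intros t Ht. specialize (Hg t Ht). simpl.
  assert (P := two_PI_Ci_neq_0).
  assert (zn : g t - / x <> 0).
  { intros F. apply Hg. replace (g t) with (/ x + (g t - / x)) by ring. rewrite F. ring. }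
  assert (E : 1 - x * g t = - (x * (g t - / x))) by (field; exact x0).
  rewrite E. clear E H.
  generalize dependent (g t - / x). intros w w0.
  generalize dependent (2 * PI * Ci). intros c c0.
  field. repeat split; assumption.
Qed.

(** The integrand is a polynomial in 1/z without terms of degree below 2. Expanding the last factor
    raises the power of 1/z, so the induction needs all [m] at once. *)
Lemma contour_integral_qpoch_inv_pow (g : R -> C) (Q : C) (n : nat) : forall m,
  simple_closed_contour g -> (forall t, (0 <= t <= 1)%R -> g t <> 0) ->
  is_contour_integral g (fun z => qpoch (/ z) Q n * (/ z) ^ (m + 2)) 0.
Proof.
  induction n; intros m Hs Hg.
  - eapply contour_integral_ext; [|apply (contour_integral_inv_pow g m Hs Hg)].
    intros t Ht. simpl. ring.
  - apply (contour_integral_eq g _ (0 + - Q ^ n * 0)); [ring|].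
    eapply contour_integral_ext;
      [|apply contour_integral_plus; [apply (IHn m Hs Hg) | apply contour_integral_scal, (IHn (S m) Hs Hg)]].
    intros t Ht. cbn [qpoch]. replace (S m + 2)%nat with (S (m + 2)) by lia.
    rewrite Cpow_S. ring.
Qed.

(** The identity (1 - Q^n/z) / (1 - x z) = (1 - x Q^n) / (1 - x z) - Q^n/z peels off a factor. Its
    last term, multiplied by the remaining polynomial in 1/z and by 1/z, integrates to 0, so each
    factor is evaluated at 1/z = x. *)
Lemma contour_integral_qpoch_node (g : R -> C) (Q x : C) (n : nat) :
  simple_closed_contour g -> positively_encloses g 0 ->
  x <> 0 -> leaves_outside g (/ x) ->
  is_contour_integral g (fun z => qpoch (/ z) Q n / (1 - x * z) / (2 * PI * Ci * z))
    (qpoch x Q n).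
Proof.
  intros Hs [Hg W0] x0 Hx.
  assert (c0 := two_PI_Ci_neq_0). set (c := 2 * PI * Ci) in *. clearbody c.
  assert (dn : forall t, (0 <= t <= 1)%R -> 1 - x * g t <> 0).
  { intros t Ht E. apply (proj1 Hx t Ht).
    replace (g t) with (/ x - / x * (1 - x * g t)) by (field; exact x0). rewrite E. ring. }
  induction n.
  (* Here 1/(z (1 - x z)) = 1/z + x/(1 - x z): winding number 1 around 0, and 0 around 1/x. *)
  - apply (contour_integral_eq g _ (1 + x / c * 0)); [simpl; ring|].
    eapply contour_integral_ext;
      [|apply contour_integral_plus;
        [apply W0 | apply contour_integral_scal, (contour_integral_inv_node g x x0 Hx)]].
    intros t Ht. simpl. specialize (dn t Ht). specialize (Hg t Ht).
    assert (g0 : g t - 0 <> 0) by (replace (g t - 0) with (g t) by ring; exact Hg).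
    field. repeat split; assumption.
  - apply (contour_integral_eq g _ ((1 - x * Q ^ n) * qpoch x Q n + - (Q ^ n / c) * 0));
      [cbn [qpoch]; ring|].
    eapply contour_integral_ext;
      [|apply contour_integral_plus;
        [apply contour_integral_scal, IHn
        | apply contour_integral_scal, (contour_integral_qpoch_inv_pow g Q n 0 Hs Hg)]].
    intros t Ht. specialize (dn t Ht). specialize (Hg t Ht). cbn [qpoch]. simpl (0 + 2)%nat.
    field. repeat split; assumption.
Qed.

Definition finite_integrand (q : C) (K : nat) (z : C) : C :=
  qpoch (q ^ 6 * z) (q ^ 3) K * qpoch (q ^ 3 * z) (q ^ 3) K * qpoch (/ z) (q ^ 3) K /
  (qpoch (q ^ 4 * z) (q ^ 3) K * qpoch (omega * q ^ 4 * z) (q ^ 3) K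
   * qpoch (omega ^ 2 * q ^ 4 * z) (q ^ 3) K) / (2 * PI * Ci * z).

Lemma contour_integral_finite (g : R -> C) (q : C) (K : nat) :
  (0 < Cmod q < 1)%R -> (1 <= K)%nat ->
  simple_closed_contour g -> positively_encloses g 0 ->
  (forall i, leaves_outside g (/ node q i)) ->
  is_contour_integral g (finite_integrand q K)
    (/ 3 * (huffed_approx K q + huffed_approx K (omega * q) + huffed_approx K (omega ^ 2 * q))).
Proof.
  intros Hq HK Hs H0 Hn. assert (q0 : q <> 0) by (apply Cmod_gt_0; lra).
  rewrite <- residue_sum_eq by exact Hq.
  eapply contour_integral_ext;
    [|apply contour_integral_csum; intros i; apply contour_integral_scal,
        (contour_integral_qpoch_node g (q ^ 3) (node q i) K Hs H0 (node_neq_0 q i q0) (Hn i))].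
  intros t Ht. cbv beta.
  assert (dn : forall i, 1 - node q i * g t <> 0).
  { intros i E. apply (proj1 (Hn i) t Ht).
    replace (g t) with (/ node q i - / node q i * (1 - node q i * g t))
      by (field; apply node_neq_0, q0).
    rewrite E. ring. }
  unfold finite_integrand.
  assert (F := finite_integrand_partial_fractions q (g t) K Hq HK dn).
  unfold Cdiv in *.
  match goal with |- _ = ?A * ?B * ?c * ?d * ?e =>
    replace (A * B * c * d * e) with (c * e * (A * B * d)) by ring end.
  rewrite F, <- csum_scal. apply csum_ext. intros; ring.
Qed.

(** Uniform convergence on [0, 1]. The bound on the limit is bundled in because stability under
    products uses it. *)
Definition ucv (F : nat -> R -> C) (f : R -> C) : Prop :=
  (forall eps, (0 < eps)%R -> exists N, forall K t, (N <= K)%nat -> (0 <= t <= 1)%R ->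
     (Cmod (F K t - f t) < eps)%R) /\
  exists B, (0 < B)%R /\ forall t, (0 <= t <= 1)%R -> (Cmod (f t) <= B)%R.

Lemma ucv_mult (F G : nat -> R -> C) (f g : R -> C) :
  ucv F f -> ucv G g -> ucv (fun K t => F K t * G K t) (fun t => f t * g t).
Proof.
  intros [HF (A & A0 & HA)] [HG (B & B0 & HB)]. split.
  - intros eps Heps.
    destruct (HF 1%R ltac:(lra)) as [N0 HN0].
    destruct (HF (eps / (2 * B))%R) as [N1 HN1]; [apply Rdiv_lt_0_compat; lra|].
    destruct (HG (eps / (2 * (A + 1)))%R) as [N2 HN2]; [apply Rdiv_lt_0_compat; lra|].
    exists (max N0 (max N1 N2)). intros K t HK Ht.
    assert (H0 := HN0 K t ltac:(lia) Ht). assert (H1 := HN1 K t ltac:(lia) Ht).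
    assert (H2 := HN2 K t ltac:(lia) Ht). assert (HAt := HA t Ht). assert (HBt := HB t Ht).
    replace (F K t * G K t - f t * g t)
      with (F K t * (G K t - g t) + g t * (F K t - f t)) by ring.
    eapply Rle_lt_trans; [apply Cmod_triangle|]. rewrite !Cmod_mult.
    assert (HFt : (Cmod (F K t) <= A + 1)%R).
    { replace (F K t) with (f t + (F K t - f t)) by ring.
      eapply Rle_trans; [apply Cmod_triangle|]. lra. }
    assert (P1 := Cmod_ge_0 (G K t - g t)). assert (P2 := Cmod_ge_0 (F K t - f t)).
    assert (X1 : ((A + 1) * Cmod (G K t - g t) < eps / 2)%R).
    { apply Rlt_le_trans with ((A + 1) * (eps / (2 * (A + 1))))%R;
        [apply Rmult_lt_compat_l; lra | right; field; lra]. }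
    assert (X2 : (B * Cmod (F K t - f t) < eps / 2)%R).
    { apply Rlt_le_trans with (B * (eps / (2 * B)))%R;
        [apply Rmult_lt_compat_l; lra | right; field; lra]. }
    assert (X3 : (Cmod (F K t) * Cmod (G K t - g t) <= (A + 1) * Cmod (G K t - g t))%R)
      by (apply Rmult_le_compat_r; lra).
    assert (X4 : (Cmod (g t) * Cmod (F K t - f t) <= B * Cmod (F K t - f t))%R)
      by (apply Rmult_le_compat_r; lra).
    lra.
  - exists (A * B)%R. split; [apply Rmult_lt_0_compat; assumption|].
    intros t Ht. rewrite Cmod_mult.
    apply Rmult_le_compat; try apply Cmod_ge_0; [apply HA, Ht | apply HB, Ht].
Qed.

Lemma ucv_inv (F : nat -> R -> C) (f : R -> C) (d : R) :
  (0 < d)%R -> (forall t, (0 <= t <= 1)%R -> (d <= Cmod (f t))%R) ->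
  ucv F f -> ucv (fun K t => / F K t) (fun t => / f t).
Proof.
  intros d0 Hd [HF _].
  assert (fn : forall t, (0 <= t <= 1)%R -> f t <> 0).
  { intros t Ht. apply Cmod_gt_0. specialize (Hd t Ht). lra. }
  split.
  - intros eps Heps.
    destruct (HF (d / 2)%R ltac:(lra)) as [N1 HN1].
    destruct (HF (eps * (d * d / 2))%R) as [N2 HN2].
    { apply Rmult_lt_0_compat; [lra|]. nra. }
    exists (max N1 N2). intros K t HK Ht.
    assert (H1 := HN1 K t ltac:(lia) Ht). assert (H2 := HN2 K t ltac:(lia) Ht).
    assert (H3 := Hd t Ht). assert (H4 := fn t Ht).
    assert (H5 : (d / 2 < Cmod (F K t))%R).
    { assert (G := Cmod_minus_le (f t) (F K t)).
      replace (f t - F K t) with (- (F K t - f t)) in G by ring. rewrite Cmod_opp in G. lra. }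
    assert (H6 : F K t <> 0) by (apply Cmod_gt_0; lra).
    replace (/ F K t - / f t) with (- ((F K t - f t) / (F K t * f t))) by (field; split; assumption).
    rewrite Cmod_opp, Cmod_div, Cmod_mult by (apply Cmult_neq_0; assumption).
    apply Rmult_lt_reg_r with (Cmod (F K t) * Cmod (f t))%R; [nra|].
    unfold Rdiv. rewrite Rmult_assoc, Rinv_l by nra. rewrite Rmult_1_r.
    eapply Rlt_le_trans; [exact H2|]. apply Rmult_le_compat_l; [lra|]. nra.
  - exists (/ d)%R. split; [apply Rinv_0_lt_compat, d0|]. intros t Ht.
    rewrite Cmod_inv by (apply fn, Ht). apply Rinv_le_contravar; [exact d0 | apply Hd, Ht].
Qed.

Lemma ucv_const (f : R -> C) (B : R) :
  (0 < B)%R -> (forall t, (0 <= t <= 1)%R -> (Cmod (f t) <= B)%R) -> ucv (fun _ => f) f.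
Proof.
  intros B0 HB. split; [|exists B; split; assumption].
  intros eps Heps. exists 0%nat. intros K t _ _.
  replace (f t - f t) with (RtoC 0) by ring. rewrite Cmod_0. exact Heps.
Qed.

Lemma ucv_qpoch (A : R -> C) (Q : C) (r : R) :
  (Cmod Q < 1)%R -> (forall t, (0 <= t <= 1)%R -> (Cmod (A t) <= r)%R) ->
  ucv (fun K t => qpoch (A t) Q K) (fun t => qpoch_inf (A t) Q).
Proof.
  intros HQ HA. split.
  - intros eps Heps.
    destruct (Rpow_cv_0 (Cmod Q) (ebound r (Cmod Q) * r / (1 - Cmod Q)) eps
                (conj (Cmod_ge_0 Q) HQ) Heps) as [N HN].
    exists N. intros K t HK Ht.
    replace (qpoch (A t) Q K - qpoch_inf (A t) Q) with (- (qpoch_inf (A t) Q - qpoch (A t) Q K)) by ring.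
    rewrite Cmod_opp. eapply Rle_lt_trans; [|apply (HN K HK)].
    apply (qpoch_inf_spec (A t) Q r HQ (HA t Ht)).
  - exists (ebound r (Cmod Q)). split; [apply exp_pos|].
    intros t Ht. apply qpoch_inf_le; [exact HQ | apply HA, Ht].
Qed.

Lemma contour_integral_integrand (g : R -> C) (q : C) :
  (0 < Cmod q < 1)%R -> simple_closed_contour g -> separates_0_from_poles g (integrand q) ->
  is_contour_integral g (integrand q)
    (/ 3 * (huffed_function q + huffed_function (omega * q) + huffed_function (omega ^ 2 * q))).
Proof.
  intros Hq Hs [H0 Hp]. assert (q0 : q <> 0) by (apply Cmod_gt_0; lra).
  (* The hypothesis on poles enters here: as each inverse node is a genuine pole of the integrand,
     it lies outside the contour. *)
  assert (Hn : forall i, leaves_outside g (/ node q i)).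
  { intros i. apply Hp; [apply Cinv_neq_0, node_neq_0, q0 | apply is_pole_integrand, Hq]. }
  assert (Hg0 := proj1 H0).
  assert (H3 : (Cmod (q ^ 3) < 1)%R) by (apply Cmod_pow_lt_1; [lra | lia]).
  apply (contour_integral_lim g (fun K => finite_integrand q (S K)) (integrand q)
    (fun K => / 3 * (huffed_approx (S K) q + huffed_approx (S K) (omega * q)
                     + huffed_approx (S K) (omega ^ 2 * q)))).
  - apply Hs.
  - intros K. apply contour_integral_finite; (assumption || lia).
  - assert (Hgc : forall t, Ccontinuous (fun s => g (clamp s)) t)
      by (intros; apply continuous_clamp, (proj1 (proj1 Hs))).
    assert (Hgi : forall t, Ccontinuous (fun s => / g (clamp s)) t).
    { intros t. apply (Ccontinuous_inv (fun s => g (clamp s))); [apply Hgc | apply Hg0, clamp_range]. }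
    destruct (Ccontinuous_bounded (fun s => g (clamp s)) 0 1) as (B1 & B1p & HB1); [lra | intros; apply Hgc|].
    destruct (Ccontinuous_bounded (fun s => / g (clamp s)) 0 1) as (B2 & B2p & HB2); [lra | intros; apply Hgi|].
    assert (HB1' : forall t, (0 <= t <= 1)%R -> (Cmod (g t) <= B1)%R).
    { intros t Ht. rewrite <- (clamp_id t Ht). apply HB1, Ht. }
    assert (HB2' : forall t, (0 <= t <= 1)%R -> (Cmod (/ g t) <= B2)%R).
    { intros t Ht. rewrite <- (clamp_id t Ht). apply HB2, Ht. }
    assert (Hc : forall c, ucv (fun K t => qpoch (c * g t) (q ^ 3) K)
                               (fun t => qpoch_inf (c * g t) (q ^ 3))).
    { intros c. apply (ucv_qpoch _ _ (Cmod c * B1)); [exact H3|].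
      intros t Ht. rewrite Cmod_mult. apply Rmult_le_compat_l; [apply Cmod_ge_0 | apply HB1', Ht]. }
    assert (Hi : ucv (fun K t => qpoch (/ g t) (q ^ 3) K) (fun t => qpoch_inf (/ g t) (q ^ 3)))
      by (apply (ucv_qpoch _ _ B2); assumption).
    set (den := fun z => qpoch_inf3 (q ^ 4 * z) (omega * q ^ 4 * z) (omega ^ 2 * q ^ 4 * z) (q ^ 3)).
    assert (Hden : forall t, (0 <= t <= 1)%R -> den (g t) <> 0).
    { intros t Ht. unfold den, qpoch_inf3.
      assert (F : forall j, (j < 3)%nat -> qpoch_inf (omega ^ j * q ^ 4 * g t) (q ^ 3) <> 0).
      { intros j Hj. apply qpoch_inf_neq_0; [exact H3|]. intros k E.
        apply (proj1 (Hn (3 * k + j)%nat) t Ht).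
        rewrite node_3, Cpow_add_r, Cpow_mult_r by exact Hj.
        assert (x0 : omega ^ j * (q ^ 4 * (q ^ 3) ^ k) <> 0).
        { apply Cmult_neq_0; [|apply Cmult_neq_0]; repeat apply Cpow_nz;
            (exact omega_neq_0 || exact q0). }
        set (x := omega ^ j * (q ^ 4 * (q ^ 3) ^ k)) in *.
        replace (g t) with (/ x - / x * (1 - x * g t)) by (field; exact x0).
        replace (x * g t) with (omega ^ j * q ^ 4 * g t * (q ^ 3) ^ k) by (unfold x; ring).
        rewrite E. ring. }
      assert (F0 := F 0%nat ltac:(lia)). assert (F1 := F 1%nat ltac:(lia)). rewrite Cpow_1_r in F1.
      replace (omega ^ 0 * q ^ 4) with (q ^ 4) in F0 by (simpl; ring).
      apply Cmult_neq_0; [apply Cmult_neq_0; [exact F0 | exact F1] | apply F; lia]. }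
    assert (Hdc : forall t, Ccontinuous (fun s => den (g (clamp s))) t).
    { intros t. unfold den, qpoch_inf3.
      assert (F : forall c, Ccontinuous (fun s => qpoch_inf (c * g (clamp s)) (q ^ 3)) t).
      { intros c. apply Ccontinuous_qpoch_inf; [exact H3|].
        apply Ccontinuous_mult; [apply Ccontinuous_const | apply Hgc]. }
      apply Ccontinuous_mult; [apply Ccontinuous_mult|]; apply F. }
    (* The denominator has no zero on the compact contour, hence is bounded below there, and
       reciprocals of the truncated denominators converge uniformly. *)
    destruct (Ccontinuous_bounded_below (fun s => den (g (clamp s))) 0 1) as (d & d0 & Hd).
    { lra. } { intros; apply Hdc. } { intros; apply Hden, clamp_range. }
    assert (Hd' : forall t, (0 <= t <= 1)%R -> (d <= Cmod (den (g t)))%R).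
    { intros t Ht. rewrite <- (clamp_id t Ht). apply Hd, Ht. }
    assert (U : ucv (fun K t => finite_integrand q K (g t)) (fun t => integrand q (g t))).
    { unfold finite_integrand, integrand, Cdiv. apply ucv_mult.
      - apply ucv_mult; [apply ucv_mult; [apply ucv_mult|]; [apply Hc | apply Hc | exact Hi]|].
        apply (ucv_inv _ _ d d0 Hd').
        apply ucv_mult; [apply ucv_mult|]; apply Hc.
      - apply (ucv_const _ (Cmod (/ (2 * PI * Ci)) * B2)).
        + apply Rmult_lt_0_compat; [apply Cmod_gt_0, Cinv_neq_0, two_PI_Ci_neq_0 | exact B2p].
        + intros t Ht.
          replace (/ (2 * PI * Ci * g t)) with (/ (2 * PI * Ci) * / g t).
          * rewrite Cmod_mult. apply Rmult_le_compat_l; [apply Cmod_ge_0 | apply HB2', Ht].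
          * assert (c0 := two_PI_Ci_neq_0). assert (G := Hg0 t Ht).
            generalize dependent (2 * PI * Ci). intros c c0. field. split; assumption. }
    intros eps Heps. destruct (proj1 U eps Heps) as [N HN].
    exists N. intros K t HK Ht. apply HN; [lia | exact Ht].
  - assert (L : forall s, (0 < Cmod s < 1)%R -> Ccv (fun K => huffed_approx (S K) s) (huffed_function s)).
    { intros s Hs1. rewrite huffed_function_eq by exact Hs1.
      apply Ccv_scal. apply (Ccv_subseq S (fun K => approx_sum K s)); [|apply approx_sum_cv; lra].
      intros N. exists N. intros; lia. }
    apply Ccv_scal, Ccv_plus; [apply Ccv_plus|]; apply L;
      rewrite ?Cmod_mult, ?Cmod_pow, ?Cmod_omega; lra.
Qed.

(** As 0^0 = 1, the symbol (A; 0)_oo is 1 - A, and the integrand is (1 - 1/z) / (2 pi i z). Its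
    first term gives the winding number of 0, its second has a primitive. *)
Lemma contour_integral_integrand_0 (g : R -> C) :
  simple_closed_contour g -> positively_encloses g 0 -> is_contour_integral g (integrand 0) 1.
Proof.
  intros Hs [Hg H].
  assert (E : forall A, qpoch_inf A 0 = 1 - A).
  { intros A. rewrite (qpoch_inf_add A 0 1) by (rewrite Cmod_0; lra).
    replace (A * 0 ^ 1) with (RtoC 0) by (simpl; ring).
    rewrite qpoch_inf_0_l by (rewrite Cmod_0; lra). simpl. ring. }
  assert (c0 := two_PI_Ci_neq_0).
  apply (contour_integral_eq g _ (1 + - (/ (2 * PI * Ci)) * 0)); [ring|].
  eapply contour_integral_ext; [|apply contour_integral_plus;
    [exact H | apply contour_integral_scal, (contour_integral_inv_pow g 0 Hs Hg)]].
  intros t Ht. specialize (Hg t Ht). unfold integrand, qpoch_inf3.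
  replace ((RtoC 0) ^ 3) with (RtoC 0) by (simpl; ring).
  rewrite !E. clear H. generalize dependent (2 * PI * Ci). intros c c0.
  assert (g0 : g t - 0 <> 0) by (replace (g t - 0) with (g t) by ring; exact Hg).
  replace (0 ^ 6 * g t) with (RtoC 0) by (simpl; ring).
  replace (0 ^ 4) with (RtoC 0) by (simpl; ring).
  simpl (0 + 2)%nat. simpl. field. repeat split; assumption.
Qed.

(** * Laurent expansion and huffing *)

(* The Laurent coefficients of (1 - 1/s) * sum_n u n s^n. *)
Definition huffed_coef (u : nat -> C) (n : Z) : C :=
  if (n <? 0)%Z then (if (n =? -1)%Z then - u 0%nat else RtoC 0)
  else u (Z.to_nat n) - u (S (Z.to_nat n)).

(** The principal part is the single term - u_0/s, so the part of nonnegative index sums to the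
    function plus u_0/s. Recording the two sums separately allows the average over cube roots to be
    taken on the nonnegative part alone. *)
Lemma laurent_expansion_huffed (u : nat -> C) :
  (forall s, (Cmod s < 1)%R -> Ccv (fun n => csum n (fun i => u i * s ^ i)) (approx_lim s)) ->
  (exists N : Z, forall n : Z, (n < N)%Z -> huffed_coef u n = 0) /\
  forall s, (0 < Cmod s < 1)%R ->
    is_series (V := C_NormedModule) (fun n => huffed_coef u (Z.of_nat n) * s ^ n)
      (huffed_function s + u 0%nat * / s) /\
    is_series (V := C_NormedModule) (fun n => huffed_coef u (- Z.of_nat (S n))%Z * (/ s) ^ S n)
      (- u 0%nat * / s).
Proof.
  intros Hu. split.
  - exists (-1)%Z. intros n Hn. unfold huffed_coef.
    rewrite (proj2 (Z.ltb_lt n 0)) by lia. rewrite (proj2 (Z.eqb_neq n (-1))) by lia. reflexivity.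
  - intros s Hs. assert (s0 : s <> 0) by (apply Cmod_gt_0; lra). split; apply is_series_csum.
    + rewrite huffed_function_eq by exact Hs.
      apply (Ccv_ext (fun n => csum n (fun i => u i * s ^ i)
        + - / s * (csum (S n) (fun i => u i * s ^ i) + - u 0%nat))).
      * intros n. rewrite csum_Sl.
        replace (u 0%nat * s ^ 0 + csum n (fun i => u (S i) * s ^ S i) + - u 0%nat)
          with (csum n (fun i => u (S i) * s ^ S i)) by (simpl; ring).
        rewrite <- csum_scal, <- csum_plus. apply csum_ext. intros i _. unfold huffed_coef.
        rewrite (proj2 (Z.ltb_ge (Z.of_nat i) 0)), Nat2Z.id by lia.
        rewrite Cpow_S. field. exact s0.
      * apply (Ccv_eq _ (approx_lim s + - / s * (approx_lim s + - u 0%nat))); [ring|].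
        apply Ccv_plus; [apply Hu; lra|]. apply Ccv_scal, Ccv_plus; [|apply Ccv_const].
        apply (Ccv_subseq S (fun n => csum n (fun i => u i * s ^ i))); [|apply Hu; lra].
        intros N. exists N. intros; lia.
    + apply (Ccv_ext_ev 1 (fun _ => - u 0%nat * / s)); [|apply Ccv_const].
      intros [|n] Hn; [lia|]. rewrite csum_Sl, csum_0.
      * change (huffed_coef u (- Z.of_nat 1)%Z) with (- u 0%nat). simpl. ring.
      * intros i _. unfold huffed_coef. rewrite (proj2 (Z.ltb_lt _ 0)) by lia.
        rewrite (proj2 (Z.eqb_neq _ (-1))) by lia. ring.
Qed.

Lemma omega_filter (n : nat) :
  / 3 * (1 + omega ^ n + (omega ^ 2) ^ n) = if (Z.of_nat n mod 3 =? 0)%Z then RtoC 1 else 0.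
Proof.
  assert (D := Nat.div_mod_eq n 3).
  assert (Hm : (n mod 3 < 3)%nat) by (apply Nat.mod_upper_bound; lia).
  assert (Em : (Z.of_nat n mod 3)%Z = Z.of_nat (n mod 3)) by (symmetry; apply (Nat2Z.inj_mod n 3)).
  rewrite Em.
  assert (Eo : omega ^ n = omega ^ (n mod 3)).
  { rewrite D at 1. rewrite Cpow_add_r, Cpow_mult_r, omega_3, Cpow_1_l. ring. }
  rewrite <- Cpow_mult_r, Nat.mul_comm, Cpow_mult_r, Eo.
  destruct (n mod 3)%nat as [|[|[|k]]]; [| | |lia]; simpl Z.of_nat; cbn -[Cpow Cplus Cmult Cinv omega].
  - simpl. field.
  - replace (/ 3 * (1 + omega ^ 1 + (omega ^ 1) ^ 2)) with (/ 3 * (1 + omega + omega ^ 2)) by ring.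
    rewrite omega_sum. ring.
  - replace (/ 3 * (1 + omega ^ 2 + (omega ^ 2) ^ 2))
      with (/ 3 * (1 + omega ^ 2 + omega ^ 3 * omega)) by ring.
    rewrite omega_3. replace (1 + omega ^ 2 + 1 * omega) with (1 + omega + omega ^ 2) by ring.
    rewrite omega_sum. ring.
Qed.

Lemma is_huffing_huffed (q : C) :
  (0 < Cmod q < 1)%R ->
  is_huffing huffed_function q
    (/ 3 * (huffed_function q + huffed_function (omega * q) + huffed_function (omega ^ 2 * q))).
Proof.
  intros Hq. assert (q0 : q <> 0) by (apply Cmod_gt_0; lra).
  destruct ps_approx_lim as (u & _ & _ & _ & Hu).
  destruct (laurent_expansion_huffed u Hu) as [Ha1 Ha2].
  set (a := huffed_coef u) in *.
  exists a. split; [split; [exact Ha1|]|].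
  - intros s Hs. destruct (Ha2 s Hs) as [H1 H2].
    do 2 eexists. split; [exact H1|]. split; [exact H2|]. ring.
  (* The only negative index with a possibly nonzero coefficient is -1, which 3 does not divide. *)
  - assert (Hneg : forall n, huff a (- Z.of_nat (S n))%Z = 0).
    { intros n. unfold huff, a, huffed_coef. destruct n as [|n]; [reflexivity|].
      destruct (_ =? 0)%Z; [|reflexivity].
      rewrite (proj2 (Z.ltb_lt _ 0)) by lia. rewrite (proj2 (Z.eqb_neq _ (-1))) by lia.
      reflexivity. }
    exists (/ 3 * (huffed_function q + huffed_function (omega * q) + huffed_function (omega ^ 2 * q))), 0.
    split; [|split; [|ring]]; apply is_series_csum.
    + assert (M1 : (0 < Cmod (omega * q) < 1)%R) by (rewrite Cmod_mult, Cmod_omega; lra).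
      assert (M2 : (0 < Cmod (omega ^ 2 * q) < 1)%R)
        by (rewrite Cmod_mult, Cmod_pow, Cmod_omega; lra).
      assert (S0 := proj1 (is_series_csum _ _) (proj1 (Ha2 q Hq))).
      assert (S1 := proj1 (is_series_csum _ _) (proj1 (Ha2 _ M1))).
      assert (S2 := proj1 (is_series_csum _ _) (proj1 (Ha2 _ M2))).
      assert (o0 := omega_neq_0).
      eapply Ccv_ext; [|eapply Ccv_eq;
        [|apply (Ccv_scal (/ 3)), (Ccv_plus _ _ _ _ (Ccv_plus _ _ _ _ S0 S1) S2)]].
      * intros n. cbv beta. rewrite <- !csum_plus, <- csum_scal. apply csum_ext. intros i _.
        rewrite (Cpow_mult_l omega q i), (Cpow_mult_l (omega ^ 2) q i).
        transitivity (/ 3 * (1 + omega ^ i + (omega ^ 2) ^ i) * (a (Z.of_nat i) * q ^ i)); [ring|].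
        rewrite omega_filter. unfold huff. destruct (_ =? 0)%Z; ring.
      (* The corrections u_0/s at the three points cancel, because the inverse cube roots of unity
         also sum to 0. *)
      * assert (Ez : / q + / (omega * q) + / (omega ^ 2 * q) = 0).
        { replace (/ q + / (omega * q) + / (omega ^ 2 * q))
            with ((1 + omega + omega ^ 2) * / (omega ^ 2 * q)) by (field; split; assumption).
          rewrite omega_sum. ring. }
        transitivity (/ 3 * (huffed_function q + huffed_function (omega * q)
          + huffed_function (omega ^ 2 * q)
          + u 0%nat * (/ q + / (omega * q) + / (omega ^ 2 * q)))); [ring|].
        rewrite Ez. ring.
    + apply (Ccv_ext (fun _ => 0)); [|apply Ccv_const].
      intros n. symmetry. apply csum_0. intros i _. rewrite Hneg. ring.
Qed.

(** At q = 0 only the coefficient of index 0 survives. It is u_0 - u_1 = 1 - 0, which uses the two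
    coefficients tracked by [ps]. *)
Lemma is_huffing_huffed_0 : is_huffing huffed_function 0 1.
Proof.
  destruct ps_approx_lim as (u & Hu0 & Hu1 & _ & Hu).
  destruct (laurent_expansion_huffed u Hu) as [Ha1 Ha2].
  set (a := huffed_coef u) in *.
  exists a. split; [split; [exact Ha1|]|].
  - intros s Hs. destruct (Ha2 s Hs) as [H1 H2].
    do 2 eexists. split; [exact H1|]. split; [exact H2|]. ring.
  - exists 1, 0. split; [|split; [|ring]]; apply is_series_csum.
    + apply (Ccv_ext_ev 1 (fun _ => 1)); [|apply Ccv_const].
      intros [|n] Hn; [lia|]. rewrite csum_Sl, csum_0.
      * change (huff a (Z.of_nat 0)) with (u 0%nat - u 1%nat). rewrite Hu0, Hu1. simpl. ring.
      * intros i _. rewrite Cpow_S. ring.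
    + apply (Ccv_ext (fun _ => 0)); [|apply Ccv_const].
      intros n. symmetry. apply csum_0. intros i _.
      (* By the convention 1/0 = 0 every term of negative index vanishes at q = 0. *)
      assert (E : / (RtoC 0) = 0) by (apply injective_projections; simpl; unfold Rdiv; ring).
      rewrite E, Cpow_S. ring.
Qed.

Theorem theorem3p1 (q : C) (g : R -> C) :
  (Cmod q < 1)%R ->
  simple_closed_contour g ->
  separates_0_from_poles g (integrand q) ->
  exists l : C,
    is_contour_integral g (integrand q) l /\
    is_huffing huffed_function q l.
Proof.
  intros Hq Hg Hs.
  destruct (Rle_lt_or_eq_dec 0 (Cmod q) (Cmod_ge_0 q)) as [H0|H0].
  - exists (/ 3 * (huffed_function q + huffed_function (omega * q) + huffed_function (omega ^ 2 * q))).
    split; [apply contour_integral_integrand | apply is_huffing_huffed]; (assumption || lra).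
  - symmetry in H0. apply Cmod_eq_0 in H0. rewrite H0 in *. exists 1. split.
    + apply contour_integral_integrand_0; [exact Hg | apply Hs].
    + apply is_huffing_huffed_0.
Qed.
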